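(* Suppose that $\lambda_n\to\lambda\in[0,1]$, $\Delta_n\to\Delta\in[0,1]$ and $\kappa_n\to\kappa\in[0,\infty]$, and let $\beta_c=1-\Delta-\kappa^{-1}$ (with $1/\infty=0$). Consider the regimes: (B) $\Delta\in[0,1)$ and $\lambda\in[0,1)$; (C.i) $\lambda=1$ and $\kappa=\infty$; (C.ii) $\lambda=1$ and $\kappa\in(1,\infty)$. (Discontinuous phase transition) In regimes (B) and (C.i), there is a universal constant $C>0$ such that for every constant $\delta>0$ there is a constant $\beta>0$ with $|\beta-\beta_c|<\delta$ and $\frac1nW_1(\mu_{G_n,\beta},\mu_{G_n,\beta_c})\ge C$ with probability at least $1-o(1)$. (Continuous phase transition) In regime (C.ii), for any constant $\delta>0$, every $\beta>0$ with $|\beta-\beta_c|<\delta$ satisfies $\frac1nW_1(\mu_{G_n,\beta},\mu_{G_n,\beta_c})\le\kappa\sqrt{12\delta}$ with probability at least $1-o(1)$.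
   Context: Let $(\alpha_n)$ be a sequence in $(0,\infty)$ with $0<\liminf\alpha_n\le\limsup\alpha_n<\infty$, $q_n=\alpha_n\log n/n$, $G_n\sim\mathcal G(n,q_n)$ on $\{1,\dots,n\}$. Let $\ell_n^*=\log n/\log(nq_n)$, $d_n^*=\min\{d\in\mathbb Z:(nq_n)^d\ge n/(\log\log n)^2\}$, $\Delta_n=d_n^*-\ell_n^*$, $\lambda_n\in(0,1)$ with $\log(1/\lambda_n)=(nq_n)^{d_n^*}/n$, and $\kappa_n=(1-\lambda_n)\log\log n$. Let $\overline G_n$ be the component of $G_n$ containing $1$, vertex set $\overline V_n$. For $\beta>0$ the Gibbs measure on spanning trees $T$ of $\overline G_n$ is $\mu_{G_n,\beta}(T)\propto\exp\big(-\beta\log\log(n)\sum_{v\in\overline V_n}\mathsf d_T(1,v)\big)$. Trees are rooted at $1$; $W_1$ is the $1$-Wasserstein distance for the metric $d(T,T')=\#\{v\ne1:\text{the parent of }v\text{ differs in }T\text{ and }T'\}$. *)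

(* Defs.v *)
From mathcomp Require Import all_boot all_order all_algebra.
From mathcomp Require Import all_classical all_reals all_analysis.

Set Implicit Arguments.
Unset Strict Implicit.
Unset Printing Implicit Defensive.

Import Order.TTheory GRing.Theory Num.Theory.
Import numFieldNormedType.Exports.

Local Open Scope classical_set_scope.
Local Open Scope ring_scope.

Section Graphs.
Variable V : finType.

(* A simple graph on V is the set of its edges, i.e. a set of 2-element
   subsets of V. *)
Definition graph := {set {set V}}.

Definition all_edges : graph := [set e : {set V} | #|e| == 2]%SET.

Definition adj (G : graph) : rel V := fun u v => [set u; v]%SET \in G.

Definition has_walk (G : graph) (u v : V) (k : nat) : bool :=
  [exists p : k.-tuple V, path (adj G) u p && (last u p == v)].

(* Least length of a walk from u to v; equal to #|V| if there is none. *)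
Definition gdist (G : graph) (u v : V) : nat :=
  find (has_walk G u v) (iota 0 #|V|).

Definition acyclic (G : graph) : Prop :=
  forall c : seq V, uniq c -> (2 < size c)%N -> ~~ cycle (adj G) c.

Variable r : V.

Definition component (G : graph) : {set V} := [set v | connect (adj G) r v]%SET.

Definition component_edges (G : graph) : graph :=
  [set e in G | e \subset component G]%SET.

Definition spanning_tree (G T : graph) : Prop :=
  [/\ T \subset component_edges G,
      {in component G &, forall u v, connect (adj T) u v} &
      acyclic T].

(* In a tree rooted at r, the parent of v != r is its neighbour that is closer
   to r. The value is None at r and outside the vertex set of the tree. *)
Definition parent (T : graph) (v : V) : option V :=
  [pick u | adj T u v && ((gdist T r u).+1 == gdist T r v)].

Definition tree_dist (T T' : graph) : nat :=
  #|[set v | (v != r) && (parent T v != parent T' v)]%SET|.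

Variable R : realType.

Definition gibbs_weight (b : R) (G T : graph) : R :=
  expR (- b * (\sum_(v in component G) gdist T r v)%N%:R).

Definition gibbs (b : R) (G T : graph) : R :=
  if `[< spanning_tree G T >] then
    gibbs_weight b G T /
      \sum_(T' : graph | `[< spanning_tree G T' >]) gibbs_weight b G T'
  else 0.

(* Law of the Erdos-Renyi graph: each pair is an edge independently with
   probability q. It is a probability only for 0 <= q <= 1. *)
Definition er_prob (q : R) (A : graph -> Prop) : R :=
  \sum_(G in powerset all_edges | `[< A G >])
    \prod_(e in all_edges) (if e \in G then q else 1 - q).

End Graphs.

Section Wasserstein.
Variables (R : realType) (X : finType).

Definition coupling (mu nu : X -> R) (pi : X -> X -> R) : Prop :=
  [/\ forall x y, 0 <= pi x y,
      forall x, \sum_y pi x y = mu x &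
      forall y, \sum_x pi x y = nu y].

Definition wasserstein1 (d : X -> X -> R) (mu nu : X -> R) : R :=
  inf [set \sum_x \sum_y pi x y * d x y | pi in coupling mu nu].

End Wasserstein.

Section Sequences.
Variables (R : realType) (alpha : nat -> R).

Definition edge_prob (n : nat) : R := alpha n * ln n%:R / n%:R.

Definition mean_degree (n : nat) : R := n%:R * edge_prob n.

Definition ell_star (n : nat) : R := ln n%:R / ln (mean_degree n).

Definition d_star_set (n : nat) : set int :=
  [set d : int | n%:R / ln (ln n%:R) ^+ 2 <= mean_degree n ^ d].

(* The least element of d_star_set n, which exists for all large n. *)
Definition d_star (n : nat) : int :=
  xget 0 [set d : int | d_star_set n d /\ forall d', d_star_set n d' -> d <= d'].

Definition Delta_seq (n : nat) : R := (d_star n)%:~R - ell_star n.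

(* The solution of ln (1 / lambda) = mean_degree n ^ d_star n / n. *)
Definition lambda_seq (n : nat) : R :=
  expR (- (mean_degree n ^ d_star n / n%:R)).

Definition kappa_seq (n : nat) : R := (1 - lambda_seq n) * ln (ln n%:R).

(* The graph on n.+1 vertices has law G(n.+1, edge_prob n.+1), so that the
   distinguished vertex is always available as ord0. *)
Definition whp (A : forall n, graph 'I_n.+1 -> Prop) : Prop :=
  er_prob (edge_prob n.+1) (A n) @[n --> \oo] --> (1 : R).

End Sequences.

Definition gibbs_measure (R : realType) (n : nat) (beta : R)
    (G : graph 'I_n.+1) : graph 'I_n.+1 -> R :=
  gibbs ord0 (beta * ln (ln n.+1%:R)) G.

(* W_1(mu_{G,beta}, mu_{G,beta'}) / N where N = n.+1 is the number of
   vertices. *)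
Definition normalized_W1 (R : realType) (n : nat) (G : graph 'I_n.+1)
    (beta beta' : R) : R :=
  wasserstein1 (fun T T' => (tree_dist ord0 T T')%:R)
    (gibbs_measure beta G) (gibbs_measure beta' G) / n.+1%:R.

Section Assumptions.
Variables (R : realType) (alpha : nat -> R) (lambda Delta : R) (kappa : \bar R).

Definition standing_assumptions : Prop :=
  [/\ forall n, 0 < alpha n,
      (0 < limn_einf (fun n => (alpha n)%:E))%E &
      (limn_esup (fun n => (alpha n)%:E) < +oo)%E].

Definition parameter_limits : Prop :=
  [/\ 0 <= lambda <= 1 /\ lambda_seq alpha n @[n --> \oo] --> lambda,
      0 <= Delta <= 1 /\ Delta_seq alpha n @[n --> \oo] --> Delta &
      (0 <= kappa)%E /\ (kappa_seq alpha n)%:E @[n --> \oo] --> kappa].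

Definition regime_B : Prop := 0 <= Delta < 1 /\ 0 <= lambda < 1.
Definition regime_Ci : Prop := lambda = 1 /\ kappa = +oo%E.
Definition regime_Cii : Prop := lambda = 1 /\ (1 < kappa < +oo)%E.

(* The extended-real inverse satisfies +oo^-1 = 0; kappa <> 0 in every regime
   in which beta_c is used. *)
Definition beta_c : R := 1 - Delta - fine (kappa^-1)%E.

End Assumptions.

(* Main.v *)
Require Import Defs.
From mathcomp Require Import all_boot all_order all_algebra.
From mathcomp Require Import all_classical all_reals all_analysis.
From mathcomp Require Import fintype finset zify ring lra.


(** A spanning tree rooted at [r] is a depth function [h] together with a choice,
    for every non-root vertex, of a parent one level up; the number of trees with
    depths [h] is the product over [v] of the number of neighbours of [v] at depth
    [h v - 1].  In the random graph almost all vertices lie at distance [D = d_star]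
    or [D + 1] from the root, so the Gibbs measure is governed by the set [X] of the
    vertices of layer [D] that keep depth [D].  A vertex of [X] gains
    [exp ((beta + Delta - 1) ln ln n)] from its own position, and every other vertex
    chooses its parent among its neighbours in [X], which contributes [|X|^n].

    When [kappa_n -> oo], below [beta_c = 1 - Delta] the weight concentrates on
    [|X| <= K' n / ln ln n], whereas at [beta_c] one has [|X| >= M n / ln ln n] for
    [M] as large as we please.  A small set [S] then captures at most half of the parents
    under the critical measure and almost all of them under the subcritical one, so
    any coupling moves a positive fraction of the parents.

    When [kappa] is finite the geodesic depths dominate.  Removing a fraction [u] of
    layer [D] costs [n (kappa (1 - beta) u + ln (1 - u))] in the exponent, which is
    negative as soon as [u > 4 kappa (beta_c - beta)]; the two measures are therefore
    both close to the uniform choice of geodesic parents, and parents can be coupled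
    vertex by vertex. *)

Set Implicit Arguments.
Unset Strict Implicit.
Unset Printing Implicit Defensive.

Import Order.TTheory GRing.Theory Num.Theory.
Import numFieldNormedType.Exports.

Local Open Scope ring_scope.

(** * Spanning trees as depth and parent functions *)

(** Most estimates on the Gibbs measure may lose a factor exponential in [n]: the union bound over
    [X] costs [2 ^+ #|V|], degrees are known up to a constant [K], and products of degrees are
    bounded by means. Only the power of [log n] attached to each vertex of [X] has to be exact; the
    constants are absorbed by choosing [K'], [M] and [M1] in this order, each large in terms of the
    preceding ones. For finite kappa this tolerance is too coarse, since the competing terms are
    themselves of order [n]. There the sums are normalised by the number of geodesic parent choices,
    the union bound runs over subsets of a layer with [o(n)] vertices, and the second order term of
    [ln (1 - u)] decides. Randomness enters through three properties only: the maximal degree, the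
    number of edges between all pairs of large disjoint sets, and the layer sizes. Everything else
    is deterministic for a fixed graph. *)

Section Walks.
Variable V : finType.
Implicit Types (G T : graph V) (u v x y r : V) (p : seq V) (k : nat).
Local Open Scope nat_scope.

Lemma adj_sym G : symmetric (adj G).
Proof. by move=> u v; rewrite /adj finset.setUC. Qed.

Lemma has_walkP G u v k :
  reflect (exists p, [/\ size p = k, path (adj G) u p & last u p = v])
          (has_walk G u v k).
Proof.
apply: (iffP existsP) => [[p /andP[pP /eqP lp]]|[p [sp pP lp]]].
  by exists p; rewrite size_tuple.
by have/eqP sp' := sp; exists (Tuple sp'); rewrite /= pP lp eqxx.
Qed.

Lemma gdist_le_card G u v : gdist G u v <= #|V|.
Proof. by rewrite -[leqRHS](size_iota 0) find_size. Qed.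

Lemma gdist_has_walk G u v : gdist G u v < #|V| -> has_walk G u v (gdist G u v).
Proof.
rewrite -[ltnRHS](size_iota 0) /gdist -has_find => hf.
have := nth_find 0 hf; rewrite nth_iota ?add0n //.
by move: hf; rewrite has_find size_iota.
Qed.

Lemma gdist_le_walk G u p : path (adj G) u p -> gdist G u (last u p) <= size p.
Proof.
move=> pP; case: (ltnP (size p) #|V|) => [sp|]; last first.
  exact/leq_trans/gdist_le_card.
rewrite leqNgt; apply/negP => lt.
have := before_find 0 lt; rewrite nth_iota // add0n => /negbT/negP; apply.
by apply/has_walkP; exists p.
Qed.

Lemma gdistxx G u : gdist G u u = 0.
Proof. by apply/eqP; rewrite -leqn0; apply: (@gdist_le_walk G u [::]). Qed.

(** A path without repetition has fewer than [#|V|] edges, so the default value [#|V|] of [gdist] is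
    never a genuine distance. *)
Lemma connect_gdist G u v : connect (adj G) u v = (gdist G u v < #|V|).
Proof.
apply/idP/idP => [/connectP[p pP ->]|/gdist_has_walk /has_walkP[p [_ pP <-]]].
  case/shortenP: pP => p' pP' up' _.
  apply: leq_ltn_trans (gdist_le_walk pP') _.
  by have := card_uniqP up' => /= <-; apply: max_card.
by apply/connectP; exists p.
Qed.

Lemma gdist_adj G r x y : adj G x y -> gdist G r y <= (gdist G r x).+1.
Proof.
move=> xy; case: (ltnP (gdist G r x) #|V|) => [|h]; last first.
  exact: leq_trans (gdist_le_card _ _ _) (leqW h).
move=> /gdist_has_walk/has_walkP[p [sp pP lp]].
have := @gdist_le_walk G r (rcons p y); rewrite last_rcons size_rcons sp.
by apply; rewrite rcons_path pP lp.
Qed.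

(** The bound [k.+1 < #|V|] rules out the default distance, for which there is no walk whose last
    step could be removed. *)
Lemma gdist_pred G r v k : gdist G r v = k.+1 -> k.+1 < #|V| ->
  exists2 u, adj G u v & gdist G r u = k.
Proof.
move=> dv lt; have := @gdist_has_walk G r v; rewrite dv => /(_ lt).
case/has_walkP => p; case/lastP: p => [|p x] [] //; rewrite size_rcons => -[sp].
rewrite rcons_path last_rcons => /andP[pP a] xv; rewrite xv in a.
exists (last r p) => //; apply/eqP; rewrite eqn_leq.
have := gdist_le_walk pP; rewrite sp => -> /=.
by have := gdist_adj r a; rewrite dv.
Qed.

Lemma gdist_eq0 G r v : (gdist G r v == 0) = (v == r).
Proof.
apply/eqP/eqP => [d|->]; last exact: gdistxx.
have := @gdist_has_walk G r v; rewrite d.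
have -> : 0 < #|V| by apply/card_gt0P; exists r.
by case/(_ isT)/has_walkP => p [/size0nil -> _ /= ->].
Qed.

End Walks.

Section Trees.
Variables (V : finType) (r : V) (G : graph V).
Hypothesis Gsub : G \subset all_edges V.
Local Notation comp := (component r G).
Local Open Scope nat_scope.

Definition nonroot : {set V} := comp :\ r.

Definition depth_fun := {ffun V -> 'I_#|V|.+1}.

(** Fixing the value off the component makes the depth function of a tree unique, so sums over depth
    functions count each tree once. *)
Definition valid_depth (h : depth_fun) : bool :=
  (h r == 0 :> nat) && [forall v, (v \notin comp) ==> (h v == #|V| :> nat)].

Definition parents (h : depth_fun) (v : V) : {set V} :=
  [set u | adj G u v && ((h u).+1 == h v :> nat)]%SET.

(* The vertices without a parent are their own image. *)
Definition parent_pred (h : depth_fun) (v : V) : pred V :=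
  [pred u | if v \in nonroot then u \in parents h v else u == v].

Lemma parent_predE h v u :
  parent_pred h v u = if v \in nonroot then u \in parents h v else u == v.
Proof. by []. Qed.

Definition tree_of (p : {ffun V -> V}) : graph V :=
  [set [set v; p v] | v in nonroot]%SET.

(** [T] need not be a tree: applied to the ambient graph this is the geodesic depth function, used
    later as a reference. *)
Definition depth (T : graph V) : depth_fun := [ffun v => inord (gdist T r v)].

Definition parent_fun (T : graph V) : {ffun V -> V} :=
  [ffun v => odflt v (parent r T v)].

Lemma depthE T v : depth T v = gdist T r v :> nat.
Proof. by rewrite ffunE inordK // ltnS gdist_le_card. Qed.

Lemma root_in_comp : r \in comp.
Proof. by rewrite inE connect0. Qed.

Lemma comp_adj u v : adj G u v -> (u \in comp) = (v \in comp).
Proof.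
move=> uv; rewrite !inE; apply/idP/idP => c; apply: connect_trans c (connect1 _) => //.
by rewrite adj_sym.
Qed.

Lemma set2_eq (a b c d : V) : [set a; b]%SET = [set c; d]%SET ->
  (a = c /\ b = d) \/ (a = d /\ b = c).
Proof.
move=> e.
have /set2P ha : a \in [set c; d]%SET by rewrite -e set21.
have /set2P hb : b \in [set c; d]%SET by rewrite -e set22.
have /set2P hc : c \in [set a; b]%SET by rewrite e set21.
have /set2P hd : d \in [set a; b]%SET by rewrite e set22.
by intuition congruence.
Qed.

Section OfParents.
Variables (h : depth_fun) (p : {ffun V -> V}).
Hypotheses (hok : valid_depth h) (pfam : p \in family (parent_pred h)).

Lemma family_adj v : v \in nonroot -> adj G (p v) v.
Proof. by move=> vn; have /familyP/(_ v) := pfam; rewrite inE vn inE => /andP[]. Qed.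

Lemma family_depth v : v \in nonroot -> (h (p v)).+1 = h v :> nat.
Proof.
by move=> vn; have /familyP/(_ v) := pfam; rewrite inE vn inE => /andP[_ /eqP].
Qed.

Lemma family_id v : v \notin nonroot -> p v = v.
Proof.
by move=> /negPf vn; have /familyP/(_ v) := pfam; rewrite inE vn => /eqP.
Qed.

Lemma family_comp v : v \in comp -> p v \in comp.
Proof.
move=> vc; case: (boolP (v \in nonroot)) => vn; last by rewrite family_id.
by rewrite (comp_adj (family_adj vn)).
Qed.

Lemma depth_root : h r = 0 :> nat.
Proof. by case/andP: hok => /eqP. Qed.

Lemma tree_of_adj u v : adj (tree_of p) u v ->
  (u \in nonroot /\ v = p u) \/ (v \in nonroot /\ u = p v).
Proof. by case/imsetP => w wn /set2_eq[[-> ->]|[-> ->]]; auto. Qed.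

Lemma tree_of_parent v : v \in nonroot -> adj (tree_of p) (p v) v.
Proof. by move=> vn; rewrite adj_sym; apply/imsetP; exists v. Qed.

Lemma nonroot_comp v : v \in nonroot -> v \in comp.
Proof. by case/setD1P. Qed.

Lemma tree_of_sub : tree_of p \subset component_edges r G.
Proof.
apply/fintype.subsetP => e /imsetP[v vn ->]; rewrite inE.
have := family_adj vn; rewrite adj_sym {1}/adj => -> /=.
apply/fintype.subsetP => w /set2P[] ->; first exact: nonroot_comp.
exact/family_comp/nonroot_comp.
Qed.

Lemma tree_of_walk k v : v \in comp -> h v = k :> nat ->
  exists q, [/\ size q = k, path (adj (tree_of p)) r q & last r q = v].
Proof.
elim: k v => [|k IH] v vc hv.
  exists [::]; split=> //=; case: (eqVneq v r) => [-> //|vr].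
  by have := @family_depth v; rewrite hv in_setD1 vr vc => /(_ isT).
have vn : v \in nonroot.
  by rewrite in_setD1 vc andbT; apply: contraPneq hv => ->; rewrite depth_root.
have [|q [sq qP lq]] := IH (p v) (family_comp vc).
  by have := family_depth vn; rewrite hv => -[].
exists (rcons q v); rewrite size_rcons sq last_rcons rcons_path qP lq /=.
by split=> //; apply: tree_of_parent.
Qed.

(** The depth changes by exactly one along a parent edge. This bounds the tree distance to the root
    below by [h]; [tree_of_walk] gives the opposite bound. *)
Lemma tree_of_depth_lip u q :
  path (adj (tree_of p)) u q -> h (last u q) <= h u + size q.
Proof.
elim: q u => [|x q IH] u /=; first by rewrite addn0.
case/andP=> ux /IH hl; suff hx : h x <= (h u).+1.
  by rewrite addnS -addSn (leq_trans hl) // leq_add2r.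
by case/tree_of_adj: ux => -[/family_depth]; [move=> + -> | move=> + ->]; lia.
Qed.

Lemma tree_of_gdist v : gdist (tree_of p) r v = h v :> nat.
Proof.
case: (boolP (v \in comp)) => vc; last first.
  have /andP[_ /forallP/(_ v)/implyP/(_ vc)/eqP ->] := hok.
  apply/eqP; rewrite eqn_leq gdist_le_card leqNgt -connect_gdist.
  apply: contra vc; rewrite inE; apply: connect_sub => x y xy.
  apply: connect1; have /fintype.subsetP := tree_of_sub.
  by move=> /(_ _ xy); rewrite inE => /andP[].
have [q [sq qP lq]] := tree_of_walk vc erefl.
apply/eqP; rewrite eqn_leq; apply/andP; split.
  by have := gdist_le_walk qP; rewrite lq sq.
have /gdist_has_walk/has_walkP[q' [<- q'P <-]] : gdist (tree_of p) r v < #|V|.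
  by rewrite -connect_gdist; apply/connectP; exists q.
by have := tree_of_depth_lip q'P; rewrite depth_root.
Qed.

Lemma depth_tree_of : depth (tree_of p) = h.
Proof. by apply/ffunP => v; apply/val_inj; rewrite /= depthE tree_of_gdist. Qed.

Lemma tree_of_connected : {in comp &, forall u v, connect (adj (tree_of p)) u v}.
Proof.
have c v : v \in comp -> connect (adj (tree_of p)) r v.
  by move=> vc; have [q [_ qP lq]] := tree_of_walk vc erefl; apply/connectP; exists q.
move=> u v uc vc; apply: connect_trans (c v vc).
by rewrite (sym_connect_sym (@adj_sym _ _)) c.
Qed.

(** At a vertex of maximal depth on a cycle both cycle neighbours must be its parent, since its
    children are deeper; but on a cycle of length at least three they are distinct. *)
Lemma tree_of_acyclic : acyclic (tree_of p).
Proof.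
move=> c uc sc; apply/negP => cyc.
have c0 : exists x, x \in c by case: c sc {uc cyc} => // x c _; exists x; rewrite mem_head.
have [x0 x0c] := c0.
have [v vc vmax] : exists2 v, v \in c & forall u, u \in c -> h u <= h v.
  by case: (@arg_maxnP _ x0 (mem c) (fun v => h v : nat) x0c) => v vc vm; exists v.
case: (rot_to vc) => i c' ci.
have uc' : uniq (v :: c') by rewrite -ci rot_uniq.
have sc' : 2 < size (v :: c') by rewrite -ci size_rot.
have {}cyc : cycle (adj (tree_of p)) (v :: c') by rewrite -ci rot_cycle.
have up x : x \in v :: c' -> adj (tree_of p) v x -> x = p v.
  rewrite -ci mem_rot => xc /tree_of_adj[[]//|[/family_depth e e']].
  by have := vmax _ xc; rewrite e' in e *; lia.
case: c' uc' sc' cyc {ci} up => [//|a s]; case/lastP: s => [//|s z].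
rewrite /= mem_rcons !inE !negb_or => /and3P[_ /andP[az _] _] _.
rewrite rcons_path last_rcons => /and3P[va _ zv] up.
move/eqP: az; apply; rewrite (up a) ?inE ?eqxx ?orbT //.
by rewrite -(up z) ?inE ?mem_rcons ?inE ?eqxx ?orbT // adj_sym.
Qed.

Lemma tree_of_spanning : spanning_tree r G (tree_of p).
Proof.
split; [exact: tree_of_sub|exact: tree_of_connected|exact: tree_of_acyclic].
Qed.

Lemma tree_of_parentE v :
  parent r (tree_of p) v = if v \in nonroot then Some (p v) else None.
Proof.
rewrite /parent; case: pickP => [u /andP[uv]|none].
  rewrite !tree_of_gdist => /eqP huv.
  case/tree_of_adj: uv => -[vn e]; last by rewrite vn e.
  by have := family_depth vn; rewrite -e -huv; lia.
case: ifP => // vn; have := none (p v).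
by rewrite tree_of_parent //= !tree_of_gdist family_depth // eqxx.
Qed.

Lemma parent_fun_tree_of : parent_fun (tree_of p) = p.
Proof.
apply/ffunP => v; rewrite ffunE tree_of_parentE; case: ifP => //= /negbT vn.
by rewrite family_id.
Qed.

End OfParents.

Section OfTree.
Variable T : graph V.
Hypothesis sT : spanning_tree r G T.

Lemma spanning_subG : T \subset G.
Proof.
case: sT => /fintype.subsetP sub _ _; apply/fintype.subsetP => e /sub.
by rewrite inE => /andP[].
Qed.

Lemma spanning_adj_comp u v : adj T u v -> v \in comp.
Proof.
case: sT => /fintype.subsetP sub _ _ /sub.
by rewrite inE => /andP[_ /fintype.subsetP]; apply; rewrite set22.
Qed.

Lemma spanning_gdist_lt v : (gdist T r v < #|V|) = (v \in comp).
Proof.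
rewrite -connect_gdist; apply/idP/idP => [|vc].
  rewrite inE; apply: connect_sub => x y xy; apply: connect1.
  exact: (fintype.subsetP spanning_subG).
by case: sT => _ c _; apply: c => //; apply: root_in_comp.
Qed.

Lemma valid_depth_tree : valid_depth (depth T).
Proof.
rewrite /valid_depth depthE gdistxx eqxx /=; apply/forallP => v.
apply/implyP; rewrite -spanning_gdist_lt -leqNgt depthE => ge.
by rewrite eqn_leq gdist_le_card.
Qed.

Lemma parent_spanning v : v \in nonroot ->
  exists u, [/\ parent r T v = Some u, adj T u v & (gdist T r u).+1 = gdist T r v].
Proof.
case/setD1P => vr vc; rewrite /parent; case: pickP => [u /andP[uv /eqP e]|].
  by exists u.
case e: (gdist T r v) => [|k]; first by move/eqP: e; rewrite gdist_eq0 (negPf vr).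
have [||u uv <- /(_ u)] := @gdist_pred _ T r v k; rewrite ?uv ?eqxx //.
by rewrite -e spanning_gdist_lt.
Qed.

Lemma parent_spanning_none v : v \notin nonroot -> parent r T v = None.
Proof.
rewrite in_setD1 negb_and negbK /parent => vn; case: pickP => // u /andP[uv /eqP e].
case/orP: vn => [/eqP vr|/negP[]]; last exact: spanning_adj_comp uv.
by move: e; rewrite vr gdistxx.
Qed.

Lemma parent_spanningE v :
  parent r T v = if v \in nonroot then Some (parent_fun T v) else None.
Proof.
case: ifP => [vn|/negbT/parent_spanning_none //].
by rewrite ffunE; have [u [-> _ _]] := parent_spanning vn.
Qed.

Lemma parent_fun_family : parent_fun T \in family (parent_pred (depth T)).
Proof.
apply/familyP => v; rewrite inE ffunE; case: ifP => [vn|/negbT vn].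
  have [u [-> uv e]] := parent_spanning vn; rewrite /= !inE !depthE e eqxx andbT.
  exact: (fintype.subsetP spanning_subG).
by rewrite parent_spanning_none.
Qed.

Lemma parent_fun_parents v : v \in nonroot -> parent_fun T v \in parents (depth T) v.
Proof. by move=> vn; have /familyP/(_ v) := parent_fun_family; rewrite inE vn. Qed.

(* An edge of [T] missing from the parent edges would close a cycle with the
   path joining its endpoints in the spanning tree of parent edges. *)
Lemma tree_of_parent_fun : tree_of (parent_fun T) = T.
Proof.
have sub : tree_of (parent_fun T) \subset T.
  apply/fintype.subsetP => e /imsetP[v vn ->]; rewrite ffunE.
  by have [u [-> uv _]] := parent_spanning vn; rewrite adj_sym in uv.
apply/eqP; rewrite eqEsubset sub /=; apply/fintype.subsetP => e eT.
have eG := fintype.subsetP spanning_subG e eT.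
have /cards2P[x [y [xy exy]]] : #|e| == 2 by have := fintype.subsetP Gsub e eG; rewrite inE.
have xyT : adj T x y by rewrite /adj -exy.
have yc := spanning_adj_comp xyT.
have xc : x \in comp by rewrite adj_sym in xyT; apply: spanning_adj_comp xyT.
have := tree_of_connected valid_depth_tree parent_fun_family xc yc.
case/connectP => q qP yq; move: yq; case: (shortenP qP) => q' q'P uq' _ yq.
case: q' q'P uq' yq => [|z [|z' q']] q'P uq' yq.
- by rewrite yq eqxx in xy.
- by move: q'P; rewrite /= andbT exy yq.
case: sT => _ _ /(_ (x :: z :: z' :: q') uq' isT)/negP[].
rewrite /cycle rcons_path -yq adj_sym xyT andbT.
by apply: sub_path q'P => a b; apply: (fintype.subsetP sub).
Qed.

End OfTree.

(** [tree_of] is a bijection from admissible pairs of depths and parents onto spanning trees, with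
    inverse given by [depth] and [parent_fun]. Sums over trees are evaluated through this change of
    variables. *)
Lemma sum_spanning_trees (R : nmodType) (F : depth_fun -> {ffun V -> V} -> R) :
  (\sum_(T : graph V | `[< spanning_tree r G T >]) F (depth T) (parent_fun T) =
   \sum_(h | valid_depth h) \sum_(p in family (parent_pred h)) F h p)%R.
Proof.
rewrite (partition_big depth valid_depth) => [|T /asboolP]; last exact: valid_depth_tree.
apply: eq_bigr => h hok.
rewrite (reindex_onto tree_of parent_fun) => [|T /andP[/asboolP sT _]]; last first.
  exact: tree_of_parent_fun.
apply: eq_big => [p|p pf]; last first.
  case/andP: pf => /andP[/asboolP _ /eqP ->] /eqP -> //.
apply/idP/idP => [/andP[/andP[/asboolP sT /eqP <-] /eqP <-]|pf].
  by rewrite (tree_of_parent_fun sT); apply: parent_fun_family.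
rewrite (parent_fun_tree_of hok pf) (depth_tree_of hok pf) !eqxx !andbT.
by apply/asboolP; apply: tree_of_spanning hok pf.
Qed.

Lemma tree_distE T T' : spanning_tree r G T -> spanning_tree r G T' ->
  tree_dist r T T' =
  #|[set v in nonroot | parent_fun T v != parent_fun T' v]%SET|.
Proof.
move=> sT sT'; apply: eq_card => v; rewrite [LHS]in_set [RHS]in_set.
rewrite (parent_spanningE sT) (parent_spanningE sT').
case: ifP => vn; last by rewrite eqxx andbF.
by move: vn; rewrite in_setD1 => /andP[-> _].
Qed.

End Trees.

(** * Gibbs measures and their couplings *)

Section MaximalCoupling.
Variables (R : realType) (U : finType).
Implicit Types (p q : U -> R) (A B C : {set U}).

(** One minus the total variation distance, when [p] and [q] are probabilities. *)
Definition overlap p q : R := \sum_u Num.min (p u) (q u).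

(** The common mass stays on the diagonal and the two residual masses are coupled as a normalised
    product. If the overlap is [1] the quotient is [0] by convention, and the residuals vanish as
    well. *)
Definition max_coupling p q (u u' : U) : R :=
  (if u == u' then Num.min (p u) (q u) else 0) +
  (p u - Num.min (p u) (q u)) * (q u' - Num.min (p u') (q u')) / (1 - overlap p q).

Lemma overlapC p q : overlap p q = overlap q p.
Proof. by apply: eq_bigr => u _; rewrite minC. Qed.

Lemma overlap_le1 p q : \sum_u p u = 1 -> overlap p q <= 1.
Proof. by move=> <-; apply: ler_sum => u _; rewrite ge_min lexx. Qed.

Lemma max_couplingC p q u u' : max_coupling p q u u' = max_coupling q p u' u.
Proof.
rewrite /max_coupling overlapC eq_sym [_ * (q u' - _)]mulrC; congr (_ + _).
  by case: eqP => // ->; rewrite minC.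
by rewrite ![Num.min (p _) _]minC.
Qed.

Lemma max_coupling_ge0 p q u u' :
  (forall x, 0 <= p x) -> (forall x, 0 <= q x) -> \sum_x p x = 1 ->
  0 <= max_coupling p q u u'.
Proof.
move=> p0 q0 p1; apply: addr_ge0; first by case: ifP; rewrite ?le_min ?p0 ?q0.
apply: divr_ge0; last by rewrite subr_ge0 overlap_le1.
by apply: mulr_ge0; rewrite subr_ge0 ge_min lexx ?orbT.
Qed.

Lemma max_coupling_suml p q u :
  \sum_x p x = 1 -> \sum_x q x = 1 -> \sum_u' max_coupling p q u u' = p u.
Proof.
move=> p1 q1; rewrite big_split /= -big_mkcond /= (big_pred1 u) => [|x]; last first.
  by rewrite eq_sym.
have -> : \sum_u' (p u - Num.min (p u) (q u)) * (q u' - Num.min (p u') (q u')) /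
    (1 - overlap p q) = (p u - Num.min (p u) (q u)) * ((1 - overlap p q) / (1 - overlap p q)).
  rewrite -mulr_suml -mulr_sumr -mulrA; congr (_ * (_ / _)).
  by rewrite sumrB q1.
case: (eqVneq (1 - overlap p q) 0) => [e|ne]; last by rewrite divff // mulr1; ring.
rewrite e mul0r mulr0 addr0; apply/esym/eqP; rewrite -subr_eq0.
have : \sum_x (p x - Num.min (p x) (q x)) = 0 by rewrite sumrB p1.
by move=> /psumr_eq0P h; apply/eqP/h => // x _; rewrite subr_ge0 ge_min lexx.
Qed.

(** On the diagonal one of the two residuals is zero, so the product part contributes nothing
    there. *)
Lemma max_coupling_cost p q : \sum_x p x = 1 -> \sum_x q x = 1 ->
  \sum_u \sum_u' max_coupling p q u u' * (u != u')%:R = 1 - overlap p q.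
Proof.
move=> p1 q1.
have e u : \sum_u' max_coupling p q u u' * (u != u')%:R = p u - Num.min (p u) (q u).
  rewrite -{1}(max_coupling_suml u p1 q1) (bigD1 u) //= [in RHS](bigD1 u) //=.
  rewrite eqxx mulr0 add0r /max_coupling eqxx.
  have -> : (p u - Num.min (p u) (q u)) * (q u - Num.min (p u) (q u)) = 0.
    by case: (leP (p u) (q u)) => _; rewrite subrr ?mul0r ?mulr0.
  rewrite mul0r addr0 addrAC subrr add0r; apply: eq_bigr => x xu.
  by rewrite [u == x]eq_sym (negPf xu) mulr1.
by under eq_bigr => u _ do rewrite e; rewrite sumrB p1.
Qed.

Definition uniform A (u : U) : R := (u \in A)%:R / #|A|%:R.

Lemma uniform_ge0 A u : 0 <= uniform A u.
Proof. by rewrite divr_ge0. Qed.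

Lemma uniform_sum A : (0 < #|A|)%N -> \sum_u uniform A u = 1.
Proof.
move=> A0; rewrite -mulr_suml -natr_sum -big_mkcond /= sum1_card.
by rewrite divff // pnatr_eq0 -lt0n.
Qed.

Lemma overlap_uniform_ge0 A B : 0 <= overlap (uniform A) (uniform B).
Proof. by apply: sumr_ge0 => u _; rewrite le_min !uniform_ge0. Qed.

(** The overlap is at least [#|A :&: B| / #|C|], and two subsets of [C] share at least
    [#|A| + #|B| - #|C|] points. The bound splits into one term for each set, which allows both to
    be compared with a common reference [C]. *)
Lemma overlap_uniform A B C : (0 < #|A|)%N -> (0 < #|B|)%N ->
  A \subset C -> B \subset C ->
  1 - overlap (uniform A) (uniform B) <=
  (1 - #|A|%:R / #|C|%:R) + (1 - #|B|%:R / #|C|%:R).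
Proof.
move=> A0 B0 AC BC.
have C0 : (0 < #|C|)%N := leq_trans A0 (subset_leq_card AC).
have C0' : (0 : R) < #|C|%:R by rewrite ltr0n.
suff h : (#|A|%:R + #|B|%:R - #|C|%:R) / #|C|%:R <= overlap (uniform A) (uniform B).
  by apply: le_trans (_ : 1 - (#|A|%:R + #|B|%:R - #|C|%:R) / #|C|%:R <= _);
     [lra|rewrite !mulrBl mulrDl divff ?gt_eqF //; lra].
apply: (@le_trans _ _ (#|A :&: B|%:R / #|C|%:R)).
  rewrite ler_pM2r ?invr_gt0 // lerBlDr -!natrD ler_nat.
  rewrite -cardsUI addnC leq_add2l; apply: subset_leq_card.
  by rewrite finset.subUset AC.
rewrite -sum1_card natr_sum mulr_suml big_mkcond /=; apply: ler_sum => u _.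
rewrite /uniform inE; case: (u \in A); case: (u \in B); rewrite /= ?mul0r ?le_min ?divr_ge0 ?lexx ?ler0n //.
by rewrite !ler_pM2l ?ltr01 // !lef_pV2 ?posrE ?ltr0n // !ler_nat !subset_leq_card.
Qed.

End MaximalCoupling.

(** * Wasserstein bounds from events and from couplings *)

Section Wasserstein.
Variables (R : realType) (X : finType).
Implicit Types (mu nu : X -> R) (d : X -> X -> R).

(** Every coupling gives the pairs avoiding [B1] and [B2] a mass of at least one minus the two
    probabilities, and such pairs cost at least [c]. *)
Lemma wasserstein1_ge d mu nu (B1 B2 : pred X) c :
  (forall x, 0 <= mu x) -> (forall x, 0 <= nu x) ->
  \sum_x mu x = 1 -> \sum_x nu x = 1 -> 0 <= c -> (forall x y, 0 <= d x y) ->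
  (forall x y, ~~ B1 x -> ~~ B2 y -> c <= d x y) ->
  c * (1 - \sum_(x | B1 x) mu x - \sum_(y | B2 y) nu y) <= wasserstein1 d mu nu.
Proof.
move=> mu0 nu0 mu1 nu1 c0 d0 dc; apply: lb_le_inf.
  (* The independent coupling shows that the infimum is over a nonempty set. *)
  exists (\sum_x \sum_y mu x * nu y * d x y), (fun x y => mu x * nu y) => //.
  split=> [x y|x|y]; first exact: mulr_ge0.
    by rewrite -mulr_sumr nu1 mulr1.
  by rewrite -mulr_suml mu1 mul1r.
move=> _ [pi [pi0 pi1 pi2]] <-.
have s1 : \sum_(x | B1 x) mu x = \sum_x \sum_y pi x y * (B1 x)%:R.
  rewrite big_mkcond; apply: eq_bigr => x _; rewrite -mulr_suml pi1.
  by case: (B1 x); rewrite ?mulr1 ?mulr0.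
have s2 : \sum_(x | B2 x) nu x = \sum_x \sum_y pi x y * (B2 y)%:R.
  rewrite exchange_big big_mkcond; apply: eq_bigr => x _; rewrite -mulr_suml pi2.
  by case: (B2 x); rewrite ?mulr1 ?mulr0.
have s0 : 1 = \sum_x \sum_y pi x y by rewrite -mu1; apply: eq_bigr => x _.
rewrite s1 s2 {1}s0 -!sumrB mulr_sumr; apply: ler_sum => x _.
rewrite -!sumrB mulr_sumr; apply: ler_sum => y _.
have -> : c * (pi x y - pi x y * (B1 x)%:R - pi x y * (B2 y)%:R) =
   pi x y * (c * (1 - (B1 x)%:R - (B2 y)%:R)) by ring.
apply: ler_wpM2l => //; have := d0 x y; have := dc x y.
by case: (B1 x); case: (B2 y) => /= h h'; [nra|nra|nra|rewrite !subr0 mulr1; apply: h].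
Qed.

Lemma wasserstein1_le d mu nu pi : (forall x y, 0 <= d x y) -> coupling mu nu pi ->
  wasserstein1 d mu nu <= \sum_x \sum_y pi x y * d x y.
Proof.
move=> d0 cp; apply: ge_inf; last by exists pi.
exists 0 => _ [p [p0 _ _]] <-; apply: sumr_ge0 => x _; apply: sumr_ge0 => y _.
exact: mulr_ge0.
Qed.

End Wasserstein.

(** * Factorisation of sums over trees *)

Section GibbsSums.
Variables (R : realType) (V : finType) (r : V) (G : graph V).
Hypothesis Gsub : G \subset all_edges V.
Local Notation nonroot := (nonroot r G).
Local Notation parents := (@parents V G).
Local Notation parent_pred := (@parent_pred V r G).
Local Notation valid_depth := (@valid_depth V r G).
Local Notation depth_fun := (depth_fun V).

(** Once the depths are fixed, the parents of different vertices are chosen independently. *)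
Lemma sum_family_prod (h : depth_fun) (f : V -> V -> R) :
  \sum_(p in family (parent_pred h)) \prod_(v in nonroot) f v (p v) =
  \prod_(v in nonroot) \sum_(u in parents h v) f v u.
Proof.
transitivity (\sum_(p in family (parent_pred h))
    \prod_v (if v \in nonroot then f v (p v) else 1)).
  by apply: eq_bigr => p _; rewrite -big_mkcond.
rewrite -(bigA_distr_big_dep (parent_pred h) (fun v u => if v \in nonroot then f v u else 1)).
rewrite [RHS]big_mkcond /=; apply: eq_bigr => v _.
case: ifP => vn; first by apply: eq_bigl => u; rewrite parent_predE vn.
by rewrite (big_pred1 v) // => u; rewrite parent_predE vn.
Qed.

(** Only the root and the vertices off the component have a forced depth. The other depths are
    unconstrained: incompatible ones are discarded by the number of parents, which is then zero at
    some vertex. *)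
Lemma sum_depth_prod (psi : V -> nat -> R) :
  \sum_(h | valid_depth h) \prod_(v in nonroot) psi v (h v) =
  \prod_(v in nonroot) \sum_(j < #|V|.+1) psi v j.
Proof.
pose Q (v : V) : pred 'I_#|V|.+1 :=
  [pred j | (v \in nonroot) || (j == if v == r then ord0 else ord_max)].
have QE v j : Q v j = (v \in nonroot) || (j == if v == r then ord0 else ord_max) by [].
transitivity (\sum_(h in family Q)
    \prod_v (if v \in nonroot then psi v (h v) else 1)).
  apply: eq_big => [h|h _]; last by rewrite -big_mkcond.
  apply/andP/familyP => [[h0 /forallP h1] v|hQ].
    rewrite inE in_setD1; case: eqVneq => [->|_] /=; first exact/eqP/val_inj/eqP.
    by have := h1 v; case: (v \in _) => //= e; apply/eqP/val_inj/eqP.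
  split; first by have := hQ r; rewrite inE in_setD1 eqxx /= => /eqP ->.
  apply/forallP => v; apply/implyP => vc; have := hQ v.
  rewrite inE in_setD1 (negPf vc) andbF /=; case: (eqVneq v r) => [vr|_ /eqP ->//].
  by rewrite vr (root_in_comp r G) in vc.
rewrite -(bigA_distr_big_dep Q (fun v j => if v \in nonroot then psi v j else 1)).
rewrite [RHS]big_mkcond /=; apply: eq_bigr => v _; case: ifP => vn.
  by apply: eq_bigl => j; rewrite QE vn.
rewrite (big_pred1 (if v == r then ord0 else ord_max)) // => j.
by rewrite QE vn.
Qed.

Variable b : R.

(* Boltzmann weight of a depth function relative to the reference depths [g]. *)
Definition weight (g : V -> nat) (h : depth_fun) : R :=
  \prod_(v in nonroot) expR (- b * ((h v)%:R - (g v)%:R)).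

(** Another reference [g] multiplies all weights by the same constant, so [g] can be adapted to the
    depth functions that dominate. *)
Definition partition (g : V -> nat) : R :=
  \sum_(h | valid_depth h) \sum_(p in family (parent_pred h)) weight g h.

Lemma weight_gt0 g h : 0 < weight g h.
Proof. by apply: prodr_gt0 => v _; apply: expR_gt0. Qed.

Lemma sum_family1 (h : depth_fun) (c : R) :
  \sum_(p in family (parent_pred h)) c = c * \prod_(v in nonroot) #|parents h v|%:R.
Proof.
have <- : \prod_(v in nonroot) \sum_(u in parents h v) 1 =
    \prod_(v in nonroot) #|parents h v|%:R :> R.
  by apply: eq_bigr => v _; rewrite sumr_const.
rewrite -(sum_family_prod h (fun _ _ => 1)) mulr_sumr; apply: eq_bigr => p _.
by rewrite big1_eq mulr1.
Qed.

(** The depth functions realised by some spanning tree. *)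
Definition inhabited_depth (h : depth_fun) : bool :=
  valid_depth h && [forall v in nonroot, parents h v != finset.set0].

Lemma inhabited_depth_ambient : inhabited_depth (depth r G).
Proof.
apply/andP; split.
  rewrite /valid_depth depthE gdistxx eqxx /=; apply/forallP => v.
  apply/implyP; rewrite inE connect_gdist -leqNgt depthE => ge.
  by rewrite eqn_leq gdist_le_card.
apply/forallP => v; apply/implyP => /setD1P[vr]; rewrite inE connect_gdist => lt.
case e: (gdist G r v) lt => [|k] lt; first by move/eqP: e; rewrite gdist_eq0 (negPf vr).
have [u uv du] := gdist_pred e lt.
by apply/set0Pn; exists u; rewrite inE uv !depthE du e eqxx.
Qed.

Lemma prod_parents_ge1 (h : depth_fun) : inhabited_depth h ->
  1 <= \prod_(v in nonroot) #|parents h v|%:R :> R.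
Proof.
case/andP => _ /forallP h1; rewrite -natr_prod ler1n; apply: prodn_cond_gt0 => v vn.
by rewrite card_gt0; have := h1 v; rewrite vn.
Qed.

Lemma partition_ge_depth g h : inhabited_depth h ->
  weight g h * \prod_(v in nonroot) #|parents h v|%:R <= partition g.
Proof.
case/andP => hv _; rewrite /partition (bigD1 h) //= sum_family1 lerDl.
by apply: sumr_ge0 => h' _; apply: sumr_ge0 => p _; apply/ltW/weight_gt0.
Qed.

Lemma partition_gt0 g : 0 < partition g.
Proof.
apply: lt_le_trans (partition_ge_depth g inhabited_depth_ambient).
apply: mulr_gt0; first exact: weight_gt0.
by apply: lt_le_trans (prod_parents_ge1 inhabited_depth_ambient); apply: ltr01.
Qed.

Lemma gibbs_weightE g T : gibbs_weight r b G T =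
  expR (- b * (\sum_(v in nonroot) g v)%N%:R) * weight g (depth r T).
Proof.
rewrite /gibbs_weight (big_setD1 r) ?root_in_comp //= gdistxx add0n.
rewrite /weight -expR_sum -expRD; congr expR; rewrite !natr_sum !mulr_sumr -big_split /=.
by apply: eq_bigr => v _; rewrite depthE; ring.
Qed.

Lemma gibbsE g T : gibbs r b G T =
  if `[< spanning_tree r G T >] then weight g (depth r T) / partition g else 0.
Proof.
rewrite /gibbs; case: ifP => // _.
set c := expR (- b * (\sum_(v in nonroot) g v)%N%:R).
have c0 : c != 0 by rewrite gt_eqF ?expR_gt0.
have -> : \sum_(T' : graph V | `[< spanning_tree r G T' >]) gibbs_weight r b G T' =
    c * partition g.
  under eq_bigr => T' _ do rewrite (gibbs_weightE g).
  rewrite -mulr_sumr; congr (_ * _).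
  exact: (sum_spanning_trees r Gsub (fun h _ => weight g h)).
rewrite (gibbs_weightE g) -/c; have := partition_gt0 g; move: (partition g) => z z0.
by field; rewrite c0 gt_eqF.
Qed.

Lemma gibbs_sumE g (F : depth_fun -> {ffun V -> V} -> R) :
  \sum_(T : graph V) gibbs r b G T * F (depth r T) (parent_fun r T) =
  (\sum_(h | valid_depth h) \sum_(p in family (parent_pred h)) weight g h * F h p) /
  partition g.
Proof.
rewrite -(sum_spanning_trees r Gsub (fun h p => weight g h * F h p)) mulr_suml.
rewrite [RHS]big_mkcond /=; apply: eq_bigr => T _; rewrite (gibbsE g).
by case: ifP => _; rewrite ?mul0r // mulrAC.
Qed.

Lemma gibbs_ge0 T : 0 <= gibbs r b G T.
Proof.
rewrite /gibbs; case: ifP => // _; apply: divr_ge0; first exact: expR_ge0.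
by apply: sumr_ge0 => T' _; apply: expR_ge0.
Qed.

Lemma gibbs_sum1 : \sum_T gibbs r b G T = 1.
Proof.
have := gibbs_sumE (fun=> 0%N) (fun _ _ => 1).
under eq_bigr => T _ do rewrite mulr1; move=> ->.
rewrite (_ : \sum_(h | _) _ = partition (fun=> 0%N)) ?divff ?gt_eqF ?partition_gt0 //.
by apply: eq_bigr => h _; apply: eq_bigr => p _; rewrite mulr1.
Qed.

(** Markov's inequality for a function [f] of depths and parents that dominates the indicator of
    [A], stated for unnormalised sums. *)
Lemma gibbs_prob_le g (A : depth_fun -> {ffun V -> V} -> bool)
    (f : depth_fun -> {ffun V -> V} -> R) M :
  (forall h p, 0 <= f h p) ->
  (forall h p, valid_depth h -> p \in family (parent_pred h) -> A h p -> 1 <= f h p) ->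
  \sum_(h | valid_depth h) \sum_(p in family (parent_pred h)) weight g h * f h p
    <= M * partition g ->
  \sum_(T | `[< spanning_tree r G T >] && A (depth r T) (parent_fun r T)) gibbs r b G T <= M.
Proof.
move=> f0 f1 hM.
have -> : \sum_(T | `[< spanning_tree r G T >] && A (depth r T) (parent_fun r T)) gibbs r b G T
   = \sum_T gibbs r b G T * (A (depth r T) (parent_fun r T))%:R.
  rewrite big_mkcond; apply: eq_bigr => T _; rewrite /gibbs.
  by case: asboolP => _ /=; [case: (A _ _); rewrite ?mulr1 ?mulr0|rewrite mul0r].
rewrite (gibbs_sumE g (fun h p => (A h p)%:R)) ler_pdivrMr ?partition_gt0 //.
apply: le_trans hM; apply: ler_sum => h hv; apply: ler_sum => p pf.
rewrite ler_pM2l ?weight_gt0 //; case: (boolP (A h p)) => Ahp; last exact: f0.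
exact: f1.
Qed.

End GibbsSums.

(** * A coupling of two Gibbs measures *)

Section GibbsCoupling.
Variables (R : realType) (V : finType) (r : V) (G : graph V).
Hypothesis Gsub : G \subset all_edges V.
Local Notation nonroot := (nonroot r G).
Local Notation parents := (@parents V G).
Local Notation parent_pred := (@parent_pred V r G).
Local Notation valid_depth := (@valid_depth V r G).
Local Notation depth_fun := (depth_fun V).
Local Notation count h := (\prod_(v in nonroot) #|parents h v|%:R : R).

Definition parent_coupling (h h' : depth_fun) (v u u' : V) : R :=
  max_coupling (uniform R (parents h v)) (uniform R (parents h' v)) u u'.

Lemma parent_couplingC h h' v u u' :
  parent_coupling h h' v u u' = parent_coupling h' h v u' u.
Proof. exact: max_couplingC. Qed.

Lemma parent_coupling_out h h' v u u' : u' \notin parents h' v ->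
  parent_coupling h h' v u u' = 0.
Proof.
move=> u'n; have e : uniform R (parents h' v) u' = 0.
  by rewrite /uniform (negPf u'n) mul0r.
have m0 x : Num.min (uniform R (parents h v) x) 0 = 0 by rewrite min_r ?uniform_ge0.
rewrite /parent_coupling /max_coupling e m0 subrr mulr0 mul0r addr0.
by case: eqP => // ->; rewrite e m0.
Qed.

Lemma uniform_parents_sum h v : inhabited_depth r G h -> v \in nonroot ->
  \sum_u uniform R (parents h v) u = 1.
Proof.
case/andP=> _ /forallP/(_ v)/implyP hv vn; apply: uniform_sum.
by rewrite card_gt0 hv.
Qed.

Lemma sum_parent_coupling h h' v u (F : V -> R) :
  \sum_(u' in parents h' v) parent_coupling h h' v u u' * F u' =
  \sum_u' parent_coupling h h' v u u' * F u'.
Proof.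
rewrite big_mkcond; apply: eq_bigr => u' _; case: ifP => // /negbT u'n.
by rewrite parent_coupling_out // mul0r.
Qed.

Lemma sum_parent_coupling2 h h' v (F : V -> V -> R) :
  \sum_(u in parents h v) \sum_(u' in parents h' v) parent_coupling h h' v u u' * F u u' =
  \sum_u \sum_u' parent_coupling h h' v u u' * F u u'.
Proof.
under eq_bigr => u _ do rewrite sum_parent_coupling.
rewrite big_mkcond; apply: eq_bigr => u _; case: ifP => // /negbT un.
by apply/esym; apply: big1 => u' _; rewrite parent_couplingC parent_coupling_out // mul0r.
Qed.

Lemma count_ge0 h : 0 <= count h.
Proof. by apply: prodr_ge0 => v _; apply: ler0n. Qed.

Lemma inhabitedP h : valid_depth h -> count h != 0 -> inhabited_depth r G h.
Proof.
move=> hv c; rewrite /inhabited_depth hv; apply/forallP => v; apply/implyP => vn.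
by apply: contraNneq c => e; rewrite (bigD1 v) //= e cards0 mul0r.
Qed.

Lemma inhabited_depth_tree T : spanning_tree r G T -> inhabited_depth r G (depth r T).
Proof.
move=> sT; rewrite /inhabited_depth valid_depth_tree //=.
apply/forallP => v; apply/implyP => vn; apply/set0Pn; exists (parent_fun r T v).
exact: parent_fun_parents.
Qed.

(* Depth functions are drawn independently, parents by maximal couplings. *)
Definition gibbs_coupling (w w' : depth_fun -> R) (T T' : graph V) : R :=
  if `[< spanning_tree r G T >] && `[< spanning_tree r G T' >] then
    w (depth r T) * count (depth r T) * (w' (depth r T') * count (depth r T')) *
    \prod_(v in nonroot) parent_coupling (depth r T) (depth r T') v
      (parent_fun r T v) (parent_fun r T' v)
  else 0.

Lemma gibbs_couplingC w w' T T' : gibbs_coupling w w' T T' = gibbs_coupling w' w T' T.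
Proof.
rewrite /gibbs_coupling andbC; case: (_ && _); last by [].
have -> : \prod_(v in nonroot) parent_coupling (depth r T) (depth r T') v
    (parent_fun r T v) (parent_fun r T' v) = \prod_(v in nonroot)
    parent_coupling (depth r T') (depth r T) v (parent_fun r T' v) (parent_fun r T v).
  by apply: eq_bigr => v _; rewrite parent_couplingC.
by rewrite [X in X * _]mulrC.
Qed.

(** For fixed depths the maximal couplings have uniform marginals, so the sum over the parents of
    [T'] turns the product into the inverse of [count h]; the weights of the depths of [T'] then sum
    to one. *)
Lemma gibbs_coupling_marginal w w' T :
  \sum_(h | valid_depth h) w' h * count h = 1 ->
  \sum_T' gibbs_coupling w w' T T' =
  if `[< spanning_tree r G T >] then w (depth r T) else 0.
Proof.
move=> w1; rewrite /gibbs_coupling; case: asboolP => sT /=; last exact: big1_eq.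
rewrite -big_mkcond /=; set h := depth r T.
have ih : inhabited_depth r G h := inhabited_depth_tree sT.
have c0 : count h != 0.
  by rewrite gt_eqF // (lt_le_trans _ (prod_parents_ge1 R ih)) ?ltr01.
rewrite (sum_spanning_trees r Gsub (fun h' p' => w h * count h * (w' h' * count h') *
  \prod_(v in nonroot) parent_coupling h h' v (parent_fun r T v) (p' v))).
rewrite -[RHS]mulr1 -[X in _ = _ * X]w1 mulr_sumr; apply: eq_bigr => h' hv'.
rewrite -mulr_sumr; case: (eqVneq (count h') 0) => [->|c']; first by rewrite !mulr0 mul0r.
have ih' := inhabitedP hv' c'.
rewrite (sum_family_prod r G h' (fun v u' => parent_coupling h h' v (parent_fun r T v) u')).
have -> : \prod_(v in nonroot) \sum_(u in parents h' v)
   parent_coupling h h' v (parent_fun r T v) u = (count h)^-1.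
  rewrite -prodfV; apply: eq_bigr => v vn.
  under eq_bigr => u _ do rewrite -[parent_coupling _ _ _ _ _]mulr1.
  rewrite (sum_parent_coupling h h' v _ (fun=> 1)).
  under eq_bigr => u _ do rewrite mulr1.
  rewrite max_coupling_suml ?uniform_parents_sum //.
  by rewrite /uniform parent_fun_parents // mul1r.
by field.
Qed.

(** The factors at vertices other than [v] are probability couplings and sum to one; the factor at
    [v] gives the cost of its maximal coupling. *)
Lemma sum_family_coupling h h' v : v \in nonroot ->
  inhabited_depth r G h -> inhabited_depth r G h' ->
  \sum_(p in family (parent_pred h)) \sum_(p' in family (parent_pred h'))
    (\prod_(x in nonroot) parent_coupling h h' x (p x) (p' x)) * (p v != p' v)%:R =
  1 - overlap (uniform R (parents h v)) (uniform R (parents h' v)).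
Proof.
move=> vn ih ih'.
pose F (x u u' : V) : R := if x == v then (u != u')%:R else 1.
pose f x u u' := parent_coupling h h' x u u' * F x u u'.
transitivity (\sum_(p in family (parent_pred h)) \sum_(p' in family (parent_pred h'))
    \prod_(x in nonroot) f x (p x) (p' x)).
  apply: eq_bigr => p _; apply: eq_bigr => p' _; rewrite big_split /=; congr (_ * _).
  rewrite (bigD1 v) //= /F eqxx big1 ?mulr1 // => x /andP[_ /negPf ->//].
under eq_bigr => p _ do rewrite (sum_family_prod r G h' (fun x u' => f x (p x) u')).
rewrite (sum_family_prod r G h (fun x u => \sum_(u' in parents h' x) f x u u')).
have e x : \sum_(u in parents h x) \sum_(u' in parents h' x) f x u u' =
   \sum_u \sum_u' f x u u' := sum_parent_coupling2 h h' x (F x).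
have e1 x : x \in nonroot -> x != v -> \sum_u \sum_u' f x u u' = 1.
  move=> xn xv; rewrite -(uniform_parents_sum ih xn); apply: eq_bigr => u _.
  rewrite -(max_coupling_suml u (uniform_parents_sum ih xn) (uniform_parents_sum ih' xn)).
  by apply: eq_bigr => u' _; rewrite /f /F (negPf xv) mulr1.
rewrite (bigD1 v) //= e; set c := (X in _ * X).
have -> : c = 1 by apply: big1 => x /andP[xn xv]; rewrite e e1.
rewrite mulr1 -max_coupling_cost ?uniform_parents_sum //.
by apply: eq_bigr => u _; apply: eq_bigr => u' _; rewrite /f /F eqxx.
Qed.

(** Under the coupling the expected cost at [v] is one minus an overlap. Bounding it by a function
    of [h] plus the same function of [h'] removes the joint law: one expectation under each measure
    remains. *)
Lemma wasserstein_gibbs_le (b1 b2 : R) (phi : depth_fun -> V -> R) :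
  (forall h h' v, inhabited_depth r G h -> inhabited_depth r G h' -> v \in nonroot ->
     1 - overlap (uniform R (parents h v)) (uniform R (parents h' v)) <= phi h v + phi h' v) ->
  wasserstein1 (fun T T' => (tree_dist r T T')%:R) (gibbs r b1 G) (gibbs r b2 G) <=
  \sum_T gibbs r b1 G T * (\sum_(v in nonroot) phi (depth r T) v) +
  \sum_T gibbs r b2 G T * (\sum_(v in nonroot) phi (depth r T) v).
Proof.
move=> hphi.
pose g0 := fun _ : V => 0%N.
pose w (b : R) h := weight r G b g0 h / partition r G b g0.
have w0 b h : 0 <= w b h by rewrite divr_ge0 ?ltW ?weight_gt0 ?partition_gt0.
have Wpos h h' : 0 <= w b1 h * count h * (w b2 h' * count h').
  by apply: mulr_ge0; apply: mulr_ge0; rewrite ?w0 ?count_ge0.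
have gw b T : gibbs r b G T = if `[< spanning_tree r G T >] then w b (depth r T) else 0.
  exact: gibbsE.
have wE b (F : depth_fun -> R) : \sum_T gibbs r b G T * F (depth r T) =
    \sum_(h | valid_depth h) w b h * count h * F h.
  rewrite (gibbs_sumE r Gsub b g0 (fun h _ => F h)) mulr_suml.
  by apply: eq_bigr => h _; rewrite sum_family1 /w; ring.
have w1 b : \sum_(h | valid_depth h) w b h * count h = 1.
  transitivity (\sum_(h | valid_depth h) w b h * count h * 1).
    by apply: eq_bigr => h _; rewrite mulr1.
  rewrite -(wE b (fun=> 1)) -[RHS](gibbs_sum1 r Gsub b).
  by apply: eq_bigr => T _; rewrite mulr1.
rewrite !(wE _ (fun h => \sum_(v in nonroot) phi h v)).
apply: le_trans (wasserstein1_le (pi := gibbs_coupling (w b1) (w b2)) _ _) _ => //.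
  split=> [T T'|T|T']; last 2 first.
  - by rewrite gw gibbs_coupling_marginal.
  - rewrite gw -(@gibbs_coupling_marginal (w b2) (w b1) T' (w1 b1)).
    by apply: eq_bigr => T _; rewrite gibbs_couplingC.
  rewrite /gibbs_coupling; case: ifP => // /andP[/asboolP sT /asboolP sT'].
  apply: mulr_ge0; first exact: Wpos.
  apply: prodr_ge0 => v vn; apply: max_coupling_ge0; try exact: uniform_ge0.
  exact: uniform_parents_sum (inhabited_depth_tree sT) vn.
pose W h h' := w b1 h * count h * (w b2 h' * count h').
have cost : \sum_T \sum_T' gibbs_coupling (w b1) (w b2) T T' * (tree_dist r T T')%:R =
   \sum_(h | valid_depth h) \sum_(h' | valid_depth h') W h h' *
     \sum_(v in nonroot) (1 - overlap (uniform R (parents h v)) (uniform R (parents h' v))).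
  pose K h p h' p' := W h h' * \prod_(x in nonroot) parent_coupling h h' x (p x) (p' x) *
    \sum_(v in nonroot) (p v != p' v :> V)%:R.
  transitivity (\sum_(T | `[< spanning_tree r G T >]) \sum_(T' | `[< spanning_tree r G T' >])
      K (depth r T) (parent_fun r T) (depth r T') (parent_fun r T')).
    rewrite [RHS]big_mkcond; apply: eq_bigr => T _; case: asboolP => sT; last first.
      apply: big1 => T' _; rewrite /gibbs_coupling.
      by case: asboolP => // _; rewrite mul0r.
    rewrite [RHS]big_mkcond; apply: eq_bigr => T' _; rewrite /gibbs_coupling.
    case: asboolP => // _ /=; case: asboolP => sT'; last by rewrite mul0r.
    rewrite /K; congr (_ * _); rewrite (tree_distE sT sT') -sum1_card natr_sum.
    rewrite (eq_bigl (fun v => (v \in nonroot) &&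
      (parent_fun r T v != parent_fun r T' v))) => [|v]; last by rewrite inE.
    by rewrite big_mkcondr /=; apply: eq_bigr => v _; case: ifP.
  under eq_bigr => T _ do
    rewrite (sum_spanning_trees r Gsub (K (depth r T) (parent_fun r T))).
  rewrite (sum_spanning_trees r Gsub (fun h p => \sum_(h' | valid_depth h')
     \sum_(p' in family (parent_pred h')) K h p h' p')).
  apply: eq_bigr => h hv; rewrite exchange_big /=; apply: eq_bigr => h' hv'.
  (* Pairs of zero weight are set aside because the parent couplings have total mass one only for
     inhabited depths. *)
  case: (eqVneq (W h h') 0) => [W0|].
    rewrite W0 mul0r; apply: big1 => p _; apply: big1 => p' _.
    by rewrite /K W0 !mul0r.
  rewrite /W !mulf_eq0 !negb_or => /andP[/andP[_ c1] /andP[_ c2]].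
  rewrite mulr_sumr; under [RHS]eq_bigr => v vn do
    rewrite -(sum_family_coupling vn (inhabitedP hv c1) (inhabitedP hv' c2)) mulr_sumr.
  rewrite [RHS]exchange_big /=; apply: eq_bigr => p _.
  under [RHS]eq_bigr => v _ do rewrite mulr_sumr.
  rewrite [RHS]exchange_big /=; apply: eq_bigr => p' _.
  by rewrite /K mulr_sumr; apply: eq_bigr => v _; rewrite mulrA.
rewrite cost.
have W2 h : valid_depth h -> \sum_(h' | valid_depth h') W h h' = w b1 h * count h.
  by move=> _; rewrite -mulr_sumr w1 mulr1.
have W1 h' : \sum_(h | valid_depth h) W h h' = w b2 h' * count h'.
  by rewrite -mulr_suml w1 mul1r.
have -> : \sum_(h | valid_depth h) w b1 h * count h * (\sum_(v in nonroot) phi h v) =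
    \sum_(h | valid_depth h) \sum_(h' | valid_depth h') W h h' * (\sum_(v in nonroot) phi h v).
  by apply: eq_bigr => h hv; rewrite -mulr_suml W2.
have -> : \sum_(h | valid_depth h) w b2 h * count h * (\sum_(v in nonroot) phi h v) =
    \sum_(h | valid_depth h) \sum_(h' | valid_depth h') W h h' * (\sum_(v in nonroot) phi h' v).
  by rewrite exchange_big; apply: eq_bigr => h hv; rewrite -mulr_suml W1.
rewrite -big_split; apply: ler_sum => h hv; rewrite -big_split /=.
apply: ler_sum => h' hv'; rewrite -mulrDr -big_split /=.
case: (eqVneq (W h h') 0) => [->|Wn]; first by rewrite !mul0r.
move: (Wn); rewrite {1}/W !mulf_eq0 !negb_or => /andP[/andP[_ c1] /andP[_ c2]].
apply: ler_wpM2l; first exact: Wpos.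
by apply: ler_sum => v vn; apply: hphi => //; apply: inhabitedP.
Qed.

End GibbsCoupling.

(** * Concentration in the Erdos-Renyi graph *)

Lemma ln_geV (R : realType) (z : R) : 0 < z -> 1 - z^-1 <= ln z.
Proof.
move=> z0; have := @le_ln1Dx R (z^-1 - 1).
have -> : 1 + (z^-1 - 1) = z^-1 by ring.
rewrite lnV ?posrE // => h.
have zV : 0 < z^-1 by rewrite invr_gt0.
suff : - ln z <= z^-1 - 1 by lra.
by apply: h; lra.
Qed.

Lemma expR_ge1_ge0 (R : realType) (x : R) : 0 <= x -> 1 <= expR x.
Proof. by have := expR_ge1Dx x; lra. Qed.

Section EdgeCounts.
Variable V : finType.
Implicit Types (G : graph V) (X Y A U : {set V}).

Definition nbrs G X v : {set V} := [set u in X | adj G u v].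

Definition edge_count G X Y : nat := \sum_(v in Y) #|nbrs G X v|.

(** With [A] a layer and [U] the unexplored vertices, this is the next layer of a breadth-first
    search. *)
Definition frontier G A U : {set V} := [set v in U | nbrs G A v != set0].

End EdgeCounts.

(** * Moments, independence and deviation bounds in the random graph *)

Section ErdosRenyi.
Variables (R : realType) (V : finType) (q : R).
Hypothesis q01 : 0 <= q <= 1.
Implicit Types (G H : graph V) (X Y A U : {set V}) (z : R).
Local Notation E := (all_edges V).

Lemma prod_setU_disjoint (I : finType) (A B : {set I}) (F : I -> R) :
  [disjoint A & B] -> \prod_(i in A :|: B) F i = \prod_(i in A) F i * \prod_(i in B) F i.
Proof. by move=> d; rewrite -bigU //; apply: eq_bigl => i; rewrite !inE. Qed.

Definition er_exp (f : graph V -> R) : R :=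
  \sum_(G in powerset E) (\prod_(e in E) (if e \in G then q else 1 - q)) * f G.

Lemma prod_add_powerset (I : finType) (S : {set I}) (a c : I -> R) :
  \prod_(i in S) (a i + c i) =
  \sum_(J in powerset S) \prod_(i in S) (if i \in J then a i else c i).
Proof.
transitivity (\prod_i ((if i \in S then a i else 0) + (if i \in S then c i else 1))).
  rewrite big_mkcond; apply: eq_bigr => i _; case: ifP => // _; by rewrite add0r.
rewrite bigA_distr [RHS]big_mkcond; apply: eq_bigr => J _; case: ifP => JS.
  rewrite [RHS]big_mkcond; apply: eq_bigr => i _.
  case: ifP => [iJ|_]; last by case: ifP.
  by rewrite (subsetP _ i iJ) // -powersetE.
move: JS; rewrite powersetE => /negbT/subsetPn[i iJ iS].
by rewrite (bigD1 i) //= iJ (negPf iS) mul0r.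
Qed.

(** Independence of the edges, for functions that are products over edges; the moment generating
    functions below are brought to this form. *)
Lemma er_exp_prod (S : {set {set V}}) (a c : {set V} -> R) : S \subset E ->
  er_exp (fun G => \prod_(e in S) (if e \in G then a e else c e)) =
  \prod_(e in S) (q * a e + (1 - q) * c e).
Proof.
move=> SE; rewrite /er_exp.
pose a' e := if e \in S then a e else 1; pose c' e := if e \in S then c e else 1.
have sub (F : {set V} -> R) : \prod_(e in E) (if e \in S then F e else 1) = \prod_(e in S) F e.
  rewrite -big_mkcondr; apply: eq_bigl => e; rewrite andbC; case: (boolP (e \in S)) => //= eS.
  exact: (subsetP SE).
transitivity (\sum_(G in powerset E)
    \prod_(e in E) (if e \in G then q * a' e else (1 - q) * c' e)).
  apply: eq_bigr => G _; rewrite -sub -big_split; apply: eq_bigr => e _ /=.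
  by rewrite /a' /c'; case: ifP; case: ifP.
rewrite -prod_add_powerset -sub; apply: eq_bigr => e _.
by rewrite /a' /c'; case: ifP => // _; ring.
Qed.

Lemma eq_er_exp f g : (forall G, G \subset E -> f G = g G) -> er_exp f = er_exp g.
Proof. by move=> fg; apply: eq_bigr => G; rewrite powersetE => /fg ->. Qed.

Lemma er_exp1 : er_exp (fun=> 1) = 1.
Proof.
transitivity (er_exp (fun G => \prod_(e in set0) (if e \in G then 1 else 1))).
  by apply: eq_er_exp => G _; rewrite big_set0.
by rewrite (er_exp_prod (fun=> 1) (fun=> 1)) ?sub0set // big_set0.
Qed.

Lemma er_weight_ge0 G : 0 <= \prod_(e in E) (if e \in G then q else 1 - q).
Proof. by apply: prodr_ge0 => e _; case/andP: q01 => *; case: ifP => _; lra. Qed.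

Lemma le_er_exp f g : (forall G, G \subset E -> f G <= g G) -> er_exp f <= er_exp g.
Proof.
move=> fg; apply: ler_sum => G; rewrite powersetE => /fg h.
by apply: ler_wpM2l h; apply: er_weight_ge0.
Qed.

Lemma er_exp_ge0 f : (forall G, 0 <= f G) -> 0 <= er_exp f.
Proof. by move=> f0; apply: sumr_ge0 => G _; rewrite mulr_ge0 ?er_weight_ge0. Qed.

Lemma er_exp_sum (I : Type) (s : seq I) (P : pred I) (f : I -> graph V -> R) :
  er_exp (fun G => \sum_(i <- s | P i) f i G) = \sum_(i <- s | P i) er_exp (f i).
Proof.
by rewrite /er_exp exchange_big; apply: eq_bigr => G _; rewrite mulr_sumr.
Qed.

Lemma er_expZ c f : er_exp (fun G => c * f G) = c * er_exp f.
Proof. by rewrite mulr_sumr; apply: eq_bigr => G _; rewrite mulrCA. Qed.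

Lemma er_probE (B : graph V -> Prop) : er_prob q B = er_exp (fun G => `[< B G >]%:R).
Proof.
rewrite /er_prob /er_exp big_mkcondr /=; apply: eq_bigr => G _.
by case: asboolP; rewrite ?mulr1 ?mulr0.
Qed.

Lemma er_prob_ge0 (B : graph V -> Prop) : 0 <= er_prob q B.
Proof. by rewrite er_probE; apply: er_exp_ge0 => G; apply: ler0n. Qed.

Lemma er_prob_markov (B : graph V -> Prop) f : (forall G, 0 <= f G) ->
  (forall G, G \subset E -> B G -> 1 <= f G) -> er_prob q B <= er_exp f.
Proof.
move=> f0 f1; rewrite er_probE; apply: le_er_exp => G GE.
by case: asboolP => [/f1->//|_]; apply: f0.
Qed.

Lemma er_prob_mono (B C : graph V -> Prop) : (forall G, G \subset E -> B G -> C G) ->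
  er_prob q B <= er_prob q C.
Proof.
move=> BC; rewrite [leRHS]er_probE; apply: er_prob_markov => [G|G GE /(BC G GE) CG].
  exact: ler0n.
by case: asboolP.
Qed.

Lemma er_prob_not (B : graph V -> Prop) : er_prob q (fun G => ~ B G) = 1 - er_prob q B.
Proof.
rewrite !er_probE.
have e : er_exp (fun G => `[< ~ B G >]%:R) + er_exp (fun G => `[< B G >]%:R) = 1.
  rewrite -[RHS]er_exp1 /er_exp -big_split; apply: eq_bigr => G _ /=.
  rewrite -mulrDr; congr (_ * _).
  by case: asboolP => h; case: asboolP => h' //; rewrite ?addr0 ?add0r.
by lra.
Qed.

Lemma er_prob_le1 (B : graph V -> Prop) : er_prob q B <= 1.
Proof. by have := er_prob_ge0 (fun G => ~ B G); rewrite er_prob_not; lra. Qed.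

Lemma er_prob_union (I : finType) (P : pred I) (B : I -> graph V -> Prop) :
  er_prob q (fun G => exists2 i, P i & B i G) <= \sum_(i | P i) er_prob q (B i).
Proof.
under eq_bigr => i _ do rewrite er_probE.
rewrite -er_exp_sum; apply: er_prob_markov => [G|G _ [i Pi Bi]].
  by apply: sumr_ge0 => i _; apply: ler0n.
rewrite (bigD1 i) //=; case: asboolP => // _; rewrite lerDl.
by apply: sumr_ge0 => j _; apply: ler0n.
Qed.

Lemma er_prob_or (B C : graph V -> Prop) :
  er_prob q (fun G => B G \/ C G) <= er_prob q B + er_prob q C.
Proof.
have := @er_prob_union bool predT (fun b => if b then B else C).
rewrite big_bool; apply: le_trans; apply: er_prob_mono => G _ [BG|CG].
  by exists true.
by exists false.
Qed.

Lemma restrict_indicator (S J G : {set {set V}}) :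
  \prod_(e in S) (if e \in G then (e \in J)%:R else (e \notin J)%:R) =
  (G :&: S == J :&: S)%:R :> R.
Proof.
case: eqP => [e|ne].
  apply: big1 => x xS; have /setP/(_ x) := e; rewrite !inE xS !andbT.
  by move=> ->; case: (x \in J).
have /existsP[x /andP[xS hx]] : [exists x, (x \in S) && ((x \in G) != (x \in J))].
  apply: contraT => /existsPn h; exfalso; apply: ne; apply/setP => x; rewrite !inE.
  case: (boolP (x \in S)) => xS; rewrite ?andbT ?andbF //.
  by have := h x; rewrite xS /= negbK => /eqP.
rewrite (bigD1 x) //=.
have -> : (if x \in G then (x \in J)%:R else (x \notin J)%:R) = 0 :> R.
  by move: hx; case: (x \in G); case: (x \in J).
by rewrite mul0r.
Qed.

Definition depends_on (S : {set {set V}}) (f : graph V -> R) : Prop :=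
  forall G H, G :&: S = H :&: S -> f G = f H.

(** Expansion in the indicators of the possible traces on [S]. Each indicator is a product over
    edges, to which [er_exp_prod] applies. *)
Lemma depends_onE S f G : depends_on S f ->
  f G = \sum_(J in powerset S) f J *
    \prod_(e in S) (if e \in G then (e \in J)%:R else (e \notin J)%:R).
Proof.
move=> dS; rewrite (bigD1 (G :&: S)) /=; last by rewrite powersetE subsetIr.
rewrite restrict_indicator -finset.setIA setIid eqxx mulr1 big1 ?addr0 => [|J /andP[]].
  by apply: dS; rewrite -finset.setIA setIid.
rewrite powersetE => JS JG; rewrite restrict_indicator.
rewrite (setIidPl JS) eq_sym (negPf JG) mulr0 //.
Qed.

Lemma er_exp_indep (S1 S2 : {set {set V}}) f g : S1 \subset E -> S2 \subset E ->
  [disjoint S1 & S2] -> depends_on S1 f -> depends_on S2 g ->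
  er_exp (fun G => f G * g G) = er_exp f * er_exp g.
Proof.
move=> S1E S2E dis d1 d2.
pose pr (S J G : {set {set V}}) : R :=
  \prod_(e in S) (if e \in G then (e \in J)%:R else (e \notin J)%:R).
have exp1 S h : depends_on S h ->
    er_exp h = \sum_(J in powerset S) h J * er_exp (pr S J).
  move=> d; under [RHS]eq_bigr => J _ do rewrite -er_expZ.
  by rewrite -er_exp_sum; apply: eq_er_exp => G _; apply: depends_onE.
rewrite (exp1 S1 f d1) (exp1 S2 g d2) big_distrlr /=.
transitivity (er_exp (fun G => \sum_(J in powerset S1) \sum_(J' in powerset S2)
   f J * g J' * (pr S1 J G * pr S2 J' G))).
  apply: eq_er_exp => G _; rewrite (depends_onE G d1) (depends_onE G d2) big_distrlr /=.
  by apply: eq_bigr => J _; apply: eq_bigr => J' _; rewrite mulrACA.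
rewrite er_exp_sum; apply: eq_bigr => J _; rewrite er_exp_sum; apply: eq_bigr => J' _.
rewrite er_expZ mulrACA; congr (_ * _).
rewrite !er_exp_prod //; last first.
transitivity (er_exp (fun G => \prod_(e in S1 :|: S2)
   (if e \in G then (if e \in S1 then e \in J else e \in J')%:R
    else (if e \in S1 then e \notin J else e \notin J')%:R))).
  apply: eq_er_exp => G _; rewrite prod_setU_disjoint //=; congr (_ * _); apply: eq_bigr => e eS.
    by rewrite eS.
  by rewrite (disjointFl dis eS).
rewrite er_exp_prod; last by rewrite subUset S1E.
rewrite prod_setU_disjoint //=; congr (_ * _); apply: eq_bigr => e eS.
  by rewrite eS.
by rewrite (disjointFl dis eS).
Qed.

Lemma er_exp_pairs (P : {set V * V}) (a c : R) :
  {in P, forall x, x.1 != x.2} ->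
  {in P &, injective (fun x => [set x.1; x.2])} ->
  er_exp (fun G => \prod_(x in P) (if [set x.1; x.2] \in G then a else c)) =
  (q * a + (1 - q) * c) ^+ #|P|.
Proof.
move=> ne inj.
transitivity (er_exp (fun G => \prod_(e in [set [set x.1; x.2] | x in P])
    (if e \in G then a else c))).
  by apply: eq_er_exp => G _; rewrite big_imset.
rewrite er_exp_prod; first by rewrite prodr_const card_in_imset.
by apply/subsetP => e /imsetP[x xP ->]; rewrite inE cards2 ne.
Qed.

Lemma er_exp_bipartite X Y (a c : R) : [disjoint X & Y] ->
  er_exp (fun G => \prod_(v in Y) \prod_(u in X) (if adj G u v then a else c)) =
  (q * a + (1 - q) * c) ^+ (#|X| * #|Y|).
Proof.
move=> dis; rewrite -cardsX -er_exp_pairs.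
- apply: eq_er_exp => G _; rewrite exchange_big pair_big /=.
  by apply: eq_bigl => -[u v]; rewrite inE.
- move=> [u v] /setXP[/= uX vY]; apply: contraTneq vY => <-.
  by rewrite (disjointFr dis).
- move=> [u v] [u' v'] /setXP[/= uX vY] /setXP[/= uX' vY'] /set2_eq[[-> ->//]|[e _]].
  by rewrite e in uX; rewrite (disjointFr dis uX) in vY'.
Qed.

Lemma er_exp_edge_count X Y z : [disjoint X & Y] ->
  er_exp (fun G => z ^+ edge_count G X Y) = (1 + q * (z - 1)) ^+ (#|X| * #|Y|).
Proof.
move=> dis; have -> : 1 + q * (z - 1) = q * z + (1 - q) * 1 by ring.
rewrite -er_exp_bipartite //; apply: eq_er_exp => G _.
rewrite /edge_count expr_sum; apply: eq_bigr => v _.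
rewrite -prodr_const (eq_bigl (fun u => (u \in X) && adj G u v)) => [|u]; last by rewrite inE.
by rewrite big_mkcondr.
Qed.

(** The vertices of [U] join the frontier independently, each with probability
    [1 - (1 - q) ^+ #|A|]. In the expansion over [J], the vertices outside [J] carry the condition
    of having no neighbour in [A]. *)
Lemma er_exp_frontier A U z : [disjoint A & U] ->
  er_exp (fun G => z ^+ #|frontier G A U|) =
  (1 + (1 - (1 - q) ^+ #|A|) * (z - 1)) ^+ #|U|.
Proof.
move=> dis.
have -> : 1 + (1 - (1 - q) ^+ #|A|) * (z - 1) = z + (1 - z) * (1 - q) ^+ #|A| by ring.
rewrite -[in RHS]prodr_const prod_add_powerset.
transitivity (er_exp (fun G => \sum_(J in powerset U)
    \prod_(v in U) (if v \in J then z else (1 - z)) *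
    \prod_(v in U :\: J) \prod_(u in A) (if adj G u v then 0 else 1))).
  apply: eq_er_exp => G _.
  have -> : z ^+ #|frontier G A U| =
      \prod_(v in U) (z + (1 - z) * \prod_(u in A) (if adj G u v then 0 else 1)).
    rewrite -prodr_const (eq_bigl (fun v => (v \in U) && (nbrs G A v != set0))) => [|v].
      rewrite big_mkcondr; apply: eq_bigr => v _; case: ifP => [/set0Pn[u]|/negbFE/eqP n0].
        by rewrite inE => /andP[uA uv]; rewrite (bigD1 u) //= uv mul0r mulr0 addr0.
      rewrite big1 ?mulr1 ?subrKC // => u uA; case: ifP => // uv.
      by have := in_set0 u; rewrite -n0 inE uA uv.
    by rewrite inE.
  rewrite prod_add_powerset; apply: eq_bigr => J; rewrite powersetE => JU.
  rewrite [X in _ = _ * X](eq_bigl (fun v => (v \in U) && (v \notin J))) => [|v]; last first.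
    by rewrite inE andbC.
  rewrite [X in _ = _ * X]big_mkcondr -big_split; apply: eq_bigr => v _ /=.
  by case: ifP; rewrite ?mulr1.
rewrite er_exp_sum; apply: eq_bigr => J; rewrite powersetE => JU; rewrite er_expZ.
rewrite er_exp_bipartite; last first.
  by apply: disjointWr dis; apply: subsetDl.
rewrite mulr0 add0r mulr1 exprM -[X in _ * X]prodr_const.
rewrite [X in _ * X = _](eq_bigl (fun v => (v \in U) && (v \notin J))) => [|v]; last first.
  by rewrite inE andbC.
rewrite [X in _ * X = _]big_mkcondr -big_split; apply: eq_bigr => v _ /=.
by case: ifP; rewrite ?mulr1.
Qed.

(** Exponential Markov inequality at [z = 1 + eps / 2]. Together with [(z - 1) / z <= ln z] this
    choice leaves a rational inequality in [eps], at the price of the constant [6]. *)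
Lemma chernoff_upper (Y : graph V -> nat) (mu eps : R) : 0 <= mu -> 0 < eps <= 1 ->
  (forall z, 1 <= z -> er_exp (fun G => z ^+ Y G) <= expR (mu * (z - 1))) ->
  er_prob q (fun G => (1 + eps) * mu <= (Y G)%:R) <= expR (- (eps ^+ 2 * mu / 6)).
Proof.
move=> mu0 /andP[e0 e1] mgf; pose z := 1 + eps / 2.
have z0 : 0 < z by rewrite /z; lra.
have lnz : (z - 1) / z <= ln z by rewrite mulrBl divff ?gt_eqF // mul1r ln_geV.
pose c := expR (- ((1 + eps) * mu * ln z)).
have lnz0 : 0 <= ln z.
  by apply: le_trans lnz; apply: divr_ge0; rewrite /z; lra.
apply: (@le_trans _ _ (er_exp (fun G => c * z ^+ Y G))).
  apply: er_prob_markov => [G|G _ h]; first by rewrite mulr_ge0 ?expR_ge0 ?exprn_ge0 ?ltW.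
  have -> : z ^+ Y G = expR ((Y G)%:R * ln z) by rewrite mulr_natl -lnXn // lnK ?posrE ?exprn_gt0.
  rewrite /c -expRD; apply: expR_ge1_ge0.
  by have := ler_wpM2r lnz0 h; lra.
rewrite er_expZ; apply: le_trans (_ : c * expR (mu * (z - 1)) <= _).
  by apply: ler_wpM2l; [exact: expR_ge0|apply: mgf; rewrite /z; lra].
rewrite /c -expRD ler_expR.
have : (1 + eps) * (eps / 2) / (1 + eps / 2) >= eps / 2 + eps ^+ 2 / 6.
  rewrite ler_pdivlMr; [nra|lra].
have : (1 + eps) * ((z - 1) / z) <= (1 + eps) * ln z by apply: ler_wpM2l lnz; lra.
rewrite /z; have -> : 1 + eps / 2 - 1 = eps / 2 by ring.
rewrite mulrA => h1 h2.
have h3 : eps / 2 + eps ^+ 2 / 6 <= (1 + eps) * ln (1 + eps / 2) by lra.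
have := ler_wpM2l mu0 h3; lra.
Qed.

Lemma chernoff_lower (Y : graph V -> nat) (mu eps : R) : 0 <= mu -> 0 < eps <= 1 ->
  (forall z, 0 < z <= 1 -> er_exp (fun G => z ^+ Y G) <= expR (mu * (z - 1))) ->
  er_prob q (fun G => (Y G)%:R <= (1 - eps) * mu) <= expR (- (eps ^+ 2 * mu / 6)).
Proof.
move=> mu0 /andP[e0 e1] mgf; pose z := 1 - eps / 2.
have z0 : 0 < z by rewrite /z; lra.
have z1 : z <= 1 by rewrite /z; lra.
have lnz : (z - 1) / z <= ln z by rewrite mulrBl divff ?gt_eqF // mul1r ln_geV.
pose c := expR (- ((1 - eps) * mu * ln z)).
have lnz0 : ln z <= 0 by apply: ln_le0.
apply: (@le_trans _ _ (er_exp (fun G => c * z ^+ Y G))).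
  apply: er_prob_markov => [G|G _ h]; first by rewrite mulr_ge0 ?expR_ge0 ?exprn_ge0 ?ltW.
  have -> : z ^+ Y G = expR ((Y G)%:R * ln z) by rewrite mulr_natl -lnXn // lnK ?posrE ?exprn_gt0.
  rewrite /c -expRD; apply: expR_ge1_ge0.
  by have := ler_wnM2r lnz0 h; lra.
rewrite er_expZ; apply: le_trans (_ : c * expR (mu * (z - 1)) <= _).
  by apply: ler_wpM2l; [exact: expR_ge0|apply: mgf; rewrite z0].
rewrite /c -expRD ler_expR.
have : (1 - eps) * (eps / 2) / (1 - eps / 2) <= eps / 2 - eps ^+ 2 / 6.
  rewrite ler_pdivrMr; [nra|lra].
have : (1 - eps) * ((z - 1) / z) <= (1 - eps) * ln z by apply: ler_wpM2l lnz; lra.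
rewrite /z; have -> : 1 - eps / 2 - 1 = - (eps / 2) by ring.
rewrite mulrA => h1 h2.
have h3 : - (eps / 2 - eps ^+ 2 / 6) <= (1 - eps) * ln (1 - eps / 2).
  by apply: le_trans h1; rewrite mulrN mulNr; lra.
have := ler_wpM2l mu0 h3; lra.
Qed.

Lemma mgf_le (p z : R) m : 0 <= p <= 1 -> 0 <= z ->
  (1 + p * (z - 1)) ^+ m <= expR (p * m%:R * (z - 1)).
Proof.
move=> /andP[p0 p1] z0; rewrite (_ : p * m%:R * (z - 1) = m%:R * (p * (z - 1))); last by ring.
by rewrite expRM_natl; apply: lerXn2r; rewrite ?nnegrE ?expR_ge0 ?expR_ge1Dx //; nra.
Qed.

Lemma edge_count_mgf X Y z : [disjoint X & Y] -> 0 <= z ->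
  er_exp (fun G => z ^+ edge_count G X Y) <= expR (q * #|X|%:R * #|Y|%:R * (z - 1)).
Proof.
move=> dis z0; rewrite er_exp_edge_count //.
by apply: le_trans (mgf_le _ q01 z0) _; rewrite natrM mulrA.
Qed.

(** The restriction to pairs with linearly many expected edges is what lets a union bound over all
    pairs succeed. *)
Definition quasirandom (c eps : R) G : Prop :=
  forall X Y : {set V}, [disjoint X & Y] -> c * #|V|%:R <= q * #|X|%:R * #|Y|%:R ->
  (1 - eps) * (q * #|X|%:R * #|Y|%:R) <= (edge_count G X Y)%:R <=
  (1 + eps) * (q * #|X|%:R * #|Y|%:R).

(** There are at most [4 ^ n] pairs. The threshold [18 / eps ^+ 2] makes the Chernoff exponent at
    least [3 * n], and [8 <= expR 3] leaves [2 * 4 ^ n / 8 ^ n]. *)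
Lemma quasirandom_prob (eps : R) : 0 < eps <= 1 ->
  er_prob q (fun G => ~ quasirandom (18 / eps ^+ 2) eps G) <= 2 / 2 ^+ #|V|.
Proof.
move=> e01; have e0 : 0 < eps by case/andP: e01.
have q0 : 0 <= q by case/andP: q01.
pose c := 18 / eps ^+ 2; pose n := #|V|.
pose mu (x : {set V} * {set V}) : R := q * #|x.1|%:R * #|x.2|%:R.
pose P (x : {set V} * {set V}) := [disjoint x.1 & x.2] && (c * n%:R <= mu x).
pose B (x : {set V} * {set V}) G :=
  (1 + eps) * mu x <= (edge_count G x.1 x.2)%:R \/
  (edge_count G x.1 x.2)%:R <= (1 - eps) * mu x.
apply: le_trans (_ : \sum_(x | P x) er_prob q (B x) <= _).
  apply: le_trans (er_prob_union P B); apply: er_prob_mono => G _ nq.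
  apply: contrapT => h; apply: nq => X Y dis hc.
  apply/andP; split; rewrite leNgt; apply/negP => lt; apply: h; exists (X, Y);
    rewrite /P /B /mu /= ?dis ?hc //; [right|left]; exact: ltW.
have e3 : (8 : R) <= expR 3.
  have -> : (3 : R) = 3%:R * 1 by ring.
  rewrite expRM_natl; have : (2 : R) <= expR 1 by have := expR_ge1Dx (1 : R); lra.
  move: (expR 1) => t t2; have -> : (8 : R) = 2 ^+ 3 by ring.
  by apply: lerXn2r => //; rewrite nnegrE; lra.
have b x : P x -> er_prob q (B x) <= 2 * (8^-1) ^+ n.
  case/andP=> dis hc; apply: le_trans (er_prob_or _ _) _.
  have mu0 : 0 <= mu x by rewrite !mulr_ge0.
  have ex : expR (- (eps ^+ 2 * mu x / 6)) <= (8^-1) ^+ n.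
    apply: le_trans (_ : expR (n%:R * (- 3)) <= _).
      rewrite ler_expR; suff : 3 * n%:R <= eps ^+ 2 * mu x / 6 by lra.
      have : eps ^+ 2 * (c * n%:R) <= eps ^+ 2 * mu x by apply: ler_wpM2l => //; apply: sqr_ge0.
      have -> : eps ^+ 2 * (c * n%:R) = 18 * n%:R.
        by rewrite /c; field; rewrite gt_eqF.
      lra.
    rewrite expRM_natl expRN; apply: lerXn2r; rewrite ?nnegrE ?invr_ge0 ?expR_ge0 //.
    by rewrite lef_pV2 // posrE ?expR_gt0.
  rewrite mulr_natl mulr2n; apply: lerD.
    apply: le_trans ex; apply: (chernoff_upper mu0 e01) => z z1.
    by apply: edge_count_mgf => //; lra.
  apply: le_trans ex; apply: (chernoff_lower mu0 e01) => z /andP[z0 z1].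
  by apply: edge_count_mgf => //; lra.
apply: le_trans (ler_sum _ b) _.
rewrite sumr_const -[leLHS]mulr_natl.
have cP : (#|P| <= 4 ^ n)%N.
  apply: leq_trans (max_card _) _; rewrite card_prod -cardsT -powersetT card_powerset cardsT.
  by rewrite -expnMn.
apply: le_trans (_ : (4 ^ n)%:R * (2 * (8^-1) ^+ n) <= _).
  by apply: ler_wpM2r; rewrite ?ler_nat // mulr_ge0 // exprn_ge0.
rewrite natrX mulrCA -exprMn; have -> : 4%:R * 8^-1 = 2^-1 :> R by field.
by rewrite exprVn.
Qed.

Lemma nbrs_all G v : G \subset E -> nbrs G [set: V] v = nbrs G [set~ v] v.
Proof.
move=> GE; apply/setP => u; rewrite !inE; case: eqVneq => // ->.
by rewrite /=; apply/negP => /(subsetP GE); rewrite inE setUid cards1.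
Qed.

(** Exponential Markov inequality with base [2] and [1 / 2 <= ln 2], then a union bound over the
    vertices. *)
Lemma max_degree_prob (K : R) :
  er_prob q (fun G => ~ forall v, #|nbrs G [set: V] v|%:R <= K) <=
  #|V|%:R * expR (q * #|V|%:R - K / 2).
Proof.
have q0 : 0 <= q by case/andP: q01.
apply: le_trans (_ : er_prob q (fun G => exists2 v : V, predT v & K < #|nbrs G [set: V] v|%:R) <= _).
  apply: er_prob_mono => G _ nq; apply: contrapT => h; apply: nq => v.
  by rewrite leNgt; apply/negP => lt; apply: h; exists v.
apply: le_trans (er_prob_union _ _) _.
rewrite mulr_natl -sumr_const; apply: ler_sum => v _.
have dis : [disjoint [set~ v] & [set v]] by rewrite disjoints_subset subxx.
apply: le_trans (_ : er_exp (fun G => expR (- K / 2) * 2 ^+ edge_count G [set~ v] [set v]) <= _).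
  apply: er_prob_markov => [G|G GE lt]; first by rewrite mulr_ge0 ?expR_ge0 ?exprn_ge0.
  rewrite /edge_count big_set1 -nbrs_all //; move: lt.
  move: #|_| => d lt.
  have -> : (2 : R) ^+ d = expR (d%:R * ln 2) by rewrite mulr_natl -lnXn // lnK ?posrE ?exprn_gt0.
  rewrite -expRD; apply: expR_ge1_ge0.
  have l2 : (1 / 2 : R) <= ln 2 by have := @ln_geV R 2 (ltr0n _ 2); lra.
  have : d%:R * (1 / 2) <= d%:R * ln 2 :> R by apply: ler_wpM2l.
  by lra.
rewrite er_expZ addrC expRD mulNr; apply: ler_wpM2l; first exact: expR_ge0.
apply: le_trans (edge_count_mgf dis _) _ => //.
rewrite ler_expR cards1 mulr1; have -> : (2 - 1 : R) = 1 by ring.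
by rewrite mulr1; apply: ler_wpM2l => //; rewrite ler_nat max_card.
Qed.

Lemma frontier_mgf A U z : [disjoint A & U] -> 0 <= z ->
  er_exp (fun G => z ^+ #|frontier G A U|) <=
  expR ((1 - (1 - q) ^+ #|A|) * #|U|%:R * (z - 1)).
Proof.
move=> dis z0; rewrite er_exp_frontier //; apply: mgf_le => //.
have /andP[q0 q1] := q01.
have h0 : 0 <= (1 - q) ^+ #|A| by apply: exprn_ge0; lra.
have h1 : (1 - q) ^+ #|A| <= 1 by apply: exprn_ile1; lra.
by lra.
Qed.

Lemma frontier_upper A U (eps : R) : [disjoint A & U] -> 0 < eps <= 1 ->
  er_prob q (fun G => (1 + eps) * (q * #|V|%:R * #|A|%:R) <= #|frontier G A U|%:R) <=
  expR (- (eps ^+ 2 * (q * #|V|%:R * #|A|%:R) / 6)).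
Proof.
move=> dis e01; have /andP[q0 q1] := q01.
apply: (chernoff_upper _ e01) => [|z z1]; first by rewrite !mulr_ge0.
apply: le_trans (frontier_mgf dis _) _; first by lra.
rewrite ler_expR; apply: ler_wpM2r; first by lra.
have h : 1 - q * #|A|%:R <= (1 - q) ^+ #|A|.
  elim: #|A| => [|m IH]; first by rewrite mulr0 subr0 expr0.
  rewrite exprS; apply: le_trans (_ : (1 - q) * (1 - q * m%:R) <= _); last first.
    by apply: ler_wpM2l IH; lra.
  rewrite -natr1; have : 0 <= q * (q * m%:R) by rewrite !mulr_ge0.
  by lra.
have UV : #|U|%:R <= #|V|%:R :> R by rewrite ler_nat max_card.
rewrite mulrAC; apply: le_trans (_ : q * #|A|%:R * #|U|%:R <= _).
  by apply: ler_wpM2r => //; lra.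
by apply: ler_wpM2l => //; rewrite mulr_ge0.
Qed.

Lemma frontier_lower A U (eps m : R) : [disjoint A & U] -> 0 < eps <= 1 ->
  0 <= m <= (1 - (1 - q) ^+ #|A|) * #|U|%:R ->
  er_prob q (fun G => #|frontier G A U|%:R <= (1 - eps) * m) <=
  expR (- (eps ^+ 2 * m / 6)).
Proof.
move=> dis e01 /andP[m0 mU].
apply: (chernoff_lower m0 e01) => z /andP[z0 z1].
apply: le_trans (frontier_mgf dis (ltW z0)) _.
by rewrite ler_expR; apply: ler_wnM2r mU; lra.
Qed.

(** * Breadth-first exploration *)

Section Exploration.
Variables (lo hi : nat -> R).

Fixpoint explores (k i : nat) A U G : Prop :=
  if k is k'.+1 then
    lo i.+1 <= #|frontier G A U|%:R <= hi i.+1 /\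
    explores k' i.+1 (frontier G A U) (U :\: frontier G A U) G
  else True.

Lemma frontier_sub G A U : frontier G A U \subset U.
Proof. by apply/subsetP => v; rewrite inE => /andP[]. Qed.

Lemma eq_frontier G H A U :
  (forall u v, u \in A -> v \in U -> adj G u v = adj H u v) ->
  frontier G A U = frontier H A U.
Proof.
move=> e; apply/setP => v; rewrite !inE; case: (boolP (v \in U)) => //= vU.
by congr (_ != set0); apply/setP => u; rewrite !inE; case: (boolP (u \in A)) => //= uA; rewrite e.
Qed.

Lemma eq_explores G H (W : {set V}) k i A U : A \subset W -> U \subset W -> [disjoint A & U] ->
  (forall u v, u \in W -> v \in W -> u != v -> adj G u v = adj H u v) ->
  explores k i A U G -> explores k i A U H.
Proof.
move=> + + + e; elim: k i A U => [//|k IH] i A U AW UW dis /=.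
rewrite (@eq_frontier G H) => [[? h]|u v uA vU]; last first.
  apply: e; [exact: (subsetP AW)|exact: (subsetP UW)|].
  by apply: contraTneq vU => <-; rewrite (disjointFr dis).
split=> //; apply: IH h.
- exact: subset_trans (frontier_sub _ _ _) UW.
- by apply: subset_trans UW; apply: subsetDl.
- by rewrite disjoint_sym disjoints_subset setDE subsetIr.
Qed.

Variables (m : nat) (expl : nat -> R) (delta : nat -> R).
Hypothesis expl_step : forall i, expl i + hi i.+1 <= expl i.+1.
Hypothesis delta_ge0 : forall i, 0 <= delta i.
Hypothesis step : forall i A U, (i < m)%N -> [disjoint A & U] ->
  lo i <= #|A|%:R <= hi i -> #|V|%:R - expl i <= #|U|%:R ->
  er_prob q (fun G => ~ lo i.+1 <= #|frontier G A U|%:R <= hi i.+1) <= delta i.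

(** The event that the first frontier is [A'] is decided by edges not contained in [U], whereas the
    rest of the exploration only sees edges inside [U]; the two are independent. The events for
    different [A'] are disjoint, so the failure probabilities of the steps add up. *)
Lemma explores_prob k i A U : (i + k <= m)%N -> [disjoint A & U] ->
  lo i <= #|A|%:R <= hi i -> #|V|%:R - expl i <= #|U|%:R ->
  er_prob q (fun G => ~ explores k i A U G) <= \sum_(i <= j < i + k) delta j.
Proof.
elim: k i A U => [|k IH] i A U ikm dis hA hU.
  rewrite addn0 big_geq //; rewrite er_probE; apply: le_trans (_ : er_exp (fun=> 0) <= _).
    by apply: le_er_exp => G _; case: asboolP => //= h; exfalso; apply: h.
  by rewrite /er_exp big1 // => G _; rewrite mulr0.
rewrite addnS big_ltn ?ltnS ?leq_addr // -addSn.
set D := \sum_(i.+1 <= j < i.+1 + k) delta j.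
pose good (A' : {set V}) := lo i.+1 <= #|A'|%:R <= hi i.+1.
pose P (A' : {set V}) := (A' \subset U) && good A'.
apply: le_trans (_ : er_prob q (fun G => ~ good (frontier G A U) \/
   exists2 A', P A' & frontier G A U = A' /\ ~ explores k i.+1 A' (U :\: A') G) <= _).
  apply: er_prob_mono => G _ /= h.
  case: (boolP (good (frontier G A U))) => hg; last by left; apply/negP.
  right; exists (frontier G A U); first by rewrite /P frontier_sub.
  by split=> // he; apply: h.
apply: le_trans (er_prob_or _ _) _; apply: lerD; first by apply: step => //; lia.
apply: le_trans (er_prob_union _ _) _.
have D0 : 0 <= D by apply: sumr_ge0.
have one : \sum_(A' | P A') er_prob q (fun G => frontier G A U = A') <= 1.
  under eq_bigr => A' _ do rewrite er_probE.
  rewrite -er_exp_sum -[leRHS]er_exp1; apply: le_er_exp => G _.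
  case: (boolP (P (frontier G A U))) => hP.
    rewrite (bigD1 (frontier G A U)) //= big1 ?addr0 => [|A' /andP[_ ne]].
      by case: asboolP.
    by case: asboolP => // e; rewrite e eqxx in ne.
  rewrite big1 // => A' hA'; case: asboolP => // e.
  by rewrite e hA' in hP.
apply: le_trans (_ : \sum_(A' | P A') er_prob q (fun G => frontier G A U = A') * D <= _); last first.
  by rewrite -mulr_suml; apply: ler_piMl.
apply: ler_sum => A' /andP[A'U gA'].
pose f G : R := `[< frontier G A U = A' >]%:R.
pose g G : R := `[< ~ explores k i.+1 A' (U :\: A') G >]%:R.
pose S2 : {set {set V}} := [set e in E | e \subset U].
pose S1 : {set {set V}} := [set e in E | ~~ (e \subset U)].
have memS S G H : G :&: S = H :&: S -> forall e, e \in S -> (e \in G) = (e \in H).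
  by move=> e x xS; have /setP/(_ x) := e; rewrite !inE xS !andbT.
have d1 : depends_on S1 f.
  move=> G H /memS e; rewrite /f (@eq_frontier G H) // => u v uA vU; apply: e.
  have uU : u \notin U by rewrite (disjointFr dis).
  rewrite !inE cards2; have -> : u != v by apply: contraNneq uU => ->.
  by rewrite /= ?eqxx /=; apply/subsetPn; exists u; rewrite ?set21.
have dis' : [disjoint A' & U :\: A'].
  by rewrite disjoint_sym disjoints_subset setDE subsetIr.
have d2 : depends_on S2 g.
  have imp G H : G :&: S2 = H :&: S2 ->
      explores k i.+1 A' (U :\: A') G -> explores k i.+1 A' (U :\: A') H.
    move=> /memS e; apply: (@eq_explores G H U) => //; first exact: subsetDl.
    move=> u v uU vU uv; apply: e; rewrite !inE cards2 uv /=.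
    by apply/subsetP => x /set2P[] ->.
  move=> G H e; rewrite /g; congr ((nat_of_bool _)%:R).
  by apply/asboolP/asboolP => h h'; apply: h; [apply: imp (esym e) h'|apply: imp e h'].
have -> : er_prob q (fun G => frontier G A U = A' /\ ~ explores k i.+1 A' (U :\: A') G) =
    er_exp (fun G => f G * g G).
  rewrite er_probE; apply: eq_er_exp => G _; rewrite /f /g asbool_and.
  by case: asboolP; case: asboolP => _ _; rewrite /= ?mulr0 ?mulr1.
rewrite (er_exp_indep _ _ _ d1 d2); first last.
- rewrite disjoint_subset; apply/subsetP => e; rewrite !inE => /andP[-> h].
  by rewrite (negPf h).
- by apply/subsetP => e; rewrite inE => /andP[].
- by apply/subsetP => e; rewrite inE => /andP[].
rewrite -/f -er_probE; apply: ler_wpM2l; first exact: er_prob_ge0.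
rewrite -[er_exp g]er_probE; apply: IH => //; first by rewrite addSnnS.
case/andP: gA' => _ hiA'.
have -> : #|U :\: A'|%:R = #|U|%:R - #|A'|%:R :> R.
  by rewrite cardsDS // natrB // subset_leq_card.
by have := expl_step i; lra.
Qed.

End Exploration.

End ErdosRenyi.

Section Layers.
Variables (V : finType) (r : V).
Implicit Types (G : graph V).

Definition layer G k : {set V} := [set v | gdist G r v == k].
Definition within G k : {set V} := [set v | (gdist G r v <= k)%N].

Lemma layer0 G : layer G 0 = [set r].
Proof. by apply/setP => v; rewrite !inE gdist_eq0. Qed.

Lemma within0 G : within G 0 = [set r].
Proof. by apply/setP => v; rewrite !inE leqn0 gdist_eq0. Qed.

Lemma frontier_layer G k : (k.+1 < #|V|)%N ->
  frontier G (layer G k) (~: within G k) = layer G k.+1.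
Proof.
move=> kV; apply/setP => v; rewrite !inE -ltnNge; apply/andP/eqP => [[kv /set0Pn[u]]|dv].
  rewrite !inE => /andP[/eqP du uv]; have := gdist_adj r uv; rewrite du => h.
  by apply/eqP; rewrite eqn_leq h.
rewrite dv leqnn; split=> //; have [u uv du] := gdist_pred dv kV.
by apply/set0Pn; exists u; rewrite !inE du eqxx.
Qed.

Lemma within_step G k : ~: within G k :\: layer G k.+1 = ~: within G k.+1.
Proof. by apply/setP => v; rewrite !inE; lia. Qed.

Lemma explores_layers (R : realType) (lo hi : nat -> R) G k i : (i + k < #|V|)%N ->
  explores lo hi k i (layer G i) (~: within G i) G ->
  forall j, (i < j <= i + k)%N -> lo j <= #|layer G j|%:R <= hi j.
Proof.
elim: k i => [|k IH] i ik /= h j ij; first by lia.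
move: h; rewrite frontier_layer ?within_step; last by lia.
case=> hi1 h; case: (eqVneq j i.+1) => [-> //|ne].
by apply: (IH i.+1) => //; lia.
Qed.

End Layers.

Lemma succ_lt_of_ne i D : i <> D.-1 -> (i < D)%N -> (i.+1 < D)%N.
Proof. lia. Qed.

Lemma sum_last (R : nmodType) (c : R) D : (0 < D)%N ->
  \sum_(0 <= i < D) (if i == D.-1 then c else 0) = c.
Proof.
case: D => // d _; rewrite big_nat_recr //= eqxx big_nat_cond big1 ?add0r //.
by move=> i /andP[/andP[_ id] _]; rewrite ltn_eqF.
Qed.

(** * Sizes of the distance layers *)

Section LayerSizes.
Variables (R : realType) (V : finType) (r : V) (q : R).
Hypothesis q01 : 0 <= q <= 1.
Variables (n md : R).
Hypotheses (nE : n = #|V|%:R) (mdE : md = q * n).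

Lemma expRN_leV (t : R) : 0 <= t -> t / (1 + t) <= 1 - expR (- t).
Proof.
move=> t0; rewrite expRN; have h := expR_ge1Dx t.
have : (expR t)^-1 <= (1 + t)^-1 by rewrite lef_pV2 ?posrE ?expR_gt0 //; lra.
suff : t / (1 + t) = 1 - (1 + t)^-1 by move=> ->; lra.
by field; lra.
Qed.

Lemma pow1B_le_expR (a : nat) : (1 - q) ^+ a <= expR (- (q * a%:R)).
Proof.
have /andP[q0 q1] := q01.
have -> : - (q * a%:R) = a%:R * (- q) by ring.
rewrite expRM_natl; apply: lerXn2r; rewrite ?nnegrE ?expR_ge0 ?subr_ge0 //.
exact: expR_ge1Dx.
Qed.

(** The tangent to [expR (- t)] at [c * y] is evaluated at [0] and at [y], and the two inequalities
    are averaged with weights [1 - c] and [c]. *)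
Lemma expRN_concave (c y : R) : 0 <= c <= 1 -> 
  c * (1 - expR (- y)) <= 1 - expR (- (c * y)).
Proof.
move=> /andP[c0 c1]; set a := expR (- (c * y)).
have h1 : a * (1 + c * y) <= 1.
  have e : a * expR (c * y) = 1 by rewrite /a -expRD addNr expR0.
  by rewrite -[leRHS]e; apply: ler_wpM2l; rewrite ?expR_ge0 ?expR_ge1Dx.
have h2 : a * (1 - (1 - c) * y) <= expR (- y).
  have -> : - y = - (c * y) + - ((1 - c) * y) by ring.
  by rewrite expRD; apply: ler_wpM2l; rewrite ?expR_ge0 ?expR_ge1Dx.
have := ler_wpM2l c0 h2; have c1' : 0 <= 1 - c by lra.
have := ler_wpM2l c1' h1; rewrite -/a.
have -> : (1 - c) * (a * (1 + c * y)) = a * (1 - c) + a * (c * y) * (1 - c) by ring.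
have -> : c * (a * (1 - (1 - c) * y)) = a * c - a * (c * y) * (1 - c) by ring.
by lra.
Qed.

Variables (D : nat) (eps : R).
Hypotheses (D0 : (0 < D)%N) (DV : (D < #|V|)%N) (md8 : 8 <= md).
Hypothesis eps01 : 0 < eps <= 1 / 8.
Local Notation x k := (md ^+ k / n).
Local Notation y := (x D).
Hypothesis xD : x D.-1 <= eps / 48.

Let s := eps ^+ 2 * md / 400.

(** The relative errors of the steps decrease like [2^-1 ^+ k], so their sum stays below [eps]. The
    term [6 * x k] accounts for vertices already explored or reached more than once. In layer [D]
    this saturation need not be small, since [md ^+ D] may be of order [n] or larger; the exact
    profile [n * (1 - expR (- y))] is kept instead. *)
Definition lo_size k : R :=
  if (k < D)%N then md ^+ k * (1 - eps * (1 - 2^-1 ^+ k) - 6 * x k)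
  else (1 - 4 * eps) * (n * (1 - expR (- y))).

Definition hi_size k : R := md ^+ k * (1 + eps * (1 - 2^-1 ^+ k)).

Let n0 : 0 < n.
Proof. by rewrite nE ltr0n; lia. Qed.

Let md0 : 0 < md.
Proof. by have := md8; lra. Qed.

Let half_bounds k : 0 < (2^-1 : R) ^+ k <= 1.
Proof. by rewrite exprn_gt0 //= exprn_ile1 //; lra. Qed.

Let x_gt0 k : 0 < x k.
Proof. by rewrite divr_gt0 ?exprn_gt0. Qed.

Let x_succ k : x k.+1 = md * x k.
Proof. by rewrite exprS mulrA. Qed.

Let x_mono k j : (k <= j)%N -> x k <= x j.
Proof.
by move=> kj; rewrite ler_pM2r ?invr_gt0 // ler_weXn2l // (le_trans _ md8) //; lra.
Qed.

Let x_small k : (k < D)%N -> x k <= eps / 48.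
Proof. by move=> kD; apply: le_trans xD; apply: x_mono; lia. Qed.

Let hi_le k : hi_size k <= md ^+ k * (9 / 8).
Proof.
rewrite /hi_size; apply: ler_wpM2l; first by rewrite exprn_ge0 // ltW.
have /andP[h0 h1] := half_bounds k; have /andP[e0 e1] := eps01; nra.
Qed.

Let lo_ge k : (k < D)%N -> md ^+ k * (1 - 2 * eps) <= lo_size k.
Proof.
move=> kD; rewrite /lo_size kD; apply: ler_wpM2l; first by rewrite exprn_ge0 // ltW.
have /andP[h0 h1] := half_bounds k; have /andP[e0 e1] := eps01.
have := x_small kD; have : 0 <= eps * 2^-1 ^+ k by rewrite mulr_ge0 // ltW.
by lra.
Qed.

(** Since [8 <= md], twice the last layer dominates the geometric sum of all layers. *)
Definition explored k : R := 2 * md ^+ k.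

Let explored_step k : explored k + hi_size k.+1 <= explored k.+1.
Proof.
have := hi_le k.+1; rewrite /explored exprS.
have p : 0 < md ^+ k by rewrite exprn_gt0.
have : 8 * md ^+ k <= md * md ^+ k by rewrite ler_pM2r.
by lra.
Qed.

Let sq_pow k : (eps * 2^-1 ^+ k.+2) ^+ 2 * md ^+ k.+1 = eps ^+ 2 / 4 * (md / 4) ^+ k.+1.
Proof.
rewrite exprMn -exprM mulnC exprM [(md / 4) ^+ _]exprMn.
have -> : (2^-1 ^+ 2 : R) = 4^-1 by field.
by rewrite (exprS _ k.+1); ring.
Qed.

Let pow_lin (t : R) k : 2 <= t -> k.+1%:R * t <= t ^+ k.+1.
Proof.
move=> t2; elim: k => [|k IH]; first by rewrite mul1r expr1.
rewrite exprS -[k.+2%:R]natr1.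
have : t * (k.+1%:R * t) <= t * t ^+ k.+1 by apply: ler_wpM2l => //; lra.
have : 1 <= (k.+1%:R : R) by rewrite ler1n.
move=> k1 h; apply: le_trans h; rewrite [leLHS]mulrC; apply: ler_wpM2l; nra.
Qed.

(** From one step to the next the squared relative error shrinks by [4] while the mean grows by
    [md], at least [8]. As [t ^+ k.+1] is at least [k.+1 * t] for [t = md / 4], the failure
    probabilities are bounded by a geometric sequence. *)
Let tail_exp k : expR (- ((eps * 2^-1 ^+ k.+2) ^+ 2 * (md ^+ k.+1 / 2) / 6)) <=
  expR (- s) ^+ k.+1.
Proof.
rewrite -expRM_natl ler_expR mulrA sq_pow.
have := @pow_lin (md / 4) k; have -> : 2 <= md / 4 by have := md8; lra.
move=> /(_ isT) h.
have e2 : 0 <= eps ^+ 2 by rewrite sqr_ge0.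
have := ler_wpM2l e2 h.
rewrite /s; have : 0 <= eps ^+ 2 * (k.+1%:R * (md / 4)).
  by apply: mulr_ge0 => //; apply: mulr_ge0 => //; rewrite divr_ge0 // ltW.
by lra.
Qed.

Let step_upper i (A U : {set V}) : (i < D)%N -> [disjoint A & U] ->
  lo_size i <= #|A|%:R <= hi_size i ->
  er_prob q (fun G => hi_size i.+1 < #|frontier G A U|%:R) <= expR (- s) ^+ i.+1.
Proof.
move=> iD dis /andP[loA hiA]; have /andP[e0 e1] := eps01.
pose e := eps * 2^-1 ^+ i.+2.
have /andP[h0 h1] := half_bounds i.+2.
have e01 : 0 < e <= 1 by rewrite /e; nra.
apply: le_trans (tail_exp i); rewrite -/e.
apply: (@le_trans _ _ (er_prob q (fun G => (1 + e) * (q * #|V|%:R * #|A|%:R) <= #|frontier G A U|%:R))).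
  apply: er_prob_mono => // G _ /ltW; rewrite -nE -mdE; apply: le_trans.
  apply: (@le_trans _ _ ((1 + e) * (md * hi_size i))).
    apply: ler_wpM2l; first by case/andP: e01 => *; lra.
    by apply: ler_wpM2l; [exact: ltW|exact: hiA].
  rewrite /hi_size exprS -!mulrA mulrCA ler_pM2l // [leLHS]mulrCA ler_pM2l ?exprn_gt0 //.
  have -> : (2^-1 : R) ^+ i = 4 * 2^-1 ^+ i.+2 by rewrite !exprS; field.
  have -> : (2^-1 : R) ^+ i.+1 = 2 * 2^-1 ^+ i.+2 by rewrite [in RHS]exprS; field.
  rewrite /e; move: (2^-1 ^+ i.+2) h0 h1 => t t0 t1.
  by have : 0 < eps * t; [rewrite mulr_gt0|nra].
apply: le_trans (frontier_upper q01 dis e01) _; rewrite -nE -mdE ler_expR lerN2.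
rewrite ler_pM2r ?invr_gt0 //; apply: ler_wpM2l; first exact: sqr_ge0.
rewrite exprS -mulrA ler_pM2l //; apply: le_trans loA; apply: le_trans (lo_ge iD).
by apply: ler_wpM2l; [rewrite exprn_ge0 // ltW|lra].
Qed.

Let p_ge (a : nat) : 1 - expR (- (q * a%:R)) <= 1 - (1 - q) ^+ a.
Proof. by have := pow1B_le_expR a; lra. Qed.

Let U_ge i (U : {set V}) : n - explored i <= #|U|%:R -> n * (1 - 2 * x i) <= #|U|%:R.
Proof.
apply: le_trans; rewrite /explored.
by have -> : n * (1 - 2 * x i) = n - 2 * md ^+ i by field; rewrite gt_eqF.
Qed.

Let step_lower i (A U : {set V}) : (i.+1 < D)%N -> [disjoint A & U] ->
  lo_size i <= #|A|%:R <= hi_size i -> n - explored i <= #|U|%:R ->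
  er_prob q (fun G => #|frontier G A U|%:R < lo_size i.+1) <= expR (- s) ^+ i.+1.
Proof.
move=> iD dis /andP[loA hiA] hU; have /andP[e0 e1] := eps01.
have /andP[q0 q1] := q01.
pose e := eps * 2^-1 ^+ i.+2.
have /andP[h0 h1] := half_bounds i.+2.
have e01 : 0 < e <= 1 by rewrite /e; nra.
have e8 : e <= 1 / 8 by rewrite /e; nra.
have iD' : (i < D)%N := ltnW iD.
have Mp : 0 < md ^+ i by rewrite exprn_gt0.
pose X := x i.+1; have X0 : 0 < X := x_gt0 _; have X1 : X <= eps / 48 := x_small iD.
have xiX : 8 * x i <= X by rewrite /X x_succ ler_pM2r.
have a0 : 0 <= #|A|%:R :> R by [].
pose t := q * #|A|%:R.
have t0 : 0 <= t by rewrite mulr_ge0.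
have tX : t <= 9 / 8 * X.
  rewrite /t /X exprS; have -> : 9 / 8 * (md * md ^+ i / n) = q * (md ^+ i * (9 / 8)).
    by rewrite {1}mdE; field; rewrite gt_eqF.
  by apply: ler_wpM2l => //; apply: le_trans hiA (hi_le i).
(* The factor [1 - 2 * X] covers both the loss from [t] to [t / (1 + t)], due to vertices with
   several neighbours in [A], and the vertices explored before. *)
pose m := md * #|A|%:R * (1 - 2 * X).
have mU : 0 <= m <= (1 - (1 - q) ^+ #|A|) * #|U|%:R.
  apply/andP; split.
    by apply: mulr_ge0; [rewrite mulr_ge0 // ltW|lra].
  apply: (@le_trans _ _ (t / (1 + t) * (n * (1 - 2 * x i)))); last first.
    apply: ler_pM.
    - by apply: divr_ge0 => //; lra.
    - by apply: mulr_ge0; [exact: ltW|lra].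
    - by apply: le_trans (p_ge _); apply: expRN_leV.
    - exact: U_ge.
  have -> : m = t * n * (1 - 2 * X) by rewrite /m /t mdE; ring.
  rewrite -mulrA [leRHS]mulrAC -!mulrA; apply: ler_wpM2l => //.
  apply: ler_wpM2l => //; rewrite ler_pM2l // ler_pdivlMr; last by lra.
  by have := mulr_ge0 (ltW X0) t0; lra.
apply: le_trans (tail_exp i); rewrite -/e.
apply: (@le_trans _ _ (er_prob q (fun G => #|frontier G A U|%:R <= (1 - e) * m))).
  apply: er_prob_mono => // G _ /ltW h; apply: le_trans h _.
  rewrite /lo_size iD -/X exprS -mulrA /m.
  have -> : (1 - e) * (md * #|A|%:R * (1 - 2 * X)) = md * (#|A|%:R * ((1 - e) * (1 - 2 * X))) by ring.
  rewrite ler_pM2l //.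
  apply: (@le_trans _ _ (lo_size i * ((1 - e) * (1 - 2 * X)))); last first.
    by apply: ler_wpM2r loA; rewrite mulr_ge0 //; lra.
  rewrite /lo_size iD' -mulrA ler_pM2l //.
  have -> : (2^-1 : R) ^+ i = 4 * 2^-1 ^+ i.+2 by rewrite !exprS; field.
  have -> : (2^-1 : R) ^+ i.+1 = 2 * 2^-1 ^+ i.+2 by rewrite [in RHS]exprS; field.
  have xi0 := x_gt0 i.
  rewrite /e; move: (2^-1 ^+ i.+2) (x i) h0 h1 xi0 xiX => v w v0 v1 w0 wX.
  have ev : 0 < eps * v by rewrite mulr_gt0.
  have evw : 0 <= eps * v * X by rewrite mulr_ge0 // ltW.
  pose B := 1 - eps * (1 - 4 * v) - 6 * w.
  have B1 : B <= 1 + 3 * (eps * v).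
    by rewrite /B; nra.
  have B0 : 0 <= B by rewrite /B; nra.
  have C1 : 1 - eps * v - 2 * X <= (1 - eps * v) * (1 - 2 * X) by nra.
  have := ler_wpM2l B0 C1; rewrite -/B; apply: le_trans.
  have -> : B * (1 - eps * v - 2 * X) = B - B * (eps * v + 2 * X) by ring.
  have ev8 : eps * v <= 1 / 8 by apply: le_trans e1; rewrite ler_piMr // ltW.
  have : B * (eps * v + 2 * X) <= (11 / 8) * (eps * v + 2 * X).
    by apply: ler_wpM2r; lra.
  by rewrite /B; lra.
apply: le_trans (frontier_lower q01 dis e01 mU) _; rewrite ler_expR lerN2.
rewrite ler_pM2r ?invr_gt0 //; apply: ler_wpM2l; first exact: sqr_ge0.
rewrite exprS /m -[leLHS]mulrA -[leRHS]mulrA ler_pM2l //.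
apply: (@le_trans _ _ (md ^+ i * (1 - 2 * eps) * (1 - 2 * X))).
  by rewrite -[leRHS]mulrA; apply: ler_wpM2l; [exact: ltW|nra].
by apply: ler_wpM2r; [lra|apply: le_trans loA; apply: lo_ge].
Qed.

(** Concavity of the saturated profile turns the factor [1 - 2 * eps] lost on layer [D.-1] into the
    same factor on [1 - expR (- y)]; the concentration step and the explored vertices use up the
    rest of [4 * eps]. *)
Let step_last (A U : {set V}) : [disjoint A & U] ->
  lo_size D.-1 <= #|A|%:R <= hi_size D.-1 -> n - explored D.-1 <= #|U|%:R ->
  er_prob q (fun G => #|frontier G A U|%:R < lo_size D) <=
  expR (- (eps ^+ 2 * (n * (1 - expR (- y))) / 12)).
Proof.
move=> dis /andP[loA hiA] hU; have /andP[e0 e1] := eps01.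
have /andP[q0 q1] := q01.
have e01 : 0 < eps <= 1 by apply/andP; split; lra.
have DD : (D.-1 < D)%N by rewrite prednK.
pose w := 1 - expR (- y).
have w0 : 0 <= w.
  by rewrite /w subr_ge0 -expR0 ler_expR oppr_le0 ltW.
have wp : (1 - 2 * eps) * w <= 1 - (1 - q) ^+ #|A|.
  apply: le_trans (p_ge _); apply: le_trans (expRN_concave y _) _.
    by apply/andP; split; lra.
  suff : (1 - 2 * eps) * y <= q * #|A|%:R by move=> h; rewrite lerD2l lerN2 ler_expR lerN2.
  have -> : y = q * md ^+ D.-1.
    by rewrite -{1}(prednK D0) exprS {1}mdE; field; rewrite gt_eqF.
  rewrite mulrCA; apply: ler_wpM2l => //; apply: le_trans loA.
  by rewrite mulrC; apply: lo_ge.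
pose m := (1 - 3 * eps) * (n * w).
have nw : 0 <= n * w by rewrite mulr_ge0 // ltW.
have mU : 0 <= m <= (1 - (1 - q) ^+ #|A|) * #|U|%:R.
  apply/andP; split; first by rewrite /m mulr_ge0 //; lra.
  apply: (@le_trans _ _ ((1 - 2 * eps) * w * (n * (1 - 2 * x D.-1)))); last first.
    have xs := xD; apply: ler_pM => //; last exact: U_ge.
      by rewrite mulr_ge0 //; lra.
    by apply: mulr_ge0; [exact: ltW|lra].
  have -> : (1 - 2 * eps) * w * (n * (1 - 2 * x D.-1)) =
      (1 - 2 * eps) * (1 - 2 * x D.-1) * (n * w) by ring.
  by apply: ler_wpM2r => //; have := xD; have := x_gt0 D.-1; move: (x D.-1) => z; nra.
apply: (@le_trans _ _ (er_prob q (fun G => #|frontier G A U|%:R <= (1 - eps) * m))).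
  apply: er_prob_mono => // G _ /ltW h; apply: le_trans h _.
  rewrite /lo_size ltnn -/w /m mulrA; apply: ler_wpM2r => //; nra.
apply: le_trans (frontier_lower q01 dis e01 mU) _; rewrite ler_expR lerN2 -/w /m.
have : eps ^+ 2 * ((1 / 2) * (n * w)) <= eps ^+ 2 * ((1 - 3 * eps) * (n * w)).
  by apply: ler_wpM2l; [exact: sqr_ge0|apply: ler_wpM2r => //; lra].
by lra.
Qed.

Let last_bound := expR (- (eps ^+ 2 * (n * (1 - expR (- y))) / 12)).

Definition regular_layers G : Prop :=
  (forall k, (k < D)%N ->
     (1 - 2 * eps) * md ^+ k <= #|layer r G k|%:R <= (1 + eps) * md ^+ k) /\
  (1 - 4 * eps) * (n * (1 - expR (- y))) <= #|layer r G D|%:R <= (1 + eps) * md ^+ D.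

Lemma regular_layers_prob : expR (- (eps ^+ 2 * md / 400)) <= 1 / 2 ->
  er_prob q (fun G => ~ regular_layers G) <=
  4 * expR (- (eps ^+ 2 * md / 400)) + expR (- (eps ^+ 2 * (n * (1 - expR (- y))) / 12)).
Proof.
rewrite -/s -/last_bound => s2; have /andP[e0 e1] := eps01.
have es0 : 0 <= expR (- s) by apply: expR_ge0.
have lb0 : 0 <= last_bound by apply: expR_ge0.
(* A step may fail from above or from below; only the lower bound of the last step has another rate,
   governed by the saturated mean. *)
pose delta i := 2 * expR (- s) ^+ i.+1 + if i == D.-1 then last_bound else 0.
have delta0 i : 0 <= delta i.
  by rewrite addr_ge0 // ?mulr_ge0 ?exprn_ge0 //; case: ifP.
have step i (A U : {set V}) : (i < D)%N -> [disjoint A & U] ->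
    lo_size i <= #|A|%:R <= hi_size i -> #|V|%:R - explored i <= #|U|%:R ->
    er_prob q (fun G => ~ lo_size i.+1 <= #|frontier G A U|%:R <= hi_size i.+1) <= delta i.
  rewrite -nE => iD dis hA hU.
  apply: le_trans (_ : er_prob q (fun G => #|frontier G A U|%:R < lo_size i.+1 \/
      hi_size i.+1 < #|frontier G A U|%:R) <= _).
    apply: er_prob_mono => // G _ /negP; rewrite negb_and -!ltNge => /orP[]; by [left|right].
  apply: le_trans (er_prob_or q01 _ _) _; have hup := step_upper iD dis hA.
  rewrite /delta; case: eqP => [ie|ie].
    have -> : i.+1 = D by rewrite ie prednK.
    have := @step_last A U dis; rewrite -ie => /(_ hA hU).
    have : 0 <= expR (- s) ^+ D by rewrite exprn_ge0.
    by move: hup; rewrite {1 2}ie prednK // -/last_bound; lra.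
  have iD1 := succ_lt_of_ne ie iD.
  by have := step_lower iD1 dis hA hU; lra.
have sum_delta : \sum_(0 <= j < 0 + D) delta j <= 4 * expR (- s) + last_bound.
  rewrite add0n big_split /=; apply: lerD; last first.
    by rewrite sum_last.
  rewrite -mulr_sumr.
  have geo k : \sum_(0 <= j < k) expR (- s) ^+ j.+1 <= 2 * expR (- s) * (1 - 2^-1 ^+ k).
    elim: k => [|k IH]; first by rewrite big_geq // expr0 subrr mulr0.
    rewrite big_nat_recr //=.
    have : expR (- s) ^+ k.+1 <= expR (- s) * 2^-1 ^+ k.
      rewrite exprS; apply: ler_wpM2l => //; apply: lerXn2r; rewrite ?nnegrE //; lra.
    by rewrite [2^-1 ^+ k.+1]exprS; lra.
  have := geo D; have /andP[h _] := half_bounds D.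
  by have := mulr_ge0 es0 (ltW h); lra.
apply: le_trans sum_delta.
have := @explores_prob R V q q01 lo_size hi_size D explored delta explored_step delta0 step
  D 0 [set r] (~: [set r]) (leqnn _).
rewrite cards1 => h; apply: le_trans (h _ _ _).
- apply: er_prob_mono => // G _ nreg ex; apply: nreg.
  have := @explores_layers V r R lo_size hi_size G D 0.
  rewrite layer0 within0 add0n => /(_ DV ex) lay; split=> [k kD|].
    case: k kD => [|k] kD.
      by rewrite layer0 cards1 expr0; apply/andP; split; lra.
    have /andP[l1 l2] := lay k.+1 (ltnW kD); apply/andP; split.
      by rewrite mulrC; apply: le_trans l1; apply: lo_ge.
    apply: le_trans l2 _; rewrite /hi_size mulrC; apply: ler_wpM2r.
      by rewrite exprn_ge0 // ltW.
    by have /andP[h0 h1] := half_bounds k.+1; nra.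
  have := lay D; rewrite D0 leqnn => /(_ isT) /andP[l1 l2]; apply/andP; split.
    by move: l1; rewrite /lo_size ltnn.
  apply: le_trans l2 _; rewrite /hi_size mulrC; apply: ler_wpM2r.
    by rewrite exprn_ge0 // ltW.
  by have /andP[h0 h1] := half_bounds D; nra.
- by rewrite disjoint_sym disjoints_subset subxx.
- rewrite /lo_size /hi_size D0 expr0 !mul1r expr0 subrr mulr0 subr0 addr0 lexx andbT.
  by have := x_gt0 0%N; rewrite expr0; lra.
- rewrite /explored expr0 cardsC1 -nE; have -> : #|V|.-1%:R = n - 1 :> R.
    by rewrite nE -[in RHS](ltn_predK DV) -natr1 addrK.
  by lra.
Qed.

End LayerSizes.

(** * Marked partition functions *)

Section DepthFacts.
Variables (V : finType) (r : V) (G : graph V).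
Local Notation nonroot := (nonroot r G).
Local Notation parents := (@parents V G).
Local Open Scope nat_scope.

(** From a vertex to its parent the depth drops by one and the distance by at most one, down to the
    root. *)
Lemma inhabited_depth_ge (h : depth_fun V) v : inhabited_depth r G h -> gdist G r v <= h v.
Proof.
case/andP => /andP[/eqP h0 /forallP hout] /forallP hin.
have [k] := ubnP (h v); elim: k v => // k IH v hk.
case: (boolP (v \in component r G)) => vc; last first.
  by have := hout v; rewrite vc /= => /eqP ->; apply: gdist_le_card.
case: (eqVneq v r) => [->|vr]; first by rewrite gdistxx.
have := hin v; rewrite in_setD1 vr vc /= => /set0Pn[u]; rewrite inE => /andP[uv /eqP hu].
have := gdist_adj r uv; have := IH u; rewrite -hu in hk *.
by move=> /(_ hk) h1 h2; apply: leq_trans h2 _.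
Qed.

Lemma parents_sub_nbrs (h : depth_fun V) v : parents h v \subset nbrs G [set: V] v.
Proof. by apply/subsetP => u; rewrite !inE => /andP[]. Qed.

Lemma layer_nonroot k : 0 < k < #|V| -> layer r G k \subset nonroot.
Proof.
move=> /andP[k0 kV]; apply/subsetP => v; rewrite in_setD1 !inE connect_gdist => /eqP dv.
by rewrite -(gdist_eq0 G) dv -lt0n k0 kV.
Qed.

Lemma sum_nbrs (X Y : {set V}) :
  \sum_(v in Y) #|nbrs G X v| <= \sum_(u in X) #|nbrs G [set: V] u|.
Proof.
apply: leq_trans (_ : \sum_v #|nbrs G X v| <= _).
  by rewrite [leqRHS](bigID (mem Y)) /= leq_addr.
have e (Z : {set V}) v : #|nbrs G Z v| = \sum_(u in Z) adj G u v.
  rewrite -sum1_card big_mkcond [RHS]big_mkcond; apply: eq_bigr => u _.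
  by rewrite inE; case: (u \in Z); case: (adj G u v).
under eq_bigr => v _ do rewrite e.
rewrite exchange_big; apply: leq_sum => u _; rewrite e [leqRHS]big_mkcond.
by apply: leq_sum => v _; rewrite inE adj_sym.
Qed.

End DepthFacts.

(** Pointwise, [x <= tau * expR (x / tau - 1)]. This replaces the inequality of arithmetic and
    geometric means: when [tau] is at least of the order of the average of [x], the exponential
    factor is harmless. *)
Lemma prod_le_expR (R : realType) (I : finType) (A : {set I}) (x : I -> R) (tau : R) :
  0 < tau -> (forall i, i \in A -> 0 <= x i) ->
  \prod_(i in A) x i <= tau ^+ #|A| * expR (\sum_(i in A) x i / tau - #|A|%:R).
Proof.
move=> t0 x0; rewrite -prodr_const -sum1_card natr_sum -sumrB expR_sum -big_split /=.
apply: ler_prod => i iA; rewrite x0 //=.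
have := expR_ge1Dx (x i / tau - 1).
have -> : 1 + (x i / tau - 1) = x i / tau by ring.
by rewrite ler_pdivrMr // mulrC.
Qed.

Lemma geometric_tail (R : realType) (N a : nat) (x : R) : 0 <= x <= 1 / 2 ->
  \sum_(j < N) (if (a <= j)%N then x ^+ (j - a) else 0) <= 2.
Proof.
move=> /andP[x0 x1].
suff h : \sum_(j < N) (if (a <= j)%N then x ^+ (j - a) else 0) <= 2 - 2 * (1 / 2) ^+ (N - a).
  apply: le_trans h _; rewrite gerBl mulr_ge0 // exprn_ge0 //; lra.
elim: N => [|N IH]; first by rewrite big_ord0 sub0n expr0; lra.
rewrite big_ord_recr /=; case: leqP => [aN|Na]; last first.
  by rewrite addr0; have -> : (N.+1 - a = N - a)%N by lia.
rewrite subSn // exprS.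
have : x ^+ (N - a) <= (1 / 2) ^+ (N - a).
  by apply: lerXn2r => //; rewrite nnegrE //; lra.
by lra.
Qed.

(** * Upper bounds on tilted sums with a prescribed top set *)

Section MarkedSums.
Variables (R : realType) (V : finType) (r : V) (G : graph V).
Hypothesis Gsub : G \subset all_edges V.
Local Notation nonroot := (nonroot r G).
Local Notation parents := (@parents V G).
Local Notation parent_pred := (@parent_pred V r G).
Local Notation valid_depth := (@valid_depth V r G).
Local Notation depth_fun := (depth_fun V).
Variables (D : nat) (K ell b w1 w2 : R).
Hypotheses (D0 : (0 < D)%N) (DV : (D.+1 < #|V|)%N).
Hypothesis deg : forall v, #|nbrs G [set: V] v|%:R <= K * ell.
Hypothesis Kell0 : 0 <= K * ell.
Hypothesis b2 : expR (- b) <= 1 / 2.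

Definition core : {set V} := [set v | (gdist G r v < D)%N].
Definition band : {set V} := layer r G D :|: layer r G D.+1.
(** The whole band is referred to depth [D.+1], so a vertex of layer [D] that keeps depth [D]
    appears as a gain [expR b], and depths beyond [D.+1] appear as powers of [expR (- b)]. *)
Definition ref_depth (v : V) : nat := (gdist G r v + (gdist G r v == D))%N.
Definition top (h : depth_fun) : {set V} := [set v in layer r G D | h v == D :> nat].

Lemma ref_depth_band v : v \in band -> ref_depth v = D.+1.
Proof. by rewrite /ref_depth !inE => /orP[]/eqP ->; rewrite ?eqxx; lia. Qed.

(** Tilting weights: [w1] for a band vertex that lies too deep, [w2] for one at depth [D.+1] whose
    parent is a delayed core vertex instead of a vertex of [top h]. Many vertices of either kind are
    then excluded by an exponential Markov inequality. *)
Definition mark (v : V) (j : nat) (u : V) : R :=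
  if v \in band then
    if (D.+1 < j)%N then w1 else if (j == D.+1) && (u \in core) then w2 else 0
  else 0.

Definition marks (h : depth_fun) (p : {ffun V -> V}) : R :=
  \sum_(v in nonroot) mark v (h v) (p v).

(** Bound on the contribution of one vertex, summed over its depth and parent, when the top set is
    [X]. The factors [2] are geometric series in [expR (- b)]. *)
Definition factor (X : {set V}) (v : V) : R :=
  if v \in band then
    if v \in X then expR b * #|nbrs G core v|%:R
    else #|nbrs G X v|%:R + expR w2 * #|nbrs G core v|%:R + 2 * (expR w1 * (K * ell) * expR (- b))
  else 2 * (K * ell).

Lemma tail_ge0 : 0 <= expR w1 * (K * ell) * expR (- b).
Proof. by rewrite mulr_ge0 ?expR_ge0 // mulr_ge0 ?expR_ge0. Qed.

Lemma factor_ge0 X v : 0 <= factor X v.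
Proof.
rewrite /factor; case: ifP => _; last by rewrite mulr_ge0.
case: ifP => _; first by rewrite mulr_ge0 ?expR_ge0.
apply: addr_ge0; last by apply: mulr_ge0 => //; apply: tail_ge0.
by rewrite addr_ge0 // mulr_ge0 ?expR_ge0.
Qed.

(* Bound on the contribution of [v] placed at depth [j], summed over its parents. *)
Definition level_factor (X : {set V}) (v : V) (j : nat) : R :=
  if v \in band then
    if v \in X then (if j == D then expR b * #|nbrs G core v|%:R else 0)
    else if j == D.+1 then #|nbrs G X v|%:R + expR w2 * #|nbrs G core v|%:R
    else expR w1 * (K * ell) * expR (- b) *
      (if (D.+2 <= j)%N then expR (- b) ^+ (j - D.+2) else 0)
  else K * ell * (if (ref_depth v <= j)%N then expR (- b) ^+ (j - ref_depth v) else 0).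

Lemma level_factor_ge0 X v j : 0 <= level_factor X v j.
Proof.
rewrite /level_factor; case: ifP => _; last first.
  by rewrite mulr_ge0 //; case: ifP => _ //; rewrite exprn_ge0 ?expR_ge0.
case: ifP => _; first by case: ifP => _ //; rewrite mulr_ge0 ?expR_ge0.
case: ifP => _; first by rewrite addr_ge0 // mulr_ge0 ?expR_ge0.
rewrite mulr_ge0 //; last by case: ifP => _ //; rewrite exprn_ge0 ?expR_ge0.
exact: tail_ge0.
Qed.

Lemma sum_level_factor X v : \sum_(j < #|V|.+1) level_factor X v j <= factor X v.
Proof.
have eb : 0 <= expR (- b) <= 1 / 2 by rewrite expR_ge0.
rewrite /level_factor /factor; case: ifP => _; last first.
  by rewrite -mulr_sumr mulrC; apply: ler_wpM2r => //; apply: geometric_tail.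
case: ifP => _.
  have DV' : (D < #|V|.+1)%N by lia.
  rewrite (bigD1 (Ordinal DV')) //= eqxx big1 ?addr0 // => j jD.
  by case: eqP => // e; case/eqP: jD; apply/val_inj.
have DV' : (D.+1 < #|V|.+1)%N by lia.
rewrite (bigD1 (Ordinal DV')) //= eqxx lerD2l.
set c := expR w1 * _ * _; have c0 : 0 <= c := tail_ge0.
apply: le_trans (_ : \sum_(j < #|V|.+1) c * (if (D.+2 <= j)%N then expR (- b) ^+ (j - D.+2) else 0) <= _).
  rewrite [leRHS](bigD1 (Ordinal DV')) //= ltnn mulr0 add0r.
  apply: ler_sum => j jD; case: eqP => [e|_]; last exact: lexx.
  by case/eqP: jD; apply/val_inj.
by rewrite -mulr_sumr mulrC; apply: ler_wpM2r => //; apply: geometric_tail.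
Qed.

Lemma expR_depth (j g : nat) : (g <= j)%N -> expR (- b * (j%:R - g%:R)) = expR (- b) ^+ (j - g).
Proof. by move=> gj; rewrite -natrB // mulrC expRM_natl. Qed.

Lemma card_parents_le (h : depth_fun) v : #|parents h v|%:R <= K * ell.
Proof.
by apply: le_trans (deg v); rewrite ler_nat subset_leq_card // parents_sub_nbrs.
Qed.

(** Depths are at least distances. So the parent of a vertex of depth [D] lies in [core], and the
    parent of a vertex of depth [D.+1] lies in [core] or in [top h]. For deeper vertices the maximal
    degree suffices. *)
Lemma vertex_factor_le (h : depth_fun) v : inhabited_depth r G h -> v \in nonroot ->
  expR (- b * ((h v)%:R - (ref_depth v)%:R)) * \sum_(u in parents h v) expR (mark v (h v) u) <=
  level_factor (top h) v (h v).
Proof.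
move=> ih vn; have hge u := inhabited_depth_ge u ih.
rewrite /level_factor /mark; case: ifPn => vQ; last first.
  have vD : gdist G r v != D by apply: contra vQ => e; rewrite !inE e.
  have -> : ref_depth v = gdist G r v by rewrite /ref_depth (negPf vD) addn0.
  rewrite hge expR_depth // mulrC; apply: ler_wpM2r; first by rewrite exprn_ge0 ?expR_ge0.
  by rewrite expR0 sumr_const; apply: card_parents_le.
have rD := ref_depth_band vQ.
have vD : (D <= h v)%N.
  by apply: leq_trans (hge v); move: vQ; rewrite !inE => /orP[]/eqP ->.
rewrite rD; case: ifPn => vX.
  have hv : h v = D :> nat by move: vX; rewrite inE => /andP[_ /eqP].
  rewrite hv eqxx ltnNge leqnSn /= eq_sym gtn_eqF //= expR0 sumr_const.
  have -> : - b * (D%:R - D.+1%:R) = b by rewrite -[D.+1%:R]natr1; ring.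
  apply: ler_wpM2l; first exact: expR_ge0.
  rewrite ler_nat subset_leq_card //; apply/subsetP => u; rewrite !inE => /andP[-> /eqP hu].
  by rewrite andbT; apply: leq_ltn_trans (hge u) _; rewrite hv in hu; rewrite -hu.
have vD1 : (D < h v)%N.
  rewrite ltn_neqAle vD andbT; apply: contra vX => /eqP e; rewrite inE -e eqxx andbT.
  move: vQ; rewrite in_setU => /orP[//|]; rewrite inE => /eqP dv.
  by have := hge v; rewrite dv -e ltnn.
case: eqP => [hv|/eqP hv].
  rewrite hv subrr mulr0 expR0 mul1r ltnn /=.
  apply: le_trans (_ : \sum_(u in parents h v) ((u \in nbrs G (top h) v)%:R + expR w2 * (u \in nbrs G core v)%:R) <= _).
    apply: ler_sum => u; rewrite inE hv => /andP[uv /eqP[hu]].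
    case: ifPn => uc.
      have -> : u \in nbrs G core v by rewrite inE uc uv.
      by rewrite mulr1 lerDr.
    have -> : u \in nbrs G (top h) v.
      rewrite !inE uv hu eqxx !andbT eqn_leq; move: uc; rewrite inE -leqNgt => ->.
      by rewrite andbT -hu hge.
    by rewrite expR0 lerDl mulr_ge0 ?expR_ge0.
  rewrite big_split /= -mulr_sumr -!natr_sum.
  have cnt (A : {set V}) : (\sum_(u in parents h v) (u \in A) <= #|A|)%N.
    rewrite -sum1_card big_mkcond [leqRHS]big_mkcond; apply: leq_sum => u _.
    by case: ifP => _; case: (u \in A).
  by apply: lerD; [|apply: ler_wpM2l; first exact: expR_ge0]; rewrite ler_nat cnt.
have hv2 : (D.+2 <= h v)%N by rewrite ltn_neqAle eq_sym hv.
rewrite hv2 sumr_const expR_depth; last by lia.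
have -> : (h v - D.+1 = (h v - D.+2).+1)%N by lia.
rewrite exprS -mulr_natr.
have -> : expR w1 * (K * ell) * expR (- b) * expR (- b) ^+ (h v - D.+2) =
  expR (- b) * expR (- b) ^+ (h v - D.+2) * (expR w1 * (K * ell)) by ring.
apply: ler_wpM2l; first by rewrite mulr_ge0 ?exprn_ge0 ?expR_ge0.
by apply: ler_wpM2l; [exact: expR_ge0|exact: card_parents_le].
Qed.

Lemma marked_family_sum (h : depth_fun) :
  \sum_(p in family (parent_pred h)) weight r G b ref_depth h * expR (marks h p) =
  \prod_(v in nonroot) (expR (- b * ((h v)%:R - (ref_depth v)%:R)) *
    \sum_(u in parents h v) expR (mark v (h v) u)).
Proof.
rewrite big_split /= -(sum_family_prod r G h (fun v u => expR (mark v (h v) u))).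
rewrite -mulr_sumr; congr (_ * _); apply: eq_bigr => p _.
by rewrite /marks expR_sum.
Qed.

(** With the top set fixed, each level factor depends only on the depth of its own vertex, so the
    sum over depth functions factorises. The constraint [top h == X] is dropped once it has entered
    the factors. *)
Lemma marked_sum (X : {set V}) :
  \sum_(h | valid_depth h && (top h == X)) \sum_(p in family (parent_pred h))
    weight r G b ref_depth h * expR (marks h p) <= \prod_(v in nonroot) factor X v.
Proof.
apply: le_trans (_ : \sum_(h | valid_depth h) \prod_(v in nonroot) level_factor X v (h v) <= _).
  rewrite [leLHS]big_mkcondr; apply: ler_sum => h hv; case: eqP => [<-|_]; last first.
    by apply: prodr_ge0 => v _; apply: level_factor_ge0.
  rewrite marked_family_sum; case: (boolP (inhabited_depth r G h)) => ih.
    apply: ler_prod => v vn; rewrite vertex_factor_le // andbT mulr_ge0 ?expR_ge0 //.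
    by apply: sumr_ge0 => u _; apply: expR_ge0.
  move: ih; rewrite /inhabited_depth hv /= => /forallPn[v].
  rewrite negb_imply negbK => /andP[vn /eqP e].
  rewrite (bigD1 v) //= e big_set0 mulr0 mul0r.
  by apply: prodr_ge0 => v' _; apply: level_factor_ge0.
rewrite sum_depth_prod; apply: ler_prod => v vn; rewrite sum_level_factor andbT.
by apply: sumr_ge0 => j _; apply: level_factor_ge0.
Qed.

Lemma band_nonroot : band \subset nonroot.
Proof. by rewrite subUset !layer_nonroot ?D0 ?(ltnW DV) ?DV. Qed.

(** Degrees are controlled through their sums. The vertices off the band, those of [X] and the rest
    of the band each cost a factor [expR #|V|]; the comparison value is [expR a] on [X], and on the
    rest of the band it is a bound on the mean degree into [X] plus the error [sigma]. A fourth
    factor pays for raising this value to the power [#|V|] instead of [#|band :\: X|], which also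
    produces [- L] per vertex of [X]. *)
Lemma prod_factor_le (X : {set V}) (L a sigma : R) :
  X \subset layer r G D -> ell = expR L -> 1 <= K ->
  (2 * (K * ell)) ^+ #|nonroot :\: band| <= expR #|V|%:R ->
  K * ell * #|core|%:R <= #|V|%:R * expR a ->
  expR w2 * (#|core|%:R / #|V|%:R) + 2 * (expR w1 * expR (- b)) <= sigma ->
  1 <= K * ell * sigma ->
  \prod_(v in nonroot) factor X v <=
  expR (4 * #|V|%:R) * expR (#|X|%:R * (b + a - L)) *
  (K * ell * (#|X|%:R / #|V|%:R + sigma)) ^+ #|V|.
Proof.
move=> XD ellE K1 hR hC hs hs1; set n := #|V|%:R.
have nN : (0 < #|V|)%N by apply: leq_ltn_trans DV.
have n0 : 0 < n by rewrite ltr0n.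
have ell0 : 0 < ell by rewrite ellE expR_gt0.
have Xband : X \subset band by apply: subset_trans XD _; apply: subsetUl.
have degsum (A Y : {set V}) : \sum_(v in Y) #|nbrs G A v|%:R <= K * ell * #|A|%:R :> R.
  rewrite -natr_sum; apply: le_trans (_ : (\sum_(u in A) #|nbrs G [set: V] u|)%N%:R <= _).
    by rewrite ler_nat sum_nbrs.
  rewrite natr_sum mulrC mulr_natl -sumr_const; apply: ler_sum => u _; exact: deg.
rewrite (big_setID band) /= (setIidPr band_nonroot) (big_setID X) /= (setIidPr Xband).
set P2 := \prod_(v in X) _; set P3 := \prod_(v in band :\: X) _.
set P1 := \prod_(v in nonroot :\: band) _.
have h1 : P1 <= expR n.
  apply: le_trans hR; rewrite -prodr_const; apply: ler_prod => v; rewrite inE => /andP[vb _].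
  by rewrite factor_ge0 /= /factor (negPf vb).
have h2 : P2 <= expR (#|X|%:R * (b + a)) * expR n.
  have -> : P2 = expR b ^+ #|X| * \prod_(v in X) #|nbrs G core v|%:R.
    rewrite -prodr_const -big_split; apply: eq_bigr => v vX.
    by rewrite /factor (subsetP Xband) // vX.
  rewrite mulrDr expRD -mulrA [expR (_ * b)]expRM_natl; apply: ler_wpM2l.
    by rewrite exprn_ge0 ?expR_ge0.
  apply: le_trans (prod_le_expR (expR_gt0 a) _) _ => //.
  rewrite expRM_natl; apply: ler_wpM2l; first by rewrite exprn_ge0 ?expR_ge0.
  rewrite ler_expR -mulr_suml; apply: le_trans (_ : n * expR a / expR a <= _).
    apply: le_trans (_ : \sum_(v in X) #|nbrs G core v|%:R / expR a <= _).
      by rewrite -mulr_suml gerBl.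
    rewrite -mulr_suml ler_pM2r ?invr_gt0 ?expR_gt0 //.
    exact: le_trans (degsum _ _) hC.
  by rewrite mulfK // gt_eqF ?expR_gt0.
set x := #|X|%:R / n; pose tau := K * ell * (x + sigma).
have x0 : 0 <= x by rewrite divr_ge0 // ltW.
have tau1 : 1 <= tau.
  apply: le_trans hs1 _; rewrite /tau mulrDr lerDr mulr_ge0 //.
have tau0 : 0 < tau by apply: lt_le_trans tau1; apply: ltr01.
have h3 : P3 <= tau ^+ #|band :\: X| * expR n.
  apply: le_trans (prod_le_expR tau0 (fun v _ => factor_ge0 X v)) _.
  apply: ler_wpM2l; first by rewrite exprn_ge0 // ltW.
  rewrite ler_expR -mulr_suml.
  suff : \sum_(v in band :\: X) factor X v <= n * tau.
    rewrite -ler_pdivrMr // => h; apply: le_trans h; by rewrite gerBl.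
  have -> : n * tau = K * ell * (#|X|%:R + n * sigma).
    by rewrite /tau /x; field; rewrite gt_eqF.
  apply: le_trans (_ : K * ell * #|X|%:R + expR w2 * (K * ell * #|core|%:R) +
     n * (2 * (expR w1 * (K * ell) * expR (- b))) <= _).
    apply: le_trans (_ : \sum_(v in band :\: X) (#|nbrs G X v|%:R +
       expR w2 * #|nbrs G core v|%:R + 2 * (expR w1 * (K * ell) * expR (- b))) <= _).
      by apply: ler_sum => v; rewrite inE /factor => /andP[/negPf -> ->].
    rewrite !big_split /= -mulr_sumr; apply: lerD; first apply: lerD.
    - exact: degsum.
    - by apply: ler_wpM2l; [exact: expR_ge0|exact: degsum].
    rewrite sumr_const -[leLHS]mulr_natl; apply: ler_wpM2r.
      by apply: mulr_ge0 => //; apply: tail_ge0.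
    by rewrite ler_nat max_card.
  have hs' : expR w2 * #|core|%:R + n * (2 * (expR w1 * expR (- b))) <= n * sigma.
    have := ler_wpM2l (ltW n0) hs; rewrite mulrDr.
    have -> : n * (expR w2 * (#|core|%:R / #|V|%:R)) = expR w2 * #|core|%:R.
      by rewrite -/n; field; rewrite gt_eqF.
    by [].
  rewrite mulrDr -addrA lerD2l; apply: le_trans (ler_wpM2l Kell0 hs').
  by rewrite le_eqVlt; apply/orP; left; apply/eqP; ring.
have h4 : tau ^+ #|band :\: X| <= tau ^+ #|V| * (expR n * expR (- (#|X|%:R * L))).
  have hX : expR (#|X|%:R * L - n) <= tau ^+ #|X|.
    case: (posnP #|X|) => [->|Xp].
      by rewrite mul0r sub0r expr0 -(expR0 R) ler_expR oppr_le0 ltW.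
    have Xr : 0 < #|X|%:R :> R by rewrite ltr0n.
    have xp : 0 < x by rewrite divr_gt0.
    (* From [ln t < t]: the loss [#|X| * ln (n / #|X|)] is at most [n]. *)
    have lx : - (n / #|X|%:R) <= ln x.
      have := ln_sublinear (_ : 0 < x^-1); rewrite invr_gt0 => /(_ xp).
      by rewrite lnV ?posrE // => /ltW; rewrite /x invf_div lerNl.
    apply: le_trans (_ : (ell * x) ^+ #|X| <= _).
      have -> : ell * x = expR (L + ln x) by rewrite expRD lnK ?posrE // ellE.
      rewrite -expRM_natl ler_expR mulrDr lerD2l.
      have := ler_wpM2l (ltW Xr) lx.
      by have -> : #|X|%:R * - (n / #|X|%:R) = - n by field; rewrite gt_eqF.
    apply: lerXn2r; rewrite ?nnegrE; [by apply: mulr_ge0; [exact: ltW|]|exact: ltW|].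
    rewrite /tau mulrDr; apply: le_trans (_ : K * ell * x <= _).
      by rewrite -mulrA; apply: ler_peMl => //; rewrite mulr_ge0 // ltW.
    rewrite lerDl; apply: le_trans hs1; exact: ler01.
  have hc : (#|band :\: X| + #|X| <= #|V|)%N.
    by rewrite -{2}(setIidPr Xband) addnC cardsID max_card.
  have := ler_weXn2l tau1 hc; rewrite exprD => hp.
  have t0 : 0 <= tau ^+ #|band :\: X| by rewrite exprn_ge0 // ltW.
  have hq : tau ^+ #|band :\: X| * expR (#|X|%:R * L - n) <= tau ^+ #|V|.
    by apply: le_trans hp; apply: ler_wpM2l.
  have -> : expR n * expR (- (#|X|%:R * L)) = (expR (#|X|%:R * L - n))^-1.
    by rewrite -expRD -expRN; congr expR; ring.
  by rewrite ler_pdivlMr ?expR_gt0.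
have P10 : 0 <= P1 by apply: prodr_ge0 => v _; apply: factor_ge0.
have P20 : 0 <= P2 by apply: prodr_ge0 => v _; apply: factor_ge0.
have P30 : 0 <= P3 by apply: prodr_ge0 => v _; apply: factor_ge0.
have h5 : P3 <= tau ^+ #|V| * (expR n * expR (- (#|X|%:R * L))) * expR n.
  by apply: le_trans h3 _; apply: ler_wpM2r h4; apply: expR_ge0.
apply: le_trans (_ : expR (#|X|%:R * (b + a)) * expR n *
   (tau ^+ #|V| * (expR n * expR (- (#|X|%:R * L))) * expR n) * expR n <= _).
  by apply: ler_pM => //; [exact: mulr_ge0|apply: ler_pM].
rewrite le_eqVlt; apply/orP; left; apply/eqP.
transitivity (expR (#|X|%:R * (b + a) + n + n - #|X|%:R * L + n + n) * tau ^+ #|V|).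
  by rewrite !expRD; ring.
by rewrite -expRD; congr (expR _ * _); ring.
Qed.

(* The event constrains [top h] only; the marks are handled by Markov's inequality. *)
Lemma gibbs_top_prob_le (A : depth_fun -> {ffun V -> V} -> bool) (E : pred {set V})
    (m M Z : R) :
  (forall h p, A h p -> E (top h) /\ m <= marks h p) ->
  (forall X : {set V}, X \subset layer r G D -> E X -> \prod_(v in nonroot) factor X v <= M) ->
  0 < Z -> 0 <= M -> Z <= partition r G b ref_depth ->
  \sum_(T | `[< spanning_tree r G T >] && A (depth r T) (parent_fun r T)) gibbs r b G T <=
  2 ^+ #|V| * M * expR (- m) / Z.
Proof.
move=> hA hM Z0 M0 hZ.
apply: (@gibbs_prob_le _ _ _ _ Gsub b ref_depth A
  (fun h p => (E (top h))%:R * expR (marks h p - m))) => [h p|h p _ _ Ahp|].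
- by rewrite mulr_ge0 ?expR_ge0.
- have [-> hm] := hA _ _ Ahp; rewrite mul1r; apply: expR_ge1_ge0.
  by rewrite subr_ge0.
apply: le_trans (_ : 2 ^+ #|V| * M * expR (- m) <= _); last first.
  rewrite [leRHS]mulrAC ler_pdivlMr //; apply: ler_wpM2l hZ.
  by rewrite !mulr_ge0 ?exprn_ge0 ?expR_ge0.
rewrite (partition_big top (fun X => X \subset layer r G D)) /=; last first.
  by move=> h _; apply/subsetP => v; rewrite inE => /andP[].
have term (X : {set V}) : X \subset layer r G D ->
   \sum_(h | valid_depth h && (top h == X)) \sum_(p in family (parent_pred h))
     weight r G b ref_depth h * ((E (top h))%:R * expR (marks h p - m)) <= M * expR (- m).
  move=> XD; case: (boolP (E X)) => EX; last first.
    rewrite big1 ?mulr_ge0 ?expR_ge0 // => h /andP[_ /eqP e]; rewrite big1 // => p _.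
    by rewrite e (negPf EX) mul0r mulr0.
  apply: le_trans (_ : (\prod_(v in nonroot) factor X v) * expR (- m) <= _); last first.
    by apply: ler_wpM2r; [exact: expR_ge0|exact: hM].
  apply: le_trans (ler_wpM2r (expR_ge0 _) (marked_sum X)).
  rewrite mulr_suml; apply: ler_sum => h /andP[_ /eqP e]; rewrite mulr_suml.
  by apply: ler_sum => p _; rewrite e EX mul1r expRD mulrA.
apply: le_trans (ler_sum _ term) _.
rewrite sumr_const -[leLHS]mulr_natl -[leRHS]mulrA; apply: ler_wpM2r; first by rewrite mulr_ge0 ?expR_ge0.
rewrite -natrX ler_nat; apply: leq_trans (max_card _) _.
by rewrite -cardsT -powersetT card_powerset cardsT.
Qed.

(** * Lower bound on the partition function from a single depth function *)

Section Reference.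
Variables (X0 : {set V}) (c0 t0 : R) (e : nat).
Hypotheses (X0D : X0 \subset layer r G D) (c01 : 1 <= c0) (t00 : 0 <= t0) (b0 : 0 <= b).
Hypothesis core_le : (#|core| <= e)%N.
Hypothesis deep_le : (#|~: (core :|: band)| <= e)%N.

Let irregular : {set V} := [set v in ~: X0 | #|nbrs G X0 v|%:R < c0].
Let isolated : {set V} := [set v in ~: X0 | nbrs G X0 v == set0].

Hypothesis irregular_le : (#|irregular| <= e)%N.
Hypothesis X0_core : forall v, v \in X0 -> t0 <= #|nbrs G core v|%:R.

(** [X0] alone may leave vertices without a parent. The set [extra] repairs this: a vertex of layer
    [D] without neighbours in [X0] keeps depth [D], and for such a vertex of layer [D.+1] one
    neighbour in layer [D] keeps depth [D]. The default value of [up] does not occur on layer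
    [D.+1]. *)
Let up (v : V) : V := odflt v [pick u in layer r G D | adj G u v].
Let extra : {set V} :=
  (isolated :&: layer r G D) :|: (up @: (isolated :&: layer r G D.+1)).
Let X1 : {set V} := X0 :|: extra.
Let h1 : depth_fun :=
  [ffun v => inord (if v \in layer r G D :\: X1 then D.+1 else gdist G r v)].

Let h1E v : h1 v = (if v \in layer r G D :\: X1 then D.+1 else gdist G r v) :> nat.
Proof.
rewrite ffunE inordK //; case: ifP => _; last by rewrite ltnS gdist_le_card.
by apply: leq_trans DV _.
Qed.

Let isolated_irregular : isolated \subset irregular.
Proof.
apply/subsetP => v; rewrite !inE => /andP[-> /eqP ->].
by rewrite cards0 (lt_le_trans ltr01).
Qed.

Let up_spec v : v \in layer r G D.+1 -> up v \in layer r G D /\ adj G (up v) v.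
Proof.
rewrite inE => /eqP dv; rewrite /up; case: pickP => [u /andP[]//|/= none].
have [u uv du] := gdist_pred dv DV.
by have := none u; rewrite inE du eqxx uv.
Qed.

Let X1D : X1 \subset layer r G D.
Proof.
rewrite !subUset X0D subsetIr /=; apply/subsetP => _ /imsetP[v + ->].
by rewrite inE => /andP[_ /up_spec[]].
Qed.

Let h1_X1 v : v \in X1 -> h1 v = D :> nat.
Proof.
move=> vX; rewrite h1E inE vX /=; have := subsetP X1D v vX.
by rewrite inE => /eqP.
Qed.

Let h1_off v : v \notin layer r G D -> h1 v = gdist G r v :> nat.
Proof. by move=> vD; rewrite h1E inE (negPf vD) andbF. Qed.

Let up_nbr v : v \in layer r G D.+1 -> exists2 u, u \in X1 & adj G u v.
Proof.
move=> vD; case: (boolP (v \in isolated)) => vi.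
  have [_ uv] := up_spec vD; exists (up v) => //.
  by rewrite !inE; apply/orP; right; apply/orP; right; apply/imsetP; exists v => //; rewrite inE vi.
have vX0 : v \notin X0.
  by apply: contraTN vD => /(subsetP X0D); rewrite !inE => /eqP ->; rewrite neq_ltn ltnSn.
move: vi; rewrite !inE vX0 /= => /set0Pn[u]; rewrite inE => /andP[uX uv].
by exists u => //; rewrite !inE uX.
Qed.

Let h1_inhabited : inhabited_depth r G h1.
Proof.
apply/andP; split.
  apply/andP; split.
    by rewrite h1_off ?gdistxx // inE gdistxx eq_sym -lt0n.
  apply/forallP => v; apply/implyP; rewrite inE connect_gdist -leqNgt => ge.
  have e1 : gdist G r v = #|V| by apply/eqP; rewrite eqn_leq gdist_le_card.
  rewrite h1_off ?e1 // inE e1 neq_ltn (ltnW DV) orbT //.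
apply/forallP => v; apply/implyP => /setD1P[vr]; rewrite inE connect_gdist => lt.
apply/set0Pn; case: (boolP (v \in layer r G D :\: X1)) => vDX.
  have hv : h1 v = D.+1 :> nat by rewrite h1E vDX.
  have vi : v \notin isolated.
    move: vDX; rewrite inE => /andP[vX vD]; apply: contra vX => vi.
    by rewrite in_setU; apply/orP; right; rewrite in_setU inE vi vD.
  have vX0 : v \notin X0.
    by move: vDX; rewrite !inE negb_or => /andP[/andP[]].
  move: vi; rewrite !inE vX0 /= => /set0Pn[u]; rewrite inE => /andP[uX uv].
  have uX1 : u \in X1 by rewrite in_setU uX.
  by exists u; rewrite inE uv hv (h1_X1 uX1) eqxx.
have hv : h1 v = gdist G r v :> nat by rewrite h1E (negPf vDX).
case: (boolP (v \in layer r G D.+1)) => vD1.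
  have [u uX uv] := up_nbr vD1; exists u; rewrite inE uv hv h1_X1 //.
  by move: vD1; rewrite inE => /eqP ->; rewrite eqxx.
case ev : (gdist G r v) lt => [|k] lt; first by move/eqP: ev; rewrite gdist_eq0 (negPf vr).
have [u uv du] := gdist_pred ev lt.
exists u; rewrite inE uv hv ev h1_off ?du ?eqxx //.
by rewrite inE du; apply: contra vD1 => /eqP kD; rewrite inE ev kD.
Qed.

Let regular : {set V} := band :\: X1 :\: irregular.

(** [h1] never exceeds [ref_depth], so a vertex about which nothing is known still contributes at
    least [1]. *)
Let reference_factor v : v \in nonroot ->
  (if v \in X0 then expR b * t0 else if v \in regular then c0 else 1) <=
  expR (- b * ((h1 v)%:R - (ref_depth v)%:R)) * #|parents h1 v|%:R.
Proof.
move=> vn.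
have p1 : 1 <= #|parents h1 v|%:R :> R.
  rewrite ler1n card_gt0; have /andP[_ /forallP/(_ v)] := h1_inhabited.
  by rewrite vn.
case: ifPn => [vX0|vX0].
  have vX1 : v \in X1 by rewrite inE vX0.
  have dv : gdist G r v = D by have := subsetP X0D v vX0; rewrite inE => /eqP.
  rewrite h1_X1 // /ref_depth dv eqxx addn1.
  have -> : - b * (D%:R - D.+1%:R) = b by rewrite -[D.+1%:R]natr1; ring.
  apply: ler_wpM2l; first exact: expR_ge0.
  apply: le_trans (X0_core vX0) _; rewrite ler_nat subset_leq_card //.
  apply/subsetP => u; rewrite !inE => /andP[uD uv].
  have hu : h1 u = gdist G r u :> nat by rewrite h1_off // inE ltn_eqF.
  rewrite uv (h1_X1 vX1) hu /= eqn_leq uD /=.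
  by have := gdist_adj r uv; rewrite dv.
case: ifPn => [vreg|_].
  have /setDP[/setDP[vb vX1] vi] := vreg.
  have hv : h1 v = D.+1 :> nat.
    rewrite h1E; case: ifPn => //; rewrite in_setD vX1 /= => vD.
    by move: vb; rewrite in_setU (negPf vD) /= inE => /eqP.
  rewrite hv ref_depth_band // subrr mulr0 expR0 mul1r.
  move: vi; rewrite inE in_setC vX0 /= -leNgt => vi; apply: le_trans vi _.
  rewrite ler_nat subset_leq_card //; apply/subsetP => u; rewrite !inE => /andP[uX uv].
  have uX1 : u \in X1 by rewrite in_setU uX.
  by rewrite uv hv (h1_X1 uX1) eqxx.
apply: le_trans p1 _; apply: ler_peMl => //; apply: expR_ge1_ge0.
rewrite mulNr -mulrN mulr_ge0 // oppr_ge0 subr_le0 ler_nat h1E /ref_depth.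
case: ifP => [|_]; last by rewrite leq_addr.
by rewrite !inE => /andP[_ /eqP ->]; rewrite eqxx addn1.
Qed.

(** [5 * e] counts the vertices without a controlled factor: [2 * e] for [extra], and [e] each for
    [irregular], [core] and the vertices beyond the band. *)
Lemma partition_ge_reference :
  (expR b * t0) ^+ #|X0| * c0 ^+ (#|V| - #|X0| - 5 * e) <= partition r G b ref_depth.
Proof.
apply: le_trans (partition_ge_depth b ref_depth h1_inhabited).
rewrite /weight -big_split /=.
apply: le_trans (_ : \prod_(v in nonroot)
  (if v \in X0 then expR b * t0 else if v \in regular then c0 else 1) <= _); last first.
  apply: ler_prod => v vn; rewrite reference_factor // andbT.
  case: ifP => _; first by rewrite mulr_ge0 ?expR_ge0.
  by case: ifP => _ //; apply: le_trans c01; apply: ler01.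
have X0n : X0 \subset nonroot.
  by apply: subset_trans band_nonroot; apply: subset_trans X0D _; apply: subsetUl.
have X0X1 : X0 \subset X1 by apply: subsetUl.
have regn : regular \subset nonroot :\: X0.
  apply/subsetP => v /setDP[/setDP[vb vX1] _].
  rewrite in_setD; apply/andP; split; last exact: (subsetP band_nonroot).
  by apply: contra vX1; apply: (subsetP X0X1).
rewrite (big_setID X0) /= (setIidPr X0n).
rewrite (eq_bigr (fun=> expR b * t0)) => [|v ->//]; rewrite prodr_const.
apply: ler_wpM2l; first by rewrite exprn_ge0 // mulr_ge0 ?expR_ge0.
rewrite (big_setID regular) /= (setIidPr regn).
rewrite (eq_bigr (fun=> c0)) => [|v vr]; last first.
  have := subsetP regn v vr; rewrite inE => /andP[/negPf -> _]; by rewrite vr.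
rewrite prodr_const big1 ?mulr1 => [|v]; last first.
  by case/setDP => /setDP[_ /negPf ->] /negPf ->.
apply: ler_weXn2l => //.
have card_extra : (#|extra| <= 2 * e)%N.
  have iso : (#|isolated| <= e)%N := leq_trans (subset_leq_card isolated_irregular) irregular_le.
  apply: leq_trans (leq_card_setU _ _).1 _; rewrite mul2n -addnn; apply: leq_add.
    by apply: leq_trans iso; apply/subset_leq_card/subsetIl.
  apply: leq_trans (leq_imset_card _ _) _.
  by apply: leq_trans iso; apply/subset_leq_card/subsetIl.
have cover : [set: V] \subset
    regular :|: (X0 :|: (extra :|: (irregular :|: (core :|: ~: (core :|: band))))).
  apply/subsetP => v _.
  apply/setUP; case: (boolP (v \in regular)) => vr; [by left|right].
  apply/setUP; case: (boolP (v \in X0)) => vX; [by left|right].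
  apply/setUP; case: (boolP (v \in extra)) => ve; [by left|right].
  apply/setUP; case: (boolP (v \in irregular)) => vi; [by left|right].
  apply/setUP; case: (boolP (v \in core)) => vc; [by left|right].
  rewrite in_setC in_setU negb_or vc; apply: contra vr => vb.
  by apply/setDP; split=> //; apply/setDP; split=> //; rewrite in_setU negb_or vX.
have := subset_leq_card cover; rewrite cardsT => hc.
have u5 := (leq_card_setU core (~: (core :|: band))).1.
have u4 := (leq_card_setU irregular (core :|: ~: (core :|: band))).1.
have u3 := (leq_card_setU extra (irregular :|: (core :|: ~: (core :|: band)))).1.
have u2 := (leq_card_setU X0 (extra :|: (irregular :|: (core :|: ~: (core :|: band))))).1.
have u1 := (leq_card_setU regular (X0 :|: (extra :|: (irregular :|: (core :|: ~: (core :|: band)))))).1.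
have i1 := irregular_le; have i2 := core_le; have i3 := deep_le.
move: hc u1 u2 u3 u4 u5 card_extra i1 i2 i3.
move: #|regular| #|X0| #|extra| #|irregular| #|core| #|~: (core :|: band)| => x1 x2 x3 x4 x5 x6.
move: #|_ :|: _| #|_ :|: _| #|_ :|: _| #|_ :|: _| #|_ :|: _| #|V| => y1 y2 y3 y4 y5 y6.
clear; lia.
Qed.

End Reference.

End MarkedSums.

(** Exponential Markov inequality for the size of a subset, with weight [expR (- 100)] per element;
    this weight is at most [1 / 100]. *)
Lemma card_small_sets (R : realType) (V : finType) (A : {set V}) (s : R) :
  #|[set S in powerset A | #|S|%:R <= s]|%:R <= expR (100 * s + #|V|%:R / 100).
Proof.
pose z : R := expR (- 100).
have z1 : z <= 1 / 100.
  rewrite /z expRN; have := expR_ge1Dx (100 : R) => h.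
  have h' : (0 : R) < 100 by [].
  rewrite div1r lef_pV2 ?posrE ?expR_gt0 //; apply: le_trans h; lra.
rewrite expRD -sum1_card natr_sum.
apply: le_trans (_ : \sum_(S in powerset A) expR (100 * s) * \prod_(v in A) (if v \in S then z else 1) <= _).
  rewrite (eq_bigl (fun S : {set V} => (S \in powerset A) && (#|S|%:R <= s))) => [|S]; last by rewrite inE.
  rewrite big_mkcondr; apply: ler_sum => S; rewrite powersetE => SA.
  rewrite -big_mkcondr /= (eq_bigl (mem S)) => [|v]; last first.
    by rewrite /= andbC; case: (boolP (v \in S)) => //= /(subsetP SA).
  rewrite prodr_const; case: ifP => Ss; last by rewrite mulr_ge0 ?exprn_ge0 ?expR_ge0.
  rewrite /z -expRM_natl -expRD; apply: expR_ge1_ge0; lra.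
rewrite -mulr_sumr; apply: ler_wpM2l; first exact: expR_ge0.
rewrite -prod_add_powerset prodr_const.
apply: le_trans (_ : expR z ^+ #|A| <= _).
  by apply: lerXn2r; rewrite ?nnegrE ?addr_ge0 ?expR_ge0 // addrC expR_ge1Dx.
rewrite -expRM_natl ler_expR.
apply: le_trans (_ : #|V|%:R * z <= _); first by apply: ler_wpM2r; rewrite ?expR_ge0 ?ler_nat ?max_card.
rewrite ler_wpM2l //; lra.
Qed.

(** * Parents captured by small sets *)

Section Spread.
Variables (R : realType) (V : finType) (r : V) (G : graph V).
Hypothesis Gsub : G \subset all_edges V.
Local Notation nonroot := (nonroot r G).
Local Notation parents := (@parents V G).
Local Notation parent_pred := (@parent_pred V r G).
Local Notation valid_depth := (@valid_depth V r G).
Local Notation depth_fun := (depth_fun V).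
Variable D : nat.
Hypotheses (D0 : (0 < D)%N) (DV : (D.+1 < #|V|)%N).
Local Notation band := (band r G D).
Local Notation core := (core r G D).
Local Notation top := (top r G D).

Definition deeper (h : depth_fun) : {set V} := [set v in band | (D.+1 < h v)%N].
Definition hits (S : {set V}) (p : {ffun V -> V}) : {set V} :=
  [set v in nonroot | p v \in S].
Definition misplaced (h : depth_fun) (p : {ffun V -> V}) : {set V} :=
  [set v in band | (D.+1 < h v)%N || ((h v == D.+1 :> nat) && (p v \in core))].

Lemma marks_ge_misplaced (w1 w2 : R) h p : 0 <= w2 <= w1 ->
  #|misplaced h p|%:R * w2 <= marks r G D w1 w2 h p.
Proof.
move=> /andP[w20 w21]; rewrite -sum1_card natr_sum mulr_suml.
have sub : misplaced h p \subset nonroot.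
  apply: subset_trans (@band_nonroot V r G D D0 DV).
  by apply/subsetP => v; rewrite inE => /andP[].
rewrite /marks [leRHS](big_setID (misplaced h p)) /= (setIidPr sub) -[leLHS]addr0.
apply: lerD.
  apply: ler_sum => v; rewrite inE => /andP[vb hv]; rewrite mul1r /mark vb.
  by case: ifP => // hD; move: hv; rewrite hD /= => ->.
apply: sumr_ge0 => v _; rewrite /mark; case: ifP => _ //.
by case: ifP => _; [apply: le_trans w21|case: ifP].
Qed.

Lemma marks_ge_deeper (w1 w2 : R) h p : 0 <= w2 -> 0 <= w1 ->
  #|deeper h|%:R * w1 <= marks r G D w1 w2 h p.
Proof.
move=> w20 w10; rewrite -sum1_card natr_sum mulr_suml.
have sub : deeper h \subset nonroot.
  apply: subset_trans (@band_nonroot V r G D D0 DV).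
  by apply/subsetP => v; rewrite inE => /andP[].
rewrite /marks [leRHS](big_setID (deeper h)) /= (setIidPr sub) -[leLHS]addr0.
apply: lerD.
  by apply: ler_sum => v; rewrite inE => /andP[vb hv]; rewrite mul1r /mark vb hv.
apply: sumr_ge0 => v _; rewrite /mark; case: ifP => _ //.
by case: ifP => _ //; case: ifP.
Qed.

Lemma expR_half_le2 : expR (1 / 2 : R) <= 2.
Proof.
have -> : (1 / 2 : R) = - (- (1 / 2)) by ring.
rewrite expRN -[leRHS]invrK lef_pV2 ?posrE ?expR_gt0 //.
by have := expR_ge1Dx (- (1 / 2) : R); lra.
Qed.

Section Hits.
Variables (K ell b s m c1 wmax : R) (e : nat).
Hypothesis deg : forall v, #|nbrs G [set: V] v|%:R <= K * ell.
Hypotheses (c10 : 0 < c1) (m0 : 0 < m).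
Hypothesis regular : forall X : {set V}, X \subset layer r G D -> m <= #|X|%:R ->
  (#|[set v in ~: X | (#|nbrs G X v|%:R < c1 * #|X|%:R)%R]| <= e)%N.
Hypothesis out_le : (#|nonroot :\: band| <= e)%N.

Let n : R := #|V|%:R.
Let E := K * ell * s / (c1 * m) + e%:R + wmax / 2.

Let spread (h : depth_fun) := (m <= #|top h|%:R) && (#|deeper h|%:R <= wmax).

(** A vertex of depth [D.+1] with at least [c1 * #|X|] possible parents has at most the fraction
    [#|nbrs G S v| / (c1 * #|X|)] of them in [S]; as [expR (1 / 2) <= 2], the tilt costs at most the
    exponential of this fraction. Double counting bounds the sum of the fractions by the first term
    of [E]. A vertex of depth [D] has no parent in layer [D], and every other vertex is charged
    [1 / 2]. *)
Let hits_factor (h : depth_fun) (S : {set V}) : valid_depth h -> spread h ->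
  S \subset layer r G D -> #|S|%:R <= s ->
  \prod_(v in nonroot) \sum_(u in parents h v) expR ((u \in S)%:R / 2) <=
  expR E * \prod_(v in nonroot) #|parents h v|%:R.
Proof.
move=> hv /andP[hm hw] SD Ss.
case: (boolP (inhabited_depth r G h)) => ih; last first.
  move: ih; rewrite /inhabited_depth hv /= => /forallPn[v].
  rewrite negb_imply negbK => /andP[vn /eqP e0].
  by rewrite [leLHS](bigD1 v) //= e0 big_set0 mul0r mulr_ge0 ?expR_ge0 // prodr_ge0.
have hge u := inhabited_depth_ge u ih.
set X := top h in hm.
have XD : X \subset layer r G D by apply/subsetP => v; rewrite inE => /andP[].
pose irr := [set v in ~: X | #|nbrs G X v|%:R < c1 * #|X|%:R].
pose bad := (nonroot :\: band) :|: (deeper h :|: irr).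
have X0 : 0 < #|X|%:R :> R by apply: lt_le_trans hm.
pose t v : R := (if v \in bad then 1 / 2 else 0) + #|nbrs G S v|%:R / (c1 * #|X|%:R).
have q0 v : 0 <= #|nbrs G S v|%:R / (c1 * #|X|%:R) by rewrite divr_ge0 // mulr_ge0 // ltW.
have key v : v \in nonroot ->
    \sum_(u in parents h v) expR ((u \in S)%:R / 2) <= expR (t v) * #|parents h v|%:R.
  move=> vn; case: (boolP (v \in bad)) => vbad.
    apply: le_trans (_ : \sum_(u in parents h v) expR (t v) <= _); last first.
      by rewrite sumr_const mulr_natr.
    apply: ler_sum => u _; rewrite ler_expR /t vbad.
    by have := q0 v; case: (u \in S) => /=; lra.
  move: vbad; rewrite !in_setU !negb_or in_setD vn andbT negbK => /and3P[vb vd vi].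
  have {}vd : (h v <= D.+1)%N by move: vd; rewrite inE vb /= -leqNgt.
  have vD : (D <= h v)%N.
    by apply: leq_trans (hge v); move: vb; rewrite !inE => /orP[]/eqP ->.
  have tq : 0 <= t v by rewrite /t addr_ge0 //; case: ifP => _ //; lra.
  have [hvD|hvD] : h v = D :> nat \/ h v = D.+1 :> nat by move: vd vD; clear; lia.
    rewrite (eq_bigr (fun=> 1)) => [|u]; last first.
      rewrite inE hvD => /andP[_ /eqP hu].
      suff -> : (u \in S) = false by rewrite mul0r expR0.
      apply/negP => /(subsetP SD); rewrite inE => /eqP du.
      by have := hge u; rewrite du -hu ltnn.
    by rewrite sumr_const ler_peMl // expR_ge1_ge0.
  have vX : v \in ~: X by rewrite in_setC inE hvD negb_and neq_ltn ltnSn orbT orbT.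
  move: vi; rewrite inE vX /= -leNgt => vi.
  have pN : c1 * #|X|%:R <= #|parents h v|%:R.
    apply: le_trans vi _; rewrite ler_nat subset_leq_card //; apply/subsetP => u.
    by rewrite !inE hvD => /andP[/andP[_ /eqP ->] ->]; rewrite eqxx.
  apply: le_trans (_ : #|parents h v|%:R + #|nbrs G S v|%:R <= _).
    apply: le_trans (_ : \sum_(u in parents h v) (1 + (u \in S)%:R) <= _).
      apply: ler_sum => u _; case: (u \in S) => /=; last by rewrite mul0r expR0 addr0.
      by have := expR_half_le2; rewrite div1r; lra.
    rewrite big_split /= sumr_const lerD2l -natr_sum ler_nat -big_mkcondr sum1_card.
    apply: subset_leq_card; apply/subsetP => u; rewrite unfold_in => /andP[up uS].
    by move: up; rewrite !inE uS => /andP[-> _].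
  apply: le_trans (_ : (1 + t v) * #|parents h v|%:R <= _); last first.
    by apply: ler_wpM2r => //; apply: expR_ge1Dx.
  rewrite mulrDl mul1r lerD2l /t mulrDl; apply: le_trans (_ : #|nbrs G S v|%:R / (c1 * #|X|%:R) * #|parents h v|%:R <= _).
    rewrite mulrAC ler_pdivlMr ?mulr_gt0 //; exact: ler_wpM2l.
  by rewrite lerDr mulr_ge0 //; case: ifP => _ //; lra.
apply: le_trans (_ : \prod_(v in nonroot) (expR (t v) * #|parents h v|%:R) <= _).
  by apply: ler_prod => v vn; rewrite key // andbT sumr_ge0 // => u _; apply: expR_ge0.
rewrite big_split /= -expR_sum; apply: ler_wpM2r; first by rewrite prodr_ge0.
rewrite ler_expR /t big_split /=.
have t1 : \sum_(v in nonroot) (if v \in bad then 1 / 2 else 0) <= e%:R + wmax / 2.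
  rewrite -big_mkcondr /= sumr_const.
  apply: le_trans (_ : (1 / 2) * #|bad|%:R <= _).
    rewrite -[leLHS]mulr_natr; apply: ler_wpM2l; first by lra.
    by rewrite ler_nat; apply: subset_leq_card; apply/subsetP => v; rewrite unfold_in => /andP[].
  have cb : #|bad|%:R <= e%:R + (wmax + e%:R) :> R.
    apply: le_trans (_ : (#|nonroot :\: band| + (#|deeper h| + #|irr|))%:R <= _).
      rewrite ler_nat; apply: leq_trans (leq_card_setU _ _).1 _; rewrite leq_add2l.
      exact: (leq_card_setU _ _).1.
    rewrite !natrD; apply: lerD; first by rewrite ler_nat.
    by apply: lerD => //; rewrite ler_nat regular.
  by lra.
have t2 : \sum_(v in nonroot) #|nbrs G S v|%:R / (c1 * #|X|%:R) <= K * ell * s / (c1 * m).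
  rewrite -mulr_suml.
  have Kell0 : 0 <= K * ell by apply: le_trans (deg r); apply: ler0n.
  apply: ler_pM.
  - exact: sumr_ge0.
  - by rewrite invr_ge0 mulr_ge0 // ltW.
  - apply: le_trans (_ : K * ell * #|S|%:R <= _); last exact: ler_wpM2l.
    rewrite -natr_sum; apply: le_trans (_ : (\sum_(u in S) #|nbrs G [set: V] u|)%N%:R <= _).
      by rewrite ler_nat sum_nbrs.
    by rewrite natr_sum mulrC mulr_natl -sumr_const; apply: ler_sum => u _; apply: deg.
  - by rewrite lef_pV2 ?posrE ?mulr_gt0 // ler_pM2l.
by rewrite /E; lra.
Qed.

(** The set that captures many parents may depend on the tree, hence the union bound over small [S].
    A tilt of [1 / 2] per captured parent turns the threshold [n / 2] into a gain
    [expR (- (n / 4))]. *)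
Lemma hits_prob_le :
  \sum_(T | `[< spanning_tree r G T >] && (spread (depth r T) &&
     [exists S in powerset (layer r G D), (#|S|%:R <= s) &&
        (n / 2 <= #|hits S (parent_fun r T)|%:R)])) gibbs r b G T <=
  expR (100 * s + n / 100) * expR (E - n / 4).
Proof.
pose fam := [set S in powerset (layer r G D) | #|S|%:R <= s].
pose f (h : depth_fun) (p : {ffun V -> V}) : R :=
  (spread h)%:R * \sum_(S in fam) expR ((#|hits S p|%:R - n / 2) / 2).
apply: (@gibbs_prob_le _ _ _ _ Gsub b (fun=> 0%N) (fun h p => spread h &&
   [exists S in powerset (layer r G D), (#|S|%:R <= s) && (n / 2 <= #|hits S p|%:R)]) f).
- by move=> h p; rewrite mulr_ge0 // sumr_ge0 // => S _; apply: expR_ge0.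
- move=> h p _ _ /andP[hs /existsP[S /andP[SD /andP[Ss nh]]]]; rewrite /f hs mul1r.
  rewrite (bigD1 S) /=; last by rewrite inE SD.
  apply: le_trans (_ : expR ((#|hits S p|%:R - n / 2) / 2) <= _).
    by apply: expR_ge1_ge0; rewrite divr_ge0 // subr_ge0.
  by rewrite lerDl sumr_ge0 // => S' _; apply: expR_ge0.
apply: le_trans (_ : #|fam|%:R * (expR (E - n / 4) * partition r G b (fun=> 0%N)) <= _); last first.
  rewrite -mulrA; apply: ler_wpM2r; last exact: card_small_sets.
  by rewrite mulr_ge0 ?expR_ge0 // ltW // partition_gt0.
rewrite mulr_natl -sumr_const.
apply: le_trans (_ : \sum_(S in fam) \sum_(h | valid_depth h) \sum_(p in family (parent_pred h))
   weight r G b (fun=> 0%N) h * ((spread h)%:R * expR ((#|hits S p|%:R - n / 2) / 2)) <= _).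
  rewrite [leRHS]exchange_big; apply: ler_sum => h _; rewrite [leRHS]exchange_big /=.
  by apply: ler_sum => p _; rewrite /f !mulr_sumr.
apply: ler_sum => S; rewrite inE powersetE => /andP[SD Ss].
rewrite /partition mulr_sumr; apply: ler_sum => h hv.
have w0 := weight_gt0 r G b (fun=> 0%N) h.
rewrite sum_family1 mulrCA -mulr_sumr; apply: ler_wpM2l; first exact: ltW.
case: (boolP (spread h)) => hs; last first.
  rewrite big1 => [|p _]; last by rewrite mul0r.
  by rewrite mulr_ge0 ?expR_ge0 // prodr_ge0.
apply: le_trans (_ : expR (- (n / 4)) * (\prod_(v in nonroot) \sum_(u in parents h v) expR ((u \in S)%:R / 2)) <= _).
  rewrite -(sum_family_prod r G h (fun v u => expR ((u \in S)%:R / 2))) mulr_sumr.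
  apply: ler_sum => p _; rewrite mul1r -expR_sum -expRD ler_expR -mulr_suml -natr_sum.
  have -> : (\sum_(v in nonroot) (p v \in S))%N = #|hits S p|.
    rewrite -sum1_card big_mkcond [RHS]big_mkcond; apply: eq_bigr => v _.
    by rewrite [v \in hits _ _]in_set; case: (v \in nonroot) => //=; case: (_ \in S).
  lra.
rewrite expRD mulrC -mulrA; apply: le_trans (ler_wpM2r _ (hits_factor hv hs SD Ss)) _.
  exact: expR_ge0.
by rewrite -mulrA [_ * expR _]mulrC.
Qed.

End Hits.

(** The top set of the first tree serves as test set: it captures nearly all the parents of the
    first tree, while no set of this size captures half of those of the second. The second bound is
    uniform in [S] because under an arbitrary coupling the test set is correlated with the second
    tree. *)
Lemma wasserstein_gibbs_ge (b1 b2 s o p1 p2 c : R) :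
  \sum_(T | `[< spanning_tree r G T >] &&
     ~~ ((#|top (depth r T)|%:R <= s) &&
         (#|misplaced (depth r T) (parent_fun r T)|%:R <= o))) gibbs r b1 G T <= p1 ->
  \sum_(T | `[< spanning_tree r G T >] &&
     [exists S in powerset (layer r G D), (#|S|%:R <= s) &&
        (#|V|%:R / 2 <= #|hits S (parent_fun r T)|%:R :> R)]) gibbs r b2 G T <= p2 ->
  0 <= c <= #|band|%:R - s - o - #|V|%:R / 2 ->
  c * (1 - p1 - p2) <=
  wasserstein1 (fun T T' => (tree_dist r T T')%:R) (gibbs r b1 G) (gibbs r b2 G).
Proof.
move=> hp1 hp2 /andP[c0 hc].
pose A1 T := ~~ ((#|top (depth r T)|%:R <= s) &&
         (#|misplaced (depth r T) (parent_fun r T)|%:R <= o)).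
pose A2 T := [exists S in powerset (layer r G D), (#|S|%:R <= s) &&
        (#|V|%:R / 2 <= #|hits S (parent_fun r T)|%:R :> R)].
pose sp T := `[< spanning_tree r G T >].
have split_sum b (A : pred (graph V)) : \sum_(T | ~~ sp T || A T) gibbs r b G T =
    \sum_(T | sp T && A T) gibbs r b G T.
  rewrite big_mkcond [RHS]big_mkcond; apply: eq_bigr => T _; rewrite /sp /gibbs.
  by case: asboolP => //= _; case: ifP.
apply: le_trans (_ : c * (1 - \sum_(T | ~~ sp T || A1 T) gibbs r b1 G T -
   \sum_(T | ~~ sp T || A2 T) gibbs r b2 G T) <= _).
  by rewrite !split_sum; apply: ler_wpM2l => //; move: hp1 hp2; rewrite /A1 /A2 /sp; lra.
apply: (wasserstein1_ge (B1 := fun T => ~~ sp T || A1 T) (B2 := fun T => ~~ sp T || A2 T)) => //.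
- by move=> T; apply: gibbs_ge0.
- by move=> T; apply: gibbs_ge0.
- exact: gibbs_sum1.
- exact: gibbs_sum1.
move=> T T'; rewrite negb_or => /andP[/negPn/asboolP sT /negPn/andP[hs ho]].
rewrite negb_or => /andP[/negPn/asboolP sT' nA2].
apply: le_trans hc _; rewrite (tree_distE sT sT').
set h := depth r T; set p := parent_fun r T; set p' := parent_fun r T'.
set X := top h in hs.
have XD : X \subset layer r G D by apply/subsetP => v; rewrite inE => /andP[].
have hits' : #|hits X p'|%:R <= #|V|%:R / 2 :> R.
  rewrite leNgt; apply/negP => lt.
  case/negP: nA2; apply/existsP.
  by exists X; rewrite powersetE XD hs /= ltW.
have ih := inhabited_depth_tree sT; have hge u := inhabited_depth_ge u ih.
(* A band vertex outside [top h] that is not misplaced has depth [D.+1]; its parent has depth [D]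
   and is not in [core], so it belongs to [top h]. *)
have cover : band \subset (X :|: misplaced h p) :|: hits X p.
  apply/subsetP => v vb; apply/setUP.
  case: (boolP (v \in X)) => vX; first by left; rewrite in_setU vX.
  case: (boolP (v \in misplaced h p)) => vm; first by left; rewrite in_setU vm orbT.
  right; have vn := subsetP (@band_nonroot V r G D D0 DV) v vb; rewrite inE vn /=.
  move: vm; rewrite inE vb /= negb_or -leqNgt => /andP[vd vc].
  have vD : (D <= h v)%N.
    by apply: leq_trans (hge v); move: vb; rewrite !inE => /orP[]/eqP ->.
  have hvD : h v = D.+1 :> nat.
    move: vd; rewrite leq_eqVlt => /orP[/eqP //|hv]; case/negP: vX.
    have hvD : h v = D :> nat by apply/eqP; rewrite eqn_leq vD andbT.
    rewrite inE hvD eqxx andbT; move: vb; rewrite in_setU => /orP[//|]; rewrite inE => /eqP dv.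
    by have := hge v; rewrite dv -/h hvD ltnn.
  move: vc; rewrite hvD eqxx /= => vc.
  have := parent_fun_parents sT vn; rewrite inE -/h -/p hvD => /andP[_ /eqP[hp]].
  rewrite !inE hp eqxx andbT eqn_leq -{1}hp hge /=.
  by move: vc; rewrite inE -leqNgt.
have card_cover : (#|band| <= #|X| + #|misplaced h p| + #|hits X p|)%N.
  apply: leq_trans (subset_leq_card cover) _; apply: leq_trans (leq_card_setU _ _).1 _.
  by rewrite leq_add2r (leq_card_setU _ _).1.
have card_diff : (#|hits X p| <= #|hits X p'| +
    #|[set v in nonroot | p v != p' v]|)%N.
  apply: leq_trans (leq_card_setU _ _).1; apply: subset_leq_card; apply/subsetP => v.
  rewrite in_setU ![_ \in hits _ _]inE [_ \in [set v in nonroot | _]]inE => /andP[vn pX].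
  by rewrite vn /=; case: (eqVneq (p v) (p' v)) => [e|_]; rewrite ?orbT // -e pX.
move: card_cover card_diff hs ho hits'; rewrite -!(ler_nat R) !natrD -/h -/p.
move: #|band|%:R #|X|%:R #|misplaced h p|%:R #|hits X p|%:R #|hits X p'|%:R.
move: #|[set v in nonroot | p v != p' v]|%:R #|V|%:R.
clear; move=> *; lra.
Qed.

End Spread.

(** * Perturbations of the geodesic depths *)

Section NearGeodesic.
Variables (R : realType) (V : finType) (r : V) (G : graph V).
Hypothesis Gsub : G \subset all_edges V.
Local Notation nonroot := (nonroot r G).
Local Notation parents := (@parents V G).
Local Notation parent_pred := (@parent_pred V r G).
Local Notation valid_depth := (@valid_depth V r G).
Local Notation depth_fun := (depth_fun V).
Local Notation geo := (gdist G r).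
Local Notation h0 := (depth r G).
Variable D : nat.
Hypotheses (D0 : (0 < D)%N) (DV : (D.+1 < #|V|)%N).
Local Notation top := (top r G D).
Local Notation A := (layer r G D).
Variable B : {set V}.
Hypothesis BD : B \subset layer r G D.+1.

Definition late (h : depth_fun) : {set V} := [set v in B | (D.+1 < h v)%N].

Lemma card_parents_geodesic v : v \in nonroot -> (0 < #|parents h0 v|)%N.
Proof.
move=> vn; have /andP[_ /forallP/(_ v)] := inhabited_depth_ambient r G.
by rewrite vn /= card_gt0.
Qed.

Lemma parents_geodesic v : v \in B -> parents h0 v = nbrs G A v.
Proof.
move=> /(subsetP BD); rewrite inE => /eqP dv; apply/setP => u.
by rewrite !inE !depthE dv eqSS andbC.
Qed.

Lemma B_nonroot : B \subset nonroot.
Proof. by apply: subset_trans BD _; rewrite layer_nonroot ?DV. Qed.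

Section Depth.
Variable h : depth_fun.
Hypothesis ih : inhabited_depth r G h.
Let hge u : (geo u <= h u)%N := inhabited_depth_ge u ih.

Lemma parents_sub_geodesic v : h v = geo v :> nat -> parents h v \subset parents h0 v.
Proof.
move=> hv; apply/subsetP => u; rewrite !inE hv !depthE => /andP[uv /eqP hu]; rewrite uv /=.
rewrite eqn_leq (gdist_adj r uv) andbT -hu ltnS; exact: hge.
Qed.

Lemma parents_top v : v \in B -> h v = D.+1 :> nat -> parents h v = nbrs G (top h) v.
Proof.
move=> /(subsetP BD); rewrite inE => /eqP dv hv; apply/setP => u; rewrite !inE hv eqSS.
case uv: (adj G u v); rewrite ?andbF //= andbT; apply/eqP/andP => [hu|[_ /eqP//]].
split; last by rewrite hu.
rewrite eqn_leq -{1}hu hge /=; have := gdist_adj r uv; rewrite dv //.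
Qed.

End Depth.

(** The fraction of geodesic parents that [h] no longer offers to [v]; off [B] and for late vertices
    the trivial value [1] is used. *)
Definition discrepancy (h : depth_fun) (v : V) : R :=
  if (v \in B) && (h v == D.+1 :> nat) then 1 - #|parents h v|%:R / #|parents h0 v|%:R else 1.

(** At geodesic depth both parent sets lie in the set of geodesic parents, the common superset
    required by [overlap_uniform]. *)
Lemma overlap_discrepancy (h h' : depth_fun) v :
  inhabited_depth r G h -> inhabited_depth r G h' -> v \in nonroot ->
  1 - overlap (uniform R (parents h v)) (uniform R (parents h' v)) <=
  discrepancy h v + discrepancy h' v.
Proof.
move=> ih ih' vn.
have ov : 1 - overlap (uniform R (parents h v)) (uniform R (parents h' v)) <= 1.
  by rewrite gerBl overlap_uniform_ge0.
have d0 k : inhabited_depth r G k -> 0 <= discrepancy k v.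
  move=> ik; rewrite /discrepancy; case: ifP => // /andP[vB /eqP hv].
  rewrite subr_ge0 ler_pdivrMr ?ltr0n ?card_parents_geodesic // mul1r ler_nat.
  apply/subset_leq_card/parents_sub_geodesic => //; rewrite hv.
  by have := subsetP BD v vB; rewrite inE => /eqP ->.
have p1 := d0 _ ih; have p2 := d0 _ ih'.
case bh: ((v \in B) && (h v == D.+1 :> nat)); last first.
  have e : discrepancy h v = 1 by rewrite /discrepancy bh.
  by rewrite e; move: ov p2; clear; move=> *; lra.
case bh': ((v \in B) && (h' v == D.+1 :> nat)); last first.
  have e : discrepancy h' v = 1 by rewrite /discrepancy bh'.
  by rewrite e; move: ov p1; clear; move=> *; lra.
rewrite /discrepancy bh bh'.
case/andP: bh => vB /eqP hv; case/andP: bh' => _ /eqP hv'.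
have dv : geo v = D.+1 by have := subsetP BD v vB; rewrite inE => /eqP.
have pos k : inhabited_depth r G k -> (0 < #|parents k v|)%N.
  by case/andP => _ /forallP/(_ v); rewrite vn /= card_gt0.
by apply: overlap_uniform; rewrite ?pos //; apply: parents_sub_geodesic => //; rewrite dv.
Qed.

Definition deficit (X : {set V}) : R :=
  \sum_(v in B) (1 - #|nbrs G X v|%:R / #|nbrs G A v|%:R).

Lemma sum_discrepancy_le (h : depth_fun) : inhabited_depth r G h ->
  \sum_(v in nonroot) discrepancy h v <=
  #|nonroot :\: B|%:R + #|late h|%:R + deficit (top h).
Proof.
move=> ih; have hge u := inhabited_depth_ge u ih.
have frac v : v \in B -> #|nbrs G (top h) v|%:R / #|nbrs G A v|%:R <= 1 :> R.
  move=> vB; rewrite ler_pdivrMr; last first.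
    by rewrite ltr0n -parents_geodesic // card_parents_geodesic // (subsetP B_nonroot).
  rewrite mul1r ler_nat; apply: subset_leq_card; apply/subsetP => u.
  by rewrite !inE => /andP[/andP[-> _] ->].
rewrite (big_setID B) /= (setIidPr B_nonroot) addrC -addrA; apply: lerD.
  rewrite -sum1_card natr_sum; apply: ler_sum => v; rewrite inE => /andP[/negPf vB _].
  by rewrite /discrepancy vB.
have -> : #|late h|%:R = \sum_(v in B) (if (D.+1 < h v)%N then 1 else 0) :> R.
  by rewrite -big_mkcondr /= -sum1_card natr_sum; apply: eq_bigl => v; rewrite inE.
rewrite -big_split /=; apply: ler_sum => v vB; have := frac v vB.
rewrite /discrepancy vB /=; case: eqP => [hv|hv].
  by rewrite hv ltnn add0r (parents_top ih) // (parents_geodesic vB).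
have -> : (D.+1 < h v)%N.
  rewrite ltn_neqAle eq_sym; apply/andP; split; first exact/eqP.
  by apply: leq_trans (hge v); have := subsetP BD v vB; rewrite inE => /eqP ->.
by move=> h1; rewrite lerDl subr_ge0.
Qed.

Variables (K ell b w nlow : R).
Hypothesis deg : forall v, #|nbrs G [set: V] v|%:R <= K * ell.
Hypothesis b2 : expR (- b) <= 1 / 2.
Hypothesis nlow0 : 0 < nlow.
Hypothesis B_deg : forall v, v \in B -> nlow <= #|nbrs G A v|%:R.

Let Kell0 : 0 <= K * ell.
Proof. by apply: le_trans (deg r); apply: ler0n. Qed.

Let tail : R := expR w * (K * ell / nlow) * expR (- b).

Let tail0 : 0 <= tail.
Proof. by rewrite mulr_ge0 ?expR_ge0 // mulr_ge0 ?expR_ge0 // divr_ge0 // ltW. Qed.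

(** The analogue of [factor] relative to the geodesic depths and to the numbers of geodesic parents.
    A vertex of [B] all of whose geodesic parents stay available contributes [1] up to the small
    tail. *)
Definition ratio (X : {set V}) (v : V) : R :=
  if v \in B then #|nbrs G X v|%:R / #|nbrs G A v|%:R + 2 * tail
  else if v \in A then (if v \in X then 1 else 2 * (K * ell * expR (- b)))
  else 2 * (K * ell).

Let level_ratio (X : {set V}) (v : V) (j : nat) : R :=
  if v \in B then
    if j == D.+1 then #|nbrs G X v|%:R / #|nbrs G A v|%:R
    else tail * (if (D.+2 <= j)%N then expR (- b) ^+ (j - D.+2) else 0)
  else if v \in A then
    if v \in X then (if j == D then 1 else 0)
    else K * ell * expR (- b) * (if (D.+1 <= j)%N then expR (- b) ^+ (j - D.+1) else 0)
  else K * ell * (if (geo v <= j)%N then expR (- b) ^+ (j - geo v) else 0).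

Let level_ratio_ge0 X v j : 0 <= level_ratio X v j.
Proof.
have e0 (c : bool) k : 0 <= (if c then expR (- b) ^+ k else 0).
  by case: c => //; rewrite exprn_ge0 ?expR_ge0.
rewrite /level_ratio; case: ifP => _.
  by case: ifP => _; [rewrite divr_ge0|apply: mulr_ge0].
case: ifP => _; last exact: mulr_ge0.
case: ifP => _; first by case: ifP.
by apply: mulr_ge0 => //; rewrite mulr_ge0 ?expR_ge0.
Qed.

Let sum_level_ratio X v : \sum_(j < #|V|.+1) level_ratio X v j <= ratio X v.
Proof.
have eb : 0 <= expR (- b) <= 1 / 2 by rewrite expR_ge0.
have KE : 0 <= K * ell * expR (- b) by rewrite mulr_ge0 ?expR_ge0.
rewrite /level_ratio /ratio; case: ifP => _.
  have DV' : (D.+1 < #|V|.+1)%N by apply: leq_trans DV _.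
  rewrite (bigD1 (Ordinal DV')) //= eqxx lerD2l.
  apply: le_trans (_ : \sum_(j < #|V|.+1) tail * (if (D.+2 <= j)%N then expR (- b) ^+ (j - D.+2) else 0) <= _).
    rewrite [leRHS](bigD1 (Ordinal DV')) //= ltnn mulr0 add0r.
    apply: ler_sum => j jD; case: eqP => [e|_]; last exact: lexx.
    by case/eqP: jD; apply/val_inj.
  by rewrite -mulr_sumr mulrC; apply: ler_wpM2r => //; apply: geometric_tail.
case: ifP => _; last first.
  by rewrite -mulr_sumr mulrC; apply: ler_wpM2r => //; apply: geometric_tail.
case: ifP => _; last first.
  by rewrite -mulr_sumr mulrC; apply: ler_wpM2r => //; apply: geometric_tail.
have DV' : (D < #|V|.+1)%N by apply: leq_trans (ltnW DV) _.
rewrite (bigD1 (Ordinal DV')) //= eqxx big1 ?addr0 // => j jD.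
by case: eqP => // e; case/eqP: jD; apply/val_inj.
Qed.

Let card_parents_le (h : depth_fun) v : #|parents h v|%:R <= K * ell.
Proof.
by apply: le_trans (deg v); rewrite ler_nat subset_leq_card // parents_sub_nbrs.
Qed.

Let vertex_ratio_le (h : depth_fun) v : inhabited_depth r G h -> v \in nonroot ->
  expR (- b * ((h v)%:R - (geo v)%:R)) * #|parents h v|%:R *
    expR (if v \in late h then w else 0) <=
  level_ratio (top h) v (h v) * #|parents h0 v|%:R.
Proof.
move=> ih vn; have hge := inhabited_depth_ge v ih.
have N0 : 1 <= #|parents h0 v|%:R :> R by rewrite ler1n card_parents_geodesic.
have N00 : 0 < #|parents h0 v|%:R :> R by apply: lt_le_trans N0; apply: ltr01.
rewrite expR_depth // /level_ratio; case: (boolP (v \in B)) => vB.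
  have dv : geo v = D.+1 by have := subsetP BD v vB; rewrite inE => /eqP.
  rewrite inE vB /=; case: eqP => [hv|/eqP hv].
    rewrite hv dv subnn expr0 mul1r ltnn expR0 mulr1 (parents_top ih) // -parents_geodesic //.
    by rewrite divfK // gt_eqF.
  have hv2 : (D.+2 <= h v)%N by rewrite ltn_neqAle eq_sym hv -dv.
  rewrite hv2 dv; have -> : (h v - D.+1 = (h v - D.+2).+1)%N by rewrite -subSn.
  set k := (h v - D.+2)%N; rewrite exprS /tail.
  have -> : expR w * (K * ell / nlow) * expR (- b) * expR (- b) ^+ k * #|parents h0 v|%:R =
     expR (- b) * expR (- b) ^+ k * (K * ell * (#|parents h0 v|%:R / nlow)) * expR w by ring.
  apply: ler_wpM2r; first exact: expR_ge0.
  apply: ler_wpM2l; first by rewrite mulr_ge0 ?exprn_ge0 ?expR_ge0.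
  apply: le_trans (card_parents_le h v) _; apply: ler_peMr => //.
  by rewrite ler_pdivlMr // mul1r parents_geodesic // B_deg.
have -> : (v \in late h) = false by rewrite inE (negPf vB).
rewrite expR0 mulr1; case: ifPn => vA.
  have dv : geo v = D by move: vA; rewrite inE => /eqP.
  case: ifPn => vX.
    have hv : h v = D :> nat by move: vX; rewrite inE => /andP[_ /eqP].
    rewrite hv dv subnn eqxx expr0 !mul1r ler_nat.
    by apply/subset_leq_card/(parents_sub_geodesic ih); rewrite hv dv.
  have hv : (D.+1 <= h v)%N.
    rewrite ltn_neqAle -{2}dv hge andbT; apply: contra vX => /eqP e.
    by rewrite inE vA -e eqxx.
  rewrite hv dv; have -> : (h v - D = (h v - D.+1).+1)%N by rewrite -subSn.
  set k := (h v - D.+1)%N; rewrite exprS.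
  have -> : K * ell * expR (- b) * expR (- b) ^+ k * #|parents h0 v|%:R =
     expR (- b) * expR (- b) ^+ k * (K * ell * #|parents h0 v|%:R) by ring.
  apply: ler_wpM2l; first by rewrite mulr_ge0 ?exprn_ge0 ?expR_ge0.
  by apply: le_trans (card_parents_le h v) _; apply: ler_peMr.
rewrite hge [K * ell * _]mulrC -mulrA; apply: ler_wpM2l; first by rewrite exprn_ge0 ?expR_ge0.
by apply: le_trans (card_parents_le h v) _; apply: ler_peMr.
Qed.

Lemma ratio_sum (X : {set V}) :
  \sum_(h | valid_depth h && (top h == X)) \sum_(p in family (parent_pred h))
    weight r G b geo h * expR (#|late h|%:R * w) <=
  (\prod_(v in nonroot) ratio X v) * \prod_(v in nonroot) #|parents h0 v|%:R.
Proof.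
set c0 := \prod_(v in nonroot) #|parents h0 v|%:R.
have c00 : 0 <= c0 by rewrite prodr_ge0.
apply: le_trans (_ : \sum_(h | valid_depth h) (\prod_(v in nonroot) level_ratio X v (h v)) * c0 <= _).
  rewrite [leLHS]big_mkcondr; apply: ler_sum => h hv; case: eqP => [<-|_]; last first.
    by rewrite mulr_ge0 // prodr_ge0.
  rewrite sum_family1; case: (boolP (inhabited_depth r G h)) => ih; last first.
    move: ih; rewrite /inhabited_depth hv /= => /forallPn[v].
    rewrite negb_imply negbK => /andP[vn /eqP e].
    by rewrite [X in _ * X <= _](bigD1 v) //= e cards0 mul0r mulr0 mulr_ge0 // prodr_ge0.
  have -> : expR (#|late h|%:R * w) = \prod_(v in nonroot) expR (if v \in late h then w else 0).
    rewrite -expR_sum -big_mkcondr /= mulr_natl -sumr_const; congr expR.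
    apply: eq_bigl => v; rewrite andbC; case: (boolP (v \in late h)) => //= vl.
    by apply/esym/(subsetP B_nonroot); move: vl; rewrite inE => /andP[].
  rewrite mulrAC /weight -!big_split /=; apply: ler_prod => v vn.
  by rewrite vertex_ratio_le // andbT !mulr_ge0 ?expR_ge0.
rewrite -mulr_suml; apply: ler_wpM2r => //; rewrite sum_depth_prod.
apply: ler_prod => v vn; rewrite sum_level_ratio andbT.
by apply: sumr_ge0 => j _.
Qed.

(** The partition function is bounded below by the geodesic depth function alone; it has weight [1],
    and its number of parent choices cancels. The union bound runs over subsets of layer [D] only,
    hence the factor [2 ^+ #|A|]. *)
Lemma gibbs_near_geodesic (E : pred {set V}) (F : pred depth_fun) (m M : R) :
  (forall h, F h -> E (top h) /\ m <= #|late h|%:R * w) ->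
  (forall X : {set V}, X \subset A -> E X -> \prod_(v in nonroot) ratio X v <= M) ->
  0 <= M ->
  \sum_(T | `[< spanning_tree r G T >] && F (depth r T)) gibbs r b G T <=
  2 ^+ #|A| * M * expR (- m).
Proof.
move=> hF hM M0.
apply: (@gibbs_prob_le _ _ _ _ Gsub b geo (fun h _ => F h)
  (fun h p => (E (top h))%:R * expR (#|late h|%:R * w - m))) => [h p|h p _ _ Fh|].
- by rewrite mulr_ge0 ?expR_ge0.
- have [-> hm] := hF _ Fh; rewrite mul1r; apply: expR_ge1_ge0.
  by rewrite subr_ge0.
set c0 : R := \prod_(v in nonroot) #|parents h0 v|%:R.
have c00 : 0 <= c0 by rewrite prodr_ge0.
apply: le_trans (_ : 2 ^+ #|A| * M * expR (- m) * c0 <= _); last first.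
  apply: ler_wpM2l; first by rewrite !mulr_ge0 ?exprn_ge0 ?expR_ge0.
  have := partition_ge_depth b geo (inhabited_depth_ambient r G).
  rewrite [weight _ _ _ _ _]big1 ?mul1r // => v _.
  by rewrite depthE subrr mulr0 expR0.
rewrite (partition_big top (fun X => X \subset A)) /=; last first.
  by move=> h _; apply/subsetP => v; rewrite inE => /andP[].
have term (X : {set V}) : X \subset A ->
   \sum_(h | valid_depth h && (top h == X)) \sum_(p in family (parent_pred h))
     weight r G b geo h * ((E (top h))%:R * expR (#|late h|%:R * w - m)) <= M * expR (- m) * c0.
  move=> XD; case: (boolP (E X)) => EX; last first.
    rewrite big1 ?mulr_ge0 ?expR_ge0 // => h /andP[_ /eqP e]; rewrite big1 // => p _.
    by rewrite e (negPf EX) mul0r mulr0.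
  apply: le_trans (_ : (\prod_(v in nonroot) ratio X v) * c0 * expR (- m) <= _); last first.
    by rewrite mulrAC; apply: ler_wpM2r => //; apply: ler_wpM2r; [exact: expR_ge0|exact: hM].
  apply: le_trans (ler_wpM2r (expR_ge0 _) (ratio_sum X)).
  rewrite mulr_suml; apply: ler_sum => h /andP[_ /eqP e]; rewrite mulr_suml.
  by apply: ler_sum => p _; rewrite e EX mul1r expRD mulrA.
apply: le_trans (ler_sum _ term) _.
rewrite sumr_const -[leLHS]mulr_natl -!mulrA; apply: ler_wpM2r; first by rewrite !mulr_ge0 ?expR_ge0.
rewrite -natrX ler_nat -card_powerset.
by apply: subset_leq_card; apply/subsetP => X; rewrite powersetE unfold_in.
Qed.

End NearGeodesic.

(** * Discontinuous transition *)

Lemma mul_expRN_le (R : realType) (a s t : R) :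
  a * expR s <= expR t -> a * expR (- t) <= expR (- s).
Proof.
by move=> h; rewrite !expRN ler_pdivrMr ?expR_gt0 // mulrC ler_pdivlMr ?expR_gt0.
Qed.

Section Phase.
Variables (R : realType) (V : finType) (r : V) (G : graph V).
Hypothesis Gsub : G \subset all_edges V.
Variables (D : nat) (K L c1 Delta n : R).
Hypotheses (nE : n = #|V|%:R) (D0 : (0 < D)%N) (DV : (D.+1 < #|V|)%N).
Local Notation ell := (expR L).
Local Notation core := (core r G D).
Local Notation band := (band r G D).
Local Notation A := (layer r G D).
Hypotheses (K1 : 1 <= K) (c10 : 0 < c1) (L24 : 24 <= L) (ln2K : ln (2 * K) <= L) (Ln : L <= n).
Hypothesis deg : forall v, #|nbrs G [set: V] v|%:R <= K * ell.
Hypothesis regular : forall X : {set V}, n / L <= #|X|%:R ->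
  #|[set v in ~: X | (#|nbrs G X v|%:R < c1 * ell / n * #|X|%:R)%R]|%:R <= n / L ^+ 2.
Hypothesis core_le : #|core|%:R <= 3 * (n / L ^+ 2).
Hypothesis layer_ge : n / L <= #|A|%:R.

Let L0 : 0 < L. Proof. by apply: lt_le_trans L24. Qed.
Let n0 : 0 < n. Proof. exact: lt_le_trans Ln. Qed.
Let ell0 : 0 < ell. Proof. exact: expR_gt0. Qed.
Let K0 : 0 < K. Proof. exact: lt_le_trans K1. Qed.
Let Kell0 : 0 <= K * ell. Proof. by rewrite mulr_ge0 // ltW. Qed.
(** A vertex beyond layer [D.+1] has no neighbour in layer [D], so it is among the few vertices with
    too few neighbours there. *)
Lemma deep_le : #|~: (core :|: band)|%:R <= n / L ^+ 2.
Proof.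
apply: le_trans (regular layer_ge); rewrite ler_nat; apply: subset_leq_card.
apply/subsetP => v; rewrite in_setC in_setU negb_or => /andP[vc vb].
have Ap : 0 < #|A|%:R :> R by apply: lt_le_trans layer_ge; rewrite divr_gt0.
move: vb; rewrite in_setU negb_or => /andP[vA vA1].
rewrite inE in_setC vA /= (_ : nbrs G A v = set0) ?cards0.
  by rewrite mulr_gt0 // divr_gt0 // mulr_gt0.
apply/setP => u; rewrite !inE; apply/negP => /andP[/eqP du uv].
have := gdist_adj r uv; rewrite du => h.
move: vc vA vA1; rewrite !inE; move: h; clear; lia.
Qed.

(** A common bound for the sets of order [n / L ^+ 2]. Losing a factor [ell = expR L] at this many
    vertices costs at most [expR (n / 8)]. *)
Definition exceptional : nat := Num.truncn (3 * (n / L ^+ 2)).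

Let nL2 : 0 <= n / L ^+ 2. Proof. by rewrite divr_ge0 ?exprn_ge0 // ltW. Qed.

Lemma exceptional_le : exceptional%:R <= 3 * (n / L ^+ 2).
Proof. by rewrite truncn_le // mulr_ge0. Qed.

Lemma le_exceptional (k : nat) : k%:R <= 3 * (n / L ^+ 2) -> (k <= exceptional)%N.
Proof. by move=> h; rewrite truncn_ge_nat // mulr_ge0. Qed.

Lemma core_exceptional : (#|core| <= exceptional)%N.
Proof. exact: le_exceptional. Qed.

Lemma deep_exceptional : (#|~: (core :|: band)| <= exceptional)%N.
Proof. by apply: le_exceptional; have := deep_le; have := nL2; lra. Qed.

Lemma off_band_le (S : {set V}) : (#|S :\: band| <= 2 * exceptional)%N.
Proof.
have sub : S :\: band \subset core :|: ~: (core :|: band).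
  apply/subsetP => v /setDP[_ vb]; rewrite in_setU in_setC in_setU negb_or vb andbT.
  exact: orbN.
apply: leq_trans (subset_leq_card sub) _; apply: leq_trans (leq_card_setU _ _).1 _.
by rewrite mul2n -addnn leq_add ?core_exceptional ?deep_exceptional.
Qed.

Lemma exceptional_L : exceptional%:R * L <= n / 8.
Proof.
apply: le_trans (ler_wpM2r (ltW L0) exceptional_le) _.
have -> : 3 * (n / L ^+ 2) * L = 3 * n / L by field; rewrite gt_eqF.
rewrite ler_pdivrMr //; have := ler_wpM2l (ltW n0) L24; lra.
Qed.

Section Bounds.
Variables (beta eps M0 : R).
Hypotheses (beta0 : 0 < beta) (betaL : 4 * L <= expR (beta * L / 2)) (M01 : 1 <= M0)
  (c1M0 : c1 * M0 <= L) (Lc1 : L <= c1 * M0 * ell) (gap0 : 0 <= 1 - Delta - beta + eps).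
Hypothesis core_deg : K * ell * #|core|%:R <= n * expR ((Delta + eps) * L).
Variable A' : {set V}.
Hypotheses (A'A : A' \subset A) (A'_card : 2 * (M0 * (n / L)) <= #|A'|%:R)
  (A'_deg : forall v, v \in A' -> expR ((Delta - eps) * L) <= #|nbrs G core v|%:R).

Local Notation b := (beta * L).
Local Notation w1 := (beta * L / 2).
Local Notation w2 := (ln (L / 6)).
Local Notation gap := (1 - Delta - beta + eps).

Let b2 : expR (- b) <= 1 / 2.
Proof.
rewrite expRN div1r lef_pV2 ?posrE ?expR_gt0 //.
apply: le_trans (_ : expR (b / 2) <= _); first by have := betaL; have := L24; lra.
by rewrite ler_expR; have := mulr_gt0 beta0 L0; lra.
Qed.

(** The size [k] of [X0] is between [M0 * n / L] and twice that. Raising the exponent [m] to [#|V|]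
    costs a factor [ell] per missing vertex; on [X0] this combines with the gain
    [expR ((beta + Delta - eps) * L)] to [expR (- gap * L)] per vertex, and
    [k * L <= 2 * M0 * n]. *)
Lemma phase_partition_ge :
  expR (- ((2 * M0 * gap + 1) * n)) * (c1 * M0 / L * ell) ^+ #|V| <=
  partition r G b (ref_depth r G D).
Proof.
have M00 : 0 < M0 by apply: lt_le_trans M01.
have nL : 1 <= n / L by rewrite ler_pdivlMr // mul1r.
pose x := M0 * (n / L).
have x1 : 1 <= x by apply: le_trans nL _; rewrite /x ler_peMl // ltW // divr_gt0.
have x0 : 0 <= x by apply: le_trans x1.
pose k := (Num.truncn x).+1.
have kx : x <= k%:R by rewrite ltW // truncnS_gt.
have k2x : k%:R <= 2 * x.
  have : (Num.truncn x)%:R <= x by rewrite truncn_le.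
  by rewrite /k -natr1; lra.
have kA : (k <= #|A'|)%N by rewrite -(ler_nat R); apply: le_trans k2x A'_card.
have /set0Pn[X0] : [set X in powerset A' | #|X| == k] != set0.
  rewrite -card_gt0; have -> : #|[set X in powerset A' | #|X| == k]| = 'C(#|A'|, k).
    rewrite -cards_draws; apply: eq_card => X; rewrite !inE; by [].
  by rewrite bin_gt0.
rewrite inE powersetE => /andP[X0A' /eqP X0k].
have X0A := subset_trans X0A' A'A.
pose c' := c1 * M0 / L * ell.
have c'1 : 1 <= c' by rewrite /c' mulrAC ler_pdivlMr // mul1r.
have c'0 : 0 < c' by apply: lt_le_trans c'1.
have c'ell : c' <= ell by rewrite /c' ler_piMl // ler_pdivrMr // mul1r.
have X0big : n / L <= #|X0|%:R.
  by rewrite X0k; apply: le_trans kx; rewrite /x ler_peMl // ltW // divr_gt0.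
have c0c' : c' <= c1 * ell / n * #|X0|%:R.
  rewrite X0k; apply: le_trans (_ : c1 * ell / n * x <= _); last first.
    by apply: ler_wpM2l kx; rewrite divr_ge0 ?ltW // mulr_gt0.
  by rewrite /c' /x le_eqVlt; apply/orP; left; apply/eqP; field; rewrite !gt_eqF.
have irr_le : (#|[set v in ~: X0 | (#|nbrs G X0 v|%:R < c1 * ell / n * #|X0|%:R)%R]| <= exceptional)%N.
  by apply: le_exceptional; apply: le_trans (regular X0big) _; have := nL2; lra.
have hZ := @partition_ge_reference R V r G Gsub D K ell b D0 DV Kell0 b2 X0 (c1 * ell / n * #|X0|%:R)
  (expR ((Delta - eps) * L)) exceptional X0A (le_trans c'1 c0c') (expR_ge0 _)
  (mulr_ge0 (ltW beta0) (ltW L0)) core_exceptional deep_exceptional irr_le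
  (fun v vX => A'_deg (subsetP X0A' v vX)).
apply: le_trans hZ.
set e := exceptional; set m := (#|V| - #|X0| - 5 * e)%N.
apply: le_trans (_ : (expR b * expR ((Delta - eps) * L)) ^+ #|X0| * c' ^+ m <= _); last first.
  apply: ler_wpM2l; first by rewrite exprn_ge0 // mulr_ge0 ?expR_ge0.
  by apply: lerXn2r; rewrite ?nnegrE ?(ltW c'0) // (le_trans (ltW c'0)).
have hm : c' ^+ #|V| <= c' ^+ m * ell ^+ (#|X0| + 5 * e).
  apply: le_trans (_ : c' ^+ m * c' ^+ (#|X0| + 5 * e) <= _); last first.
    apply: ler_wpM2l; first by rewrite exprn_ge0 // ltW.
    by apply: lerXn2r; rewrite ?nnegrE ?(ltW c'0) ?(ltW ell0).
  rewrite -exprD; apply: ler_weXn2l => //; rewrite /m -subnDA addnC -leq_subLR; exact: leqnn.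
rewrite -/c' -expRD -expRM_natl.
apply: le_trans (ler_wpM2l (expR_ge0 _) hm) _; rewrite mulrCA mulrC; apply: ler_wpM2r.
  by rewrite exprn_ge0 // ltW.
rewrite -expRM_natl -expRD ler_expR natrD natrM X0k.
have he := exceptional_L; rewrite -/e in he.
have kL : k%:R * L <= 2 * M0 * n.
  have := ler_wpM2r (ltW L0) k2x; rewrite /x.
  by have -> : 2 * (M0 * (n / L)) * L = 2 * M0 * n by field; rewrite gt_eqF.
have := ler_wpM2r gap0 kL.
move: he; move: (k%:R) (e%:R) => kk ee; move=> he hk.
have -> : - ((2 * M0 * gap + 1) * n) + (kk + 5%:R * ee) * L =
  - (2 * M0 * n * gap) - n + kk * L + 5 * (ee * L) by ring.
have -> : kk * (beta * L + (Delta - eps) * L) = kk * L - kk * L * gap by ring.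
move: hk; move: (kk * L * gap) (2 * M0 * n * gap) (ee * L) (kk * L) he => *; have := n0; lra.
Qed.

(** Quotient of the upper and lower bounds, with [sigma = L^-1]; the powers of [ell] cancel. Half of
    [sigma] pays for parents in [core], which has at most [3 * n / L ^+ 2] vertices, tilted by
    [expR w2 = L / 6]. The other half pays for deep vertices, tilted by half of their cost [b]. *)
Lemma phase_prob (F : depth_fun V -> {ffun V -> V} -> bool) (E : pred {set V}) (m Q : R) :
  (forall h p, F h p -> E (top r G D h) /\ m <= marks r G D w1 w2 h p) ->
  0 <= Q ->
  (forall X : {set V}, X \subset A -> E X ->
     expR (#|X|%:R * ((beta + Delta + eps - 1) * L)) * (#|X|%:R / n + L^-1) ^+ #|V| <= Q ^+ #|V|) ->
  \sum_(T | `[< spanning_tree r G T >] && F (depth r T) (parent_fun r T)) gibbs r b G T <=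
  expR (- m) * (2 * expR (5 + 2 * M0 * gap) * K * (L / (c1 * M0)) * Q) ^+ #|V|.
Proof.
move=> hF Q0 hQ.
have M00 : 0 < M0 by apply: lt_le_trans M01.
have w1b : expR w1 * expR (- b) <= (4 * L)^-1.
  rewrite -expRD (_ : w1 + - b = - (b / 2)); last by field.
  by rewrite expRN lef_pV2 ?posrE ?expR_gt0 // mulr_gt0.
have w2E : expR w2 = L / 6 by rewrite lnK ?posrE // divr_gt0.
have LeL : L <= ell by have := expR_ge1Dx L; lra.
pose M := expR (4 * n) * (K * ell * Q) ^+ #|V|.
pose Z := expR (- ((2 * M0 * gap + 1) * n)) * (c1 * M0 / L * ell) ^+ #|V|.
have c0 : 0 < c1 * M0 / L by rewrite divr_gt0 // mulr_gt0.
have Z0 : 0 < Z by rewrite mulr_gt0 ?expR_gt0 // exprn_gt0 // mulr_gt0.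
have MM : 0 <= M by rewrite mulr_ge0 ?expR_ge0 // exprn_ge0 // mulr_ge0.
have hM (X : {set V}) : X \subset A -> E X ->
    \prod_(v in nonroot r G) factor r G D K ell b w1 w2 X v <= M.
  move=> XA EX.
  apply: le_trans (@prod_factor_le R V r G D K ell b w1 w2 D0 DV deg Kell0 X L
    ((Delta + eps) * L) (L^-1) XA erefl K1 _ _ _ _) _.
  - have K2 : 0 < 2 * (K * ell) by rewrite mulr_gt0 // mulr_gt0.
    rewrite -nE -(@lnK _ (2 * (K * ell))) ?posrE // -expRM_natl ler_expR.
    have -> : ln (2 * (K * ell)) = ln (2 * K) + L.
      by rewrite mulrA lnM ?posrE ?mulr_gt0 ?expR_gt0 // expRK.
    apply: le_trans (_ : (2 * exceptional)%:R * (L + L) <= _).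
      apply: ler_pM => //; [|by rewrite ler_nat off_band_le|by rewrite lerD2r].
      by rewrite addr_ge0 ?(ltW L0) // ln_ge0; have := K1; lra.
    rewrite natrM; have := exceptional_L; have := n0; lra.
  - by rewrite -nE.
  - rewrite w2E -nE.
    have h1 : L / 6 * (#|core|%:R / n) <= (2 * L)^-1.
      apply: le_trans (_ : L / 6 * (3 * (n / L ^+ 2) / n) <= _).
        apply: ler_wpM2l; first by rewrite divr_ge0 // ltW.
        by apply: ler_wpM2r => //; rewrite invr_ge0 ltW.
      by rewrite le_eqVlt; apply/orP; left; apply/eqP; field; rewrite !gt_eqF.
    have -> : L^-1 = (2 * L)^-1 + 2 * (4 * L)^-1 by field; rewrite gt_eqF.
    by apply: lerD => //; apply: ler_wpM2l.
  - rewrite ler_pdivlMr // mul1r; apply: le_trans LeL _.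
    by rewrite ler_peMl.
  rewrite -nE /M -mulrA; apply: ler_wpM2l; first exact: expR_ge0.
  rewrite [in leRHS]exprMn exprMn mulrCA; apply: ler_wpM2l; first by rewrite exprn_ge0.
  apply: le_trans (hQ X XA EX).
  by rewrite (_ : b + (Delta + eps) * L - L = (beta + Delta + eps - 1) * L) //; ring.
have := @gibbs_top_prob_le R V r G Gsub D K ell b w1 w2 D0 DV deg Kell0 b2 F E m M Z hF hM Z0 MM.
move=> /(_ phase_partition_ge) h; apply: le_trans h _.
rewrite le_eqVlt; apply/orP; left; apply/eqP.
rewrite /M /Z.
have -> : expR (4 * n) = expR 4 ^+ #|V| by rewrite -expRM_natl -nE mulrC.
have -> : expR (- ((2 * M0 * gap + 1) * n)) = (expR (2 * M0 * gap + 1))^-1 ^+ #|V|.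
  by rewrite -expRN -expRM_natl -nE; congr expR; ring.
rewrite -!exprMn mulrAC -expr_div_n mulrC; congr (_ * _ ^+ _).
have -> : 5 + 2 * M0 * gap = 4 + (2 * M0 * gap + 1) by ring.
by rewrite [expR (4 + _)]expRD; field; rewrite !gt_eqF ?expR_gt0.
Qed.

End Bounds.

(** * Comparison of the critical parameter with a smaller one *)

Section Gap.
Variables (gamma eps M M1 K' : R).
Local Notation beta1 := (1 - Delta - gamma).
Local Notation betac := (1 - Delta).
Hypotheses (gamma0 : 0 < gamma) (beta10 : 0 < beta1) (beta1L : 4 * L <= expR (beta1 * L / 2))
  (M_ge1 : 1 <= M) (M1_ge1 : 1 <= M1) (M1_big : 2 * expR 7 * K * (M + 1) <= c1 * M1)
  (c1M1 : c1 * M1 <= L) (Lc1 : L <= c1 * ell)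
  (eps0 : 0 < eps) (eps_gamma : eps <= gamma / 2) (eps_M : eps * (M + 2 * M1) <= 1)
  (eps_beta : eps <= betac / 40) (betacL : 2 * expR 1 * L <= expR (betac * L / 40))
  (K'0 : 0 <= K') (KK' : 100 * (K * K') <= c1 * M) (K'L : 2000 * K' <= L)
  (nbig : expR (- (n / 10)) <= 1 / 20).
Local Notation B1 := (2 * expR (5 + 3 * gamma) * (K / c1) * (4 / gamma * expR (gamma / 4))).
Hypotheses (B1K' : B1 * expR 1 <= expR (gamma * K' / 4))
  (B1L : B1 * expR 1 <= expR (ln (L / 6) / 10)).
Hypothesis core_deg : K * ell * #|core|%:R <= n * expR ((Delta + eps) * L).
Variable A' : {set V}.
Hypotheses (A'A : A' \subset A) (A'_card : 2 * (M1 * (n / L)) <= #|A'|%:R)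
  (A'_deg : forall v, v \in A' -> expR ((Delta - eps) * L) <= #|nbrs G core v|%:R).
Local Notation w1 beta := (beta * L / 2).
Local Notation w2 := (ln (L / 6)).

Let M10 : 0 < M1. Proof. exact: lt_le_trans M1_ge1. Qed.
Let M0 : 0 < M. Proof. exact: lt_le_trans M_ge1. Qed.
Let nL0 : 0 < n / L. Proof. by rewrite divr_gt0. Qed.
Let w20 : 0 <= w2.
Proof. by rewrite ln_ge0 // ler_pdivlMr // mul1r; have := L24; lra. Qed.
Let w21 : w2 <= w1 beta1.
Proof.
rewrite -ler_expR lnK ?posrE ?divr_gt0 //; apply: le_trans beta1L.
by have := L0; lra.
Qed.
Let expX (x : R) : expR x ^+ #|V| = expR (n * x).
Proof. by rewrite -expRM_natl nE. Qed.
(** In the variable [x = #|X| * L / n] the competition between position and parent choices is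
    [(x + 1) * expR (t * x)] per vertex of the graph. *)
Let powE (X : {set V}) (t : R) :
  expR (#|X|%:R * (t * L)) * (#|X|%:R / n + L^-1) ^+ #|V| =
  (L^-1 * ((#|X|%:R * L / n + 1) * expR (t * (#|X|%:R * L / n)))) ^+ #|V|.
Proof.
rewrite (mulrA L^-1) [in RHS]exprMn expX mulrC; congr (_ ^+ _ * expR _).
  by field; rewrite !gt_eqF.
by field; rewrite gt_eqF.
Qed.
(** A reference set of order [n / L] suffices here, with [M0 = 1]. In the factor
    [(x + 1) * expR (- gamma * x / 2)] half of the exponent absorbs [x + 1], which leaves
    [expR (- gamma * k / 4)] for [k <= x]. *)
Lemma below_prob (F : depth_fun V -> {ffun V -> V} -> bool) (k m : R) : 0 <= k ->
  (forall h p, F h p -> k * (n / L) <= #|top r G D h|%:R /\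
     m <= marks r G D (w1 beta1) w2 h p) ->
  \sum_(T | `[< spanning_tree r G T >] && F (depth r T) (parent_fun r T))
    gibbs r (beta1 * L) G T <= expR (- m) * (B1 * expR (- (gamma * k / 4))) ^+ #|V|.
Proof.
move=> k0 hF.
have c1L : c1 * 1 <= L.
  by apply: le_trans c1M1; rewrite ler_pM2l.
have gap0 : 0 <= 1 - Delta - beta1 + gamma / 2 by have := gamma0; lra.
have Lc1' : L <= c1 * 1 * ell by rewrite mulr1.
have cd : K * ell * #|core|%:R <= n * expR ((Delta + gamma / 2) * L).
  apply: le_trans core_deg _; rewrite ler_pM2l // ler_expR ler_pM2r //; have := eps_gamma; lra.
have A'c : 2 * (1 * (n / L)) <= #|A'|%:R.
  apply: le_trans A'_card; rewrite ler_pM2l // ler_pM2r //.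
have A'd v : v \in A' -> expR ((Delta - gamma / 2) * L) <= #|nbrs G core v|%:R.
  move=> /A'_deg; apply: le_trans; rewrite ler_expR ler_pM2r //; have := eps_gamma; lra.
pose Q := L^-1 * (4 / gamma * expR (gamma / 4) * expR (- (gamma * k / 4))).
have Q0 : 0 <= Q.
  by rewrite /Q mulr_ge0 ?invr_ge0 ?(ltW L0) // !mulr_ge0 ?expR_ge0 // invr_ge0 ltW.
have h := @phase_prob beta1 (gamma / 2) 1 beta10 beta1L (lexx 1) c1L Lc1' gap0 cd
  A' A'A A'c A'd F (fun X => k * (n / L) <= #|X|%:R) m Q hF Q0 _.
apply: le_trans (h _) _ => {h}.
  move=> X XA kX; have -> : beta1 + Delta + gamma / 2 - 1 = - (gamma / 2) by field.
  rewrite powE; set x := #|X|%:R * L / n.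
  have kx : k <= x.
    rewrite /x ler_pdivlMr // -ler_pdivrMr // -mulrA //.
  have x0 : 0 <= x by apply: le_trans kx.
  apply: lerXn2r; rewrite ?nnegrE //.
    by rewrite !mulr_ge0 ?invr_ge0 ?expR_ge0 ?(ltW L0) ?addr_ge0.
  rewrite /Q ler_pM2l ?invr_gt0 //.
  apply: le_trans (_ : 4 / gamma * expR (gamma / 4 * (x + 1)) * expR (- (gamma / 2) * x) <= _).
    apply: ler_wpM2r; first exact: expR_ge0.
    have := expR_ge1Dx (gamma / 4 * (x + 1)) => h.
    have -> : x + 1 = 4 / gamma * (gamma / 4 * (x + 1)) by field; rewrite gt_eqF.
    apply: ler_wpM2l; first by rewrite divr_ge0 // ltW.
    have -> : gamma / 4 * (4 / gamma * (gamma / 4 * (x + 1))) = gamma / 4 * (x + 1).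
      by field; rewrite gt_eqF.
    lra.
  rewrite -!mulrA; apply: ler_wpM2l => //; apply: ler_wpM2l; first by rewrite invr_ge0 ltW.
  rewrite -!expRD ler_expR; have := ler_wpM2l (ltW gamma0) kx; lra.
rewrite le_eqVlt; apply/orP; left; apply/eqP; congr (_ * _ ^+ _).
have -> : 5 + 2 * 1 * (1 - Delta - beta1 + gamma / 2) = 5 + 3 * gamma by field.
by rewrite /Q; field; rewrite !gt_eqF.
Qed.

(** At the critical value the position of a top vertex matters only up to [expR (eps * L)], so a
    reference set of order [M1 * n / L] wins by its number of parent choices. [M1_big] turns the
    accumulated constants into [expR (- 2) / (M + 1)] per vertex. *)
Lemma at_prob (F : depth_fun V -> {ffun V -> V} -> bool) (E : pred {set V}) (m Q : R) :
  0 <= Q ->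
  (forall h p, F h p -> E (top r G D h) /\ m <= marks r G D (w1 betac) w2 h p) ->
  (forall X : {set V}, X \subset A -> E X ->
     (#|X|%:R * L / n + 1) * expR (eps * (#|X|%:R * L / n)) <= Q) ->
  \sum_(T | `[< spanning_tree r G T >] && F (depth r T) (parent_fun r T))
    gibbs r (betac * L) G T <=
  expR (- m) * (expR (- 2) * expR (2 * M1 * eps) * (Q / (M + 1))) ^+ #|V|.
Proof.
move=> Q0 hF hQ.
have bc0 : 0 < betac by have := gamma0; have := beta10; lra.
have bcL : 4 * L <= expR (betac * L / 2).
  apply: le_trans beta1L _; rewrite ler_expR ler_pM2r // ler_pM2r //; have := gamma0; lra.
have gap0 : 0 <= 1 - Delta - betac + eps by have := eps0; lra.
have Lc1' : L <= c1 * M1 * ell.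
  apply: le_trans Lc1 _; apply: ler_wpM2r => //; by rewrite ler_peMr // ltW.
have Q'0 : 0 <= L^-1 * Q by rewrite mulr_ge0 ?invr_ge0 // ltW.
have h := @phase_prob betac eps M1 bc0 bcL M1_ge1 c1M1 Lc1' gap0 core_deg
  A' A'A A'_card A'_deg F E m (L^-1 * Q) hF Q'0 _.
apply: le_trans (h _) _ => {h}.
  move=> X XA EX; have -> : betac + Delta + eps - 1 = eps by ring.
  rewrite powE; apply: lerXn2r; rewrite ?nnegrE //.
    by rewrite mulr_ge0 ?invr_ge0 ?(ltW L0) // mulr_ge0 ?expR_ge0 // addr_ge0 // divr_ge0 ?mulr_ge0 // ltW.
  by rewrite ler_pM2l ?invr_gt0 // hQ.
apply: ler_wpM2l; first exact: expR_ge0.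
have M1p : 0 < M + 1 by rewrite addr_gt0.
have e0 : 0 <= expR (2 * M1 * eps) :> R by exact: expR_ge0.
apply: lerXn2r; rewrite ?nnegrE.
- by rewrite !mulr_ge0 ?expR_ge0 ?invr_ge0 // ?mulr_ge0 // ltW.
- by rewrite !mulr_ge0 ?expR_ge0 ?invr_ge0 // ltW.
have -> : 5 + 2 * M1 * (1 - Delta - betac + eps) = 5 + 2 * M1 * eps by ring.
rewrite expRD.
have -> : 2 * (expR 5 * expR (2 * M1 * eps)) * K * (L / (c1 * M1)) * (L^-1 * Q) =
  2 * expR 5 * K * (c1 * M1)^-1 * (expR (2 * M1 * eps) * Q).
  by field; rewrite !gt_eqF.
have -> : expR (-2) * expR (2 * M1 * eps) * (Q / (M + 1)) =
  expR (- 2) / (M + 1) * (expR (2 * M1 * eps) * Q) by field; rewrite gt_eqF.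
apply: ler_wpM2r; first by rewrite mulr_ge0.
rewrite ler_pdivrMr ?mulr_gt0 // expRN.
have -> : (expR 2)^-1 / (M + 1) * (c1 * M1) = c1 * M1 / (expR 2 * (M + 1)).
  by field; rewrite !gt_eqF ?expR_gt0.
rewrite ler_pdivlMr ?mulr_gt0 ?expR_gt0 //.
apply: le_trans M1_big; rewrite (_ : 7 = 5 + 2) ?expRD; last by ring.
by rewrite le_eqVlt; apply/orP; left; apply/eqP; ring.
Qed.

Lemma low_beta_prob :
  \sum_(T | `[< spanning_tree r G T >] &&
     ~~ ((#|top r G D (depth r T)|%:R <= K' * (n / L)) &&
         (#|misplaced r G D (depth r T) (parent_fun r T)|%:R <= n / 10)))
    gibbs r (beta1 * L) G T <= 2 * expR (- n).
Proof.
(* A top set that is too large is excluded with [k = K'] and no marks; misplaced vertices are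
   excluded with [k = 0] and the marks. *)
have ma := @below_prob (fun h _ => K' * (n / L) < #|top r G D h|%:R) K' 0 K'0.
have mb := @below_prob (fun h p => n / 10 < #|misplaced r G D h p|%:R) 0 (n / 10 * w2) (lexx 0).
have B10 : 0 <= B1.
  rewrite !mulr_ge0 ?expR_ge0 ?invr_ge0 //; exact: ltW.
have h1 : expR (- 0) * (B1 * expR (- (gamma * K' / 4))) ^+ #|V| <= expR (- n).
  rewrite oppr0 expR0 mul1r (_ : - n = n * (-1)); last by ring.
  rewrite -expX; apply: lerXn2r; rewrite ?nnegrE; [exact: mulr_ge0 B10 (expR_ge0 _)|exact: expR_ge0|].
  exact: mul_expRN_le.
have h2 : expR (- (n / 10 * w2)) * (B1 * expR (- (gamma * 0 / 4))) ^+ #|V| <= expR (- n).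
  rewrite mulr0 mul0r oppr0 expR0 mulr1.
  rewrite (_ : - (n / 10 * w2) = n * (- (w2 / 10))); last by field.
  rewrite -expX -exprMn (_ : - n = n * (-1)); last by ring.
  rewrite -expX; apply: lerXn2r; rewrite ?nnegrE; [exact: mulr_ge0 (expR_ge0 _) B10|exact: expR_ge0|].
  by rewrite mulrC; apply: mul_expRN_le.
rewrite (_ : 2 * expR (- n) = expR (- n) + expR (- n)); last by ring.
apply: le_trans (lerD (le_trans (ma _) h1) (le_trans (mb _) h2)).
- rewrite big_mkcond [X in _ <= X + _]big_mkcond [X in _ <= _ + X]big_mkcond -big_split /=.
  apply: ler_sum => T _; case: `[< spanning_tree r G T >] => /=; last by rewrite addr0.
  have : 0 <= gibbs r (beta1 * L) G T by apply: gibbs_ge0.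
  rewrite negb_and -!ltNge; case: ltP => _; case: ltP => _ /=; lra.
- move=> h p hp; split; first exact: ltW.
  apply: le_trans (@marks_ge_deeper R V r G D D0 DV _ _ h p w20 (le_trans w20 w21)).
  by rewrite mulr_ge0 // (le_trans w20 w21).
- move=> h p hp; split; first by rewrite mul0r.
  have w2w1 : 0 <= w2 <= w1 beta1 by rewrite w20 w21.
  apply: le_trans (@marks_ge_misplaced R V r G D D0 DV _ _ h p w2w1).
  by apply: ler_wpM2r => //; apply: ltW.
Qed.

(** Apart from trees with a small top set or with many deep vertices, the top set is large enough
    for [hits_prob_le]. *)
Lemma critical_beta_prob :
  \sum_(T | `[< spanning_tree r G T >] &&
     [exists S in powerset A, (#|S|%:R <= K' * (n / L)) &&
        (#|V|%:R / 2 <= #|hits r G S (parent_fun r T)|%:R :> R)])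
    gibbs r (betac * L) G T <= 3 * expR (- (n / 10)).
Proof.
have bc1 : beta1 <= betac by have := gamma0; lra.
have w1c : w1 beta1 <= w1 betac.
  by rewrite ler_pM2r // ler_pM2r.
have w1c0 : 0 <= w1 betac by apply: le_trans w1c; apply: le_trans w21.
have Mp : 0 < M + 1 by rewrite addr_gt0.
have ma := @at_prob (fun h _ => #|top r G D h|%:R < M * (n / L))
  (fun X => #|X|%:R < M * (n / L)) 0 ((M + 1) * expR (eps * M)).
(* The top set is unconstrained here, so the factor can be as large as [2 * L * expR (eps * L)]. The
   tilt [w1], linear in [L], beats it, whereas [w2] is only logarithmic in [L]; therefore deep
   vertices are counted and not all misplaced ones. *)
have mb := @at_prob (fun h p => n / 10 < #|deeper r G D h|%:R)
  predT (n / 10 * w1 betac) (2 * L * expR (eps * L)).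
have c1n0 : 0 < c1 * ell / n by rewrite divr_gt0 // mulr_gt0.
have MnL : 0 < M * (n / L) by rewrite mulr_gt0.
have mc := @hits_prob_le R V r G Gsub D K ell (betac * L) (K' * (n / L)) (M * (n / L))
  (c1 * ell / n) (n / 10) (2 * exceptional) deg c1n0 MnL.
have h1 : expR (- 0) * (expR (-2) * expR (2 * M1 * eps) * ((M + 1) * expR (eps * M) / (M + 1))) ^+ #|V|
    <= expR (- n).
  rewrite oppr0 expR0 mul1r (_ : - n = n * (-1)); last by ring.
  rewrite -expX [(M + 1) * _]mulrC mulfK ?gt_eqF // -!expRD.
  apply: lerXn2r; rewrite ?nnegrE ?expR_ge0 // ler_expR.
  by move: eps_M; rewrite mulrDr; lra.
have h2 : expR (- (n / 10 * w1 betac)) *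
    (expR (-2) * expR (2 * M1 * eps) * (2 * L * expR (eps * L) / (M + 1))) ^+ #|V| <= expR (- n).
  rewrite (_ : - (n / 10 * w1 betac) = n * (- (betac * L / 20))); last by field.
  rewrite -expX -exprMn (_ : - n = n * (-1)); last by ring.
  have LL : 0 <= 2 * L * expR (eps * L) / (M + 1).
    by rewrite !mulr_ge0 ?expR_ge0 ?invr_ge0 // ltW.
  rewrite -expX; apply: lerXn2r; rewrite ?nnegrE; [|exact: expR_ge0|].
    by apply: mulr_ge0; [exact: expR_ge0|apply: mulr_ge0 => //; rewrite mulr_ge0 ?expR_ge0].
  rewrite mulrC; apply: mul_expRN_le.
  apply: le_trans (_ : (1 * (2 * L * expR (eps * L))) * expR 1 <= _).
    apply: ler_wpM2r; first exact: expR_ge0.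
    apply: ler_pM => //.
      rewrite -expRD expR_le1; have := mulr_gt0 eps0 M0; move: eps_M; rewrite mulrDr; lra.
    rewrite ler_pdivrMr // ler_peMr ?mulr_ge0 ?expR_ge0 ?(ltW L0) //; have := M0; lra.
  apply: le_trans (_ : expR (betac * L / 40) * expR (eps * L) <= _).
    by rewrite mul1r mulrAC; apply: ler_wpM2r; rewrite ?expR_ge0 // mulrAC.
  rewrite -expRD ler_expR; have := ler_wpM2r (ltW L0) eps_beta; lra.
have h3 : expR (100 * (K' * (n / L)) + #|V|%:R / 100) *
    expR (K * ell * (K' * (n / L)) / (c1 * ell / n * (M * (n / L))) + (2 * exceptional)%:R +
       n / 10 / 2 - #|V|%:R / 4) <= expR (- (n / 10)).
  rewrite -expRD ler_expR -nE natrM.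
  have -> : K * ell * (K' * (n / L)) / (c1 * ell / n * (M * (n / L))) = n * (K * K' / (c1 * M)).
    by field; rewrite !gt_eqF.
  have t1 : n * (K * K' / (c1 * M)) <= n * (1 / 100).
    rewrite ler_pM2l // ler_pdivrMr ?mulr_gt0 //; have := KK'; lra.
  have t2 : K' * (n / L) <= n / 2000.
    rewrite mulrA ler_pdivrMr //; have := ler_wpM2l (ltW n0) K'L; lra.
  have t3 : exceptional%:R <= n / 192.
    rewrite -(ler_pM2r L0); apply: le_trans exceptional_L _.
    have := ler_wpM2l (ltW n0) L24; lra.
  have := n0; lra.
have nn : expR (- n) <= expR (- (n / 10)) by rewrite ler_expR; have := n0; lra.
apply: le_trans (_ : expR (- n) + expR (- n) + expR (- (n / 10)) <= _); last by lra.
apply: le_trans (lerD (lerD (le_trans (ma _ _ _) h1) (le_trans (mb _ _ _) h2)) (le_trans (mc _ _) h3)).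
- rewrite big_mkcond [X in _ <= X + _ + _]big_mkcond [X in _ <= _ + X + _]big_mkcond.
  rewrite [X in _ <= _ + _ + X]big_mkcond -!big_split /=.
  apply: ler_sum => T _; case: `[< spanning_tree r G T >] => /=; last by rewrite !addr0.
  have gT : 0 <= gibbs r (betac * L) G T by apply: gibbs_ge0.
  by case: ltP => _; case: ltP => _ /=; case: ifP => _; rewrite ?addr0 ?add0r ?lerDl ?addr_ge0.
- by rewrite mulr_ge0 ?expR_ge0 // ltW.
- move=> h p hp; split => //.
  apply: le_trans (@marks_ge_deeper R V r G D D0 DV _ _ h p w20 w1c0).
  by rewrite mulr_ge0.
- move=> X XA XM.
  have x0 : 0 <= #|X|%:R * L / n by rewrite !mulr_ge0 ?invr_ge0 // ltW.
  have xM : #|X|%:R * L / n <= M.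
    rewrite ler_pdivrMr // -ler_pdivlMr // ltW //; by rewrite -mulrA.
  apply: ler_pM; rewrite ?expR_ge0 ?addr_ge0 ?lerD2r // ler_expR.
  by apply: ler_wpM2l => //; apply: ltW.
- by rewrite !mulr_ge0 ?expR_ge0 // ltW.
- move=> h p hp; split => //.
  apply: le_trans (@marks_ge_deeper R V r G D D0 DV _ _ h p w20 w1c0).
  by apply: ler_wpM2r => //; apply: ltW.
- move=> X XA _.
  have x0 : 0 <= #|X|%:R * L / n by rewrite !mulr_ge0 ?invr_ge0 // ltW.
  have xL : #|X|%:R * L / n <= L.
    by rewrite ler_pdivrMr // mulrC ler_pM2l // nE ler_nat max_card.
  apply: ler_pM; rewrite ?expR_ge0 ?addr_ge0 //; last first.
    by rewrite ler_expR; apply: ler_wpM2l => //; apply: ltW.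
  by have := L24; lra.
- move=> X _ XM; apply: leq_trans (_ : exceptional <= _)%N; last by rewrite mul2n -addnn leq_addr.
  apply: le_exceptional; apply: le_trans (regular _) _; last by have := nL2; lra.
  by apply: le_trans XM; rewrite ler_peMl // ltW.
- exact: off_band_le.
Qed.

(** The band misses at most [n / 96] vertices, so the parents differ at [35 / 100 * n] vertices or
    more with probability at least [3 / 4] under any coupling, and the product exceeds [n / 4]. *)
Lemma phase_wasserstein :
  n / 4 <= wasserstein1 (fun T T' => (tree_dist r T T')%:R)
    (gibbs r (beta1 * L) G) (gibbs r (betac * L) G).
Proof.
have t2 : K' * (n / L) <= n / 2000.
  rewrite mulrA ler_pdivrMr //; have := ler_wpM2l (ltW n0) K'L; lra.
have t3 : exceptional%:R <= n / 192.
  rewrite -(ler_pM2r L0); apply: le_trans exceptional_L _.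
  have := ler_wpM2l (ltW n0) L24; lra.
have hb : n <= #|band|%:R + 2 * exceptional%:R.
  have := off_band_le setT; rewrite -(ler_nat R) natrM.
  have : #|[set: V]|%:R = #|band|%:R + #|setT :\: band|%:R :> R.
    by rewrite -natrD -{1}(setTI band) cardsID.
  by rewrite cardsT -nE; lra.
have hc : 0 <= 35 / 100 * n <= #|band|%:R - K' * (n / L) - n / 10 - #|V|%:R / 2.
  by rewrite -nE; have := n0; lra.
have := @wasserstein_gibbs_ge R V r G Gsub D D0 DV _ _ _ _ _ _ _
  low_beta_prob critical_beta_prob hc.
apply: le_trans.
have nn : expR (- n) <= expR (- (n / 10)) by rewrite ler_expR; have := n0; lra.
have : 3 / 4 <= 1 - 2 * expR (- n) - 3 * expR (- (n / 10)) by have := nbig; lra.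
have n35 : 0 <= 35 / 100 * n by have := n0; lra.
by move=> /(ler_wpM2l n35); have := n0; lra.
Qed.

End Gap.
End Phase.

(** * Continuous transition *)

(** [1 - z] is at most [(1 - z / 2) ^+ 2 * (1 - z ^+ 2 / 4)], and the first order bound on the
    exponential is applied to each factor. *)
Lemma one_minus_le_expR (R : realType) (z : R) : 0 <= z <= 1 ->
  1 - z <= expR (- (z + z ^+ 2 / 4)).
Proof.
move=> /andP[z0 z1].
have h1 : (1 - z / 2) ^+ 2 <= expR (- z).
  have -> : expR (- z) = expR (- (z / 2)) ^+ 2 by rewrite -expRM_natl; congr expR; field.
  have := expR_ge1Dx (- (z / 2)) => h.
  by apply: lerXn2r; rewrite ?nnegrE ?expR_ge0 //; lra.
have h2 : 1 - z ^+ 2 / 4 <= expR (- (z ^+ 2 / 4)) by have := expR_ge1Dx (- (z ^+ 2 / 4)); lra.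
have z2 : z ^+ 2 <= 1 by rewrite expr_le1.
rewrite opprD expRD; apply: le_trans (ler_pM _ _ h1 h2); [|exact: sqr_ge0|lra].
have -> : (1 - z / 2) ^+ 2 * (1 - z ^+ 2 / 4) =
  1 - z + z ^+ 2 * (z * (1 - z / 4) / 4) by field.
rewrite lerDl mulr_ge0 ?sqr_ge0 // divr_ge0 // mulr_ge0 //; lra.
Qed.

Section Continuous.
Variables (R : realType) (V : finType) (r : V) (G : graph V).
Hypothesis Gsub : G \subset all_edges V.
Variables (D : nat) (B : {set V}) (K L beta nlow n e tau g : R).
Hypotheses (D0 : (0 < D)%N) (DV : (D.+1 < #|V|)%N) (BD : B \subset layer r G D.+1) (nE : n = #|V|%:R).
Local Notation A := (layer r G D).
Local Notation nonroot := (nonroot r G).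
Local Notation late := (late D B).
Local Notation top := (top r G D).
Local Notation deficitB := (@deficit R V r G D B).
Local Notation tail := (expR (beta * L / 2) * (K * expR L / nlow) * expR (- (beta * L))).
Hypotheses (K1 : 1 <= K) (L0 : 0 <= L) (b2 : expR (- (beta * L)) <= 1 / 2)
  (nlow0 : 0 < nlow).
Hypothesis deg : forall v, #|nbrs G [set: V] v|%:R <= K * expR L.
Hypothesis B_deg : forall v, v \in B -> nlow <= #|nbrs G A v|%:R.
Hypotheses (B_big : #|~: B|%:R <= e * n)
  (outer : #|nonroot :\: (B :|: A)|%:R * (ln (2 * K) + L) <= e * n)
  (A_small : #|A|%:R <= e * n) (tail_small : 2 * tail <= e).
(** The left side bounds the gain in the exponent when the vertices of [A :\: X] leave depth [D];
    the deficit measures the parent choices that are lost in exchange. The two balance to first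
    order, with [g] recording the excess. *)
Hypothesis push : forall X : {set V}, X \subset A ->
  #|A :\: X|%:R * (ln (2 * K) + (1 - beta) * L) <= (1 + g + e) * deficitB X + e * n.
Hypotheses (e0 : 0 < e) (tau01 : 0 < tau <= 1) (e_tau : e <= tau ^+ 2 / 48) (g0 : 0 <= g)
  (late_big : g + 2 <= tau * (beta * L / 2)).

Let n0 : 0 < n. Proof. by rewrite nE ltr0n (leq_ltn_trans _ DV). Qed.
Let tau0 : 0 < tau. Proof. by case/andP: tau01. Qed.
Let tau1 : tau <= 1. Proof. by case/andP: tau01. Qed.
Let etau : e <= tau / 48.
Proof.
apply: le_trans e_tau _; rewrite ler_pM2r ?invr_gt0 // expr2 ler_piMl //; exact: ltW.
Qed.
Let K0 : 0 < K. Proof. exact: lt_le_trans K1. Qed.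
Let tail0 : 0 < tail.
Proof. by rewrite !mulr_gt0 ?expR_gt0 ?invr_gt0. Qed.
Let NA0 v : v \in B -> 0 < #|nbrs G A v|%:R :> R.
Proof. by move=> vB; apply: lt_le_trans (B_deg vB). Qed.

Let frac01 (X : {set V}) v : X \subset A -> v \in B ->
  0 <= (#|nbrs G X v|%:R / #|nbrs G A v|%:R : R) <= 1.
Proof.
move=> XA vB; rewrite divr_ge0 //= ler_pdivrMr ?NA0 // mul1r ler_nat.
apply: subset_leq_card; apply/subsetP => u; rewrite !inE => /andP[/(subsetP XA) + ->].
by rewrite inE => ->.
Qed.

Lemma deficit_le (X : {set V}) : X \subset A -> deficitB X <= #|B|%:R.
Proof.
move=> XA; rewrite -sum1_card natr_sum; apply: ler_sum => v vB.
by rewrite gerBl; case/andP: (frac01 XA vB).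
Qed.

Let Bn : #|B|%:R <= n. Proof. by rewrite nE ler_nat max_card. Qed.

Let share (X : {set V}) v : R := #|nbrs G X v|%:R / #|nbrs G A v|%:R + 2 * tail.

Let share_ge0 X v : 0 <= share X v.
Proof. by rewrite addr_ge0 ?divr_ge0 // mulr_ge0 // ltW. Qed.

Let sum_share X : \sum_(v in B) share X v = #|B|%:R - deficitB X + #|B|%:R * (2 * tail).
Proof.
rewrite big_split /= sumr_const -[(2 * tail) *+ _]mulr_natl; congr (_ + _).
by rewrite /deficit sumrB sumr_const opprB addrCA subrr addr0.
Qed.

(** First order bound, with comparison value [1] at every vertex of [B]. *)
Lemma prod_share_le (X : {set V}) :
  \prod_(v in B) share X v <= expR (e * n - deficitB X).
Proof.
apply: le_trans (prod_le_expR ltr01 (fun v _ => share_ge0 X v)) _.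
rewrite expr1n mul1r ler_expR -mulr_suml divr1 sum_share.
have := ler_pM (ler0n R #|B|) (ltW (mulr_gt0 (ltr0Sn R 1) tail0)) Bn tail_small; lra.
Qed.

(* Second order gain over [prod_share_le]; it is what forces a small deficit. *)
Lemma prod_share_le2 (X : {set V}) (d : R) : X \subset A -> e <= d -> d * n = deficitB X ->
  \prod_(v in B) share X v <= expR (- (((d - e) + (d - e) ^+ 2 / 4) * n)).
Proof.
move=> XA ed dn.
have dn0 : 0 < deficitB X by rewrite -dn mulr_gt0 // (lt_le_trans e0).
have B0 : 0 < #|B|%:R :> R by apply: lt_le_trans dn0 (deficit_le XA).
pose z := deficitB X / #|B|%:R - 2 * tail.
have z1 : 1 - z = #|B|%:R^-1 * (#|B|%:R - deficitB X + #|B|%:R * (2 * tail)).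
  by rewrite /z; move: (tail : R) => t; field; rewrite gt_eqF.
have zpos : 0 < 1 - z.
  have : deficitB X / #|B|%:R <= 1 by rewrite ler_pdivrMr // mul1r deficit_le.
  by rewrite /z; have := tail0; lra.
have dz : d - e <= z.
  have : d <= deficitB X / #|B|%:R.
    rewrite -dn ler_pdivlMr //; apply: ler_wpM2l Bn; exact: le_trans (ltW e0) ed.
  by rewrite /z; have := tail_small; lra.
have de0 : 0 <= d - e by rewrite subr_ge0.
have z0 : 0 <= z by apply: le_trans dz.
have Bz : (d - e) * n <= #|B|%:R * z.
  have -> : #|B|%:R * z = deficitB X - #|B|%:R * (2 * tail).
    by rewrite /z; move: (tail : R) => t; field; rewrite gt_eqF.
  have := ler_pM (ler0n R #|B|) (ltW (mulr_gt0 (ltr0Sn R 1) tail0)) Bn tail_small.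
  by rewrite mulrBl dn; lra.
apply: le_trans (prod_le_expR zpos (fun v _ => share_ge0 X v)) _.
have -> : \sum_(i in B) share X i / (1 - z) - #|B|%:R = 0.
  rewrite -mulr_suml sum_share.
  have -> : #|B|%:R - deficitB X + #|B|%:R * (2 * tail) = #|B|%:R * (1 - z).
    by rewrite z1 mulVKf // gt_eqF.
  by rewrite mulfK ?subrr // gt_eqF.
rewrite expR0 mulr1.
have zle : 1 - z <= expR (- (z + z ^+ 2 / 4)) by apply: one_minus_le_expR; lra.
apply: le_trans (_ : expR (- (z + z ^+ 2 / 4)) ^+ #|B| <= _).
  by apply: lerXn2r; rewrite ?nnegrE ?expR_ge0 // ltW.
rewrite -expRM_natl ler_expR.
have : (d - e) * n * (d - e) <= #|B|%:R * z * z.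
  by apply: ler_pM => //; rewrite mulr_ge0 // ltW.
by rewrite !expr2; lra.
Qed.

Local Notation ratioB := (ratio r G D B K (expR L) (beta * L) (beta * L / 2) nlow).

Let ratio_ge0 X v : 0 <= ratioB X v.
Proof.
rewrite /ratio; case: ifP => _; first exact: share_ge0.
have KL : 0 <= K * expR L by rewrite mulr_ge0 ?expR_ge0 // ltW.
case: ifP => _; last exact: mulr_ge0.
by case: ifP => _ //; rewrite mulr_ge0 // mulr_ge0 ?expR_ge0.
Qed.

Lemma prod_ratio_le (X : {set V}) : X \subset A ->
  \prod_(v in nonroot) ratioB X v <=
  expR (2 * (e * n) + (1 + g + e) * deficitB X) * \prod_(v in B) share X v.
Proof.
move=> XA.
have Bnr : B \subset nonroot by apply: B_nonroot BD.
have AB : [disjoint A & B].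
  rewrite -setI_eq0; apply/eqP/setP => v; rewrite in_set0 in_setI.
  by apply/negP => /andP[]; rewrite inE => /eqP dv /(subsetP BD); rewrite inE dv eqn_leq ltnn andbF.
have K2 : 0 < 2 * (K * expR L) by rewrite !mulr_gt0 ?expR_gt0.
have K2E : 2 * (K * expR L) = expR (ln (2 * K) + L).
  by rewrite expRD lnK ?posrE ?mulr_gt0 // mulrA.
rewrite (big_setID B) /= (setIidPr Bnr) mulrC; apply: ler_pM.
- by apply: prodr_ge0 => v _; apply: ratio_ge0.
- by apply: prodr_ge0 => v _; apply: ratio_ge0.
- rewrite (big_setID A) /= mulrC (_ : 2 * (e * n) + (1 + g + e) * deficitB X =
     e * n + ((1 + g + e) * deficitB X + e * n)); last by ring.
  rewrite expRD; apply: ler_pM.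
  + by apply: prodr_ge0 => v _; apply: ratio_ge0.
  + by apply: prodr_ge0 => v _; apply: ratio_ge0.
  + rewrite (eq_bigr (fun=> 2 * (K * expR L))) => [|v]; last first.
      by rewrite /ratio !in_setD => /andP[/negPf -> /andP[/negPf ->]].
    by rewrite prodr_const setDDl K2E -expRM_natl ler_expR.
  apply: le_trans (_ : expR (#|A :\: X|%:R * (ln (2 * K) + (1 - beta) * L)) <= _); last first.
    by rewrite ler_expR push.
  have -> : (nonroot :\: B) :&: A = A.
    apply/setP => v; rewrite in_setI in_setD; case: (boolP (v \in A)) => vA; rewrite ?andbF //.
    rewrite !andbT (subsetP (layer_nonroot r G _) v vA) ?D0 ?(ltnW DV) // andbT.
    by rewrite (disjointFr AB vA).
  rewrite (big_setID X) /= (setIidPr XA) [X in X * _]big1 ?mul1r => [|v vX]; last first.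
    have vA := subsetP XA v vX.
    by rewrite /ratio (disjointFr AB vA) vA vX.
  rewrite (eq_bigr (fun=> expR (ln (2 * K) + (1 - beta) * L))) => [|v]; last first.
    rewrite in_setD => /andP[/negPf vX vA].
    rewrite /ratio (disjointFr AB vA) vA vX mulrA mulrA.
    by rewrite [expR (ln _ + _)]expRD lnK ?posrE ?mulr_gt0 // -mulrA -expRD; congr (_ * expR _); ring.
  by rewrite prodr_const -expRM_natl.
- by rewrite le_eqVlt; apply/orP; left; apply/eqP; apply: eq_bigr => v vB; rewrite /ratio vB.
Qed.

Local Notation spanning T := `[< spanning_tree r G T >].

(** Up to errors of order [e], a deficit [d * n] gains [(1 + g) * d] per vertex by [push] and costs
    [d + d ^+ 2 / 4] by the second order bound. The balance [g * d - d ^+ 2 / 4] is negative beyond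
    [4 * g]. *)
Lemma large_deficit_prob :
  \sum_(T | spanning T && ((4 * g + tau) * n < deficitB (top (depth r T)))) gibbs r (beta * L) G T <=
  expR (- (tau ^+ 2 / 8 * n)).
Proof.
pose M := expR ((5 * e - tau ^+ 2 / 4) * n).
apply: le_trans (@gibbs_near_geodesic R V r G Gsub D DV B BD K (expR L) (beta * L)
  (beta * L / 2) nlow deg b2 nlow0 B_deg (fun X => (4 * g + tau) * n < deficitB X)
  (fun h => (4 * g + tau) * n < deficitB (top h)) 0 M _ _ (expR_ge0 _)) _.
- by move=> h hd; split=> //; rewrite mulr_ge0 //; apply: ltW; rewrite -(pmulr_rgt0 _ tau0); have := late_big; have := g0; lra.
- move=> X XA hd; apply: le_trans (prod_ratio_le XA) _.
  pose d := deficitB X / n.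
  have dn : d * n = deficitB X by rewrite divfK // gt_eqF.
  have td : 4 * g + tau <= d by rewrite ler_pdivlMr // ltW.
  have ed : e <= d by have := etau; have := tau0; have := g0; lra.
  have d1 : d <= 1 by rewrite ler_pdivrMr // mul1r (le_trans (deficit_le XA)).
  apply: le_trans (ler_wpM2l (expR_ge0 _) (prod_share_le2 XA ed dn)) _.
  rewrite -expRD ler_expR -dn.
  have -> : 2 * (e * n) + (1 + g + e) * (d * n) + - ((d - e + (d - e) ^+ 2 / 4) * n) =
    (3 * e + (g + e) * d - (d - e) ^+ 2 / 4) * n by ring.
  rewrite ler_pM2r //.
  have h1 : tau * tau <= d * (d - 4 * g).
    by apply: ler_pM; have := tau0; have := g0; lra.
  have h2 : e * d <= e by rewrite ler_piMr // ltW.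
  have h3 : 0 <= e * e by rewrite mulr_ge0 // ltW.
  have -> : 3 * e + (g + e) * d - (d - e) ^+ 2 / 4 =
    3 * e + e * d + e * d / 2 - e * e / 4 - d * (d - 4 * g) / 4 by field.
  by rewrite expr2; have := e0; lra.
rewrite oppr0 expR0 mulr1.
apply: le_trans (_ : expR (e * n) * M <= _).
  apply: ler_wpM2r; first exact: expR_ge0.
  apply: le_trans (_ : expR 1 ^+ #|A| <= _).
    by apply: lerXn2r; rewrite ?nnegrE ?expR_ge0 //; have := expR_ge1Dx (1 : R); lra.
  by rewrite -expRM_natl mulr1 ler_expR.
rewrite -expRD ler_expR -mulrDl (_ : - (tau ^+ 2 / 8 * n) = - (tau ^+ 2 / 8) * n); last by ring.
rewrite ler_pM2r //; have := e_tau; lra.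
Qed.

(** The first order bound is enough: the tilt [beta * L / 2] per late vertex grows with [L], while
    the remaining exponent is of order [n]. *)
Lemma many_late_prob :
  \sum_(T | spanning T && (tau * n < #|late (depth r T)|%:R)) gibbs r (beta * L) G T <=
  expR (- n).
Proof.
have w0 : 0 <= beta * L / 2.
  by apply: ltW; rewrite -(pmulr_rgt0 _ tau0); have := late_big; have := g0; lra.
pose M := expR ((g + 4 * e) * n).
apply: le_trans (@gibbs_near_geodesic R V r G Gsub D DV B BD K (expR L) (beta * L)
  (beta * L / 2) nlow deg b2 nlow0 B_deg predT
  (fun h => tau * n < #|late h|%:R) (tau * n * (beta * L / 2)) M _ _ (expR_ge0 _)) _.
- by move=> h hd; split=> //; apply: ler_wpM2r => //; apply: ltW.
- move=> X XA _; apply: le_trans (prod_ratio_le XA) _.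
  apply: le_trans (ler_wpM2l (expR_ge0 _) (prod_share_le X)) _.
  rewrite -expRD ler_expR.
  have h1 : (g + e) * deficitB X <= (g + e) * n.
    apply: ler_wpM2l; first by rewrite addr_ge0 // ltW.
    exact: le_trans (deficit_le XA) Bn.
  by lra.
apply: le_trans (_ : expR (e * n) * M * expR (- (tau * n * (beta * L / 2))) <= _).
  apply: ler_wpM2r; first exact: expR_ge0.
  apply: ler_wpM2r; first exact: expR_ge0.
  apply: le_trans (_ : expR 1 ^+ #|A| <= _).
    by apply: lerXn2r; rewrite ?nnegrE ?expR_ge0 //; have := expR_ge1Dx (1 : R); lra.
  by rewrite -expRM_natl mulr1 ler_expR.
rewrite -!expRD ler_expR.
have := ler_wpM2r (ltW n0) late_big.
have : e * n <= 1 / 48 * n.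
  by apply: ler_wpM2r; [exact: ltW|have := etau; have := tau1; lra].
by have := n0; rewrite [tau * n * _]mulrAC; lra.
Qed.

(** [3 * tau] collects the margin of the deficit, the late vertices and the complement of [B]; the
    fourth [tau] pays for the two rare events, on which the discrepancy is at most [n]. *)
Lemma expected_discrepancy_le :
  expR (- (tau ^+ 2 / 8 * n)) + expR (- n) <= tau ->
  \sum_T gibbs r (beta * L) G T *
    \sum_(v in nonroot) discrepancy R r G D B (depth r T) v <= (4 * g + 4 * tau) * n.
Proof.
move=> small.
have g1 := gibbs_sum1 r Gsub (beta * L).
apply: le_trans (_ : \sum_T gibbs r (beta * L) G T * ((4 * g + 3 * tau) * n) +
  (\sum_(T | spanning T && ((4 * g + tau) * n < deficitB (top (depth r T)))) gibbs r (beta * L) G T * n +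
   \sum_(T | spanning T && (tau * n < #|late (depth r T)|%:R)) gibbs r (beta * L) G T * n) <= _); last first.
  rewrite -!mulr_suml g1 mul1r -mulrDl.
  have := ler_wpM2r (ltW n0) (le_trans (lerD large_deficit_prob many_late_prob) small).
  by lra.
rewrite [X in _ <= _ + (X + _)]big_mkcond [X in _ <= _ + (_ + X)]big_mkcond -!big_split /=.
apply: ler_sum => T _.
have gT : 0 <= gibbs r (beta * L) G T by apply: gibbs_ge0.
case: (asboolP (spanning_tree r G T)) => sT; last first.
  by rewrite /gibbs; case: asboolP => // _; rewrite !mul0r !addr0.
have ih := inhabited_depth_tree sT; rewrite /=.
have all1 : \sum_(v in nonroot) discrepancy R r G D B (depth r T) v <= n.
  apply: le_trans (_ : \sum_(v in nonroot) 1 <= _).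
    apply: ler_sum => v _; rewrite /discrepancy; by case: ifP => _ //; rewrite gerBl divr_ge0.
  by rewrite sumr_const nE ler_nat max_card.
have tn : 0 <= (4 * g + 3 * tau) * n.
  by apply: mulr_ge0; [have := tau0; have := g0; lra|exact: ltW].
have gn : 0 <= gibbs r (beta * L) G T * n by rewrite mulr_ge0 // ltW.
have gt : 0 <= gibbs r (beta * L) G T * ((4 * g + 3 * tau) * n) by rewrite mulr_ge0.
case: ltP => hd.
  have := ler_wpM2l gT all1; case: ifP => _; lra.
case: ltP => hl; first by have := ler_wpM2l gT all1; lra.
rewrite !addr0; apply: ler_wpM2l => //.
apply: le_trans (sum_discrepancy_le R DV BD ih) _.
have : #|nonroot :\: B|%:R <= e * n.
  by apply: le_trans B_big; rewrite ler_nat; apply: subset_leq_card; apply: subsetDr.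
have : e * n <= tau / 48 * n by apply: ler_wpM2r; [exact: ltW|exact: etau].
by have := mulr_gt0 tau0 n0; lra.
Qed.


End Continuous.

(** * Typical graphs *)

Section GoodGraph.
Variables (R : realType) (V : finType) (r : V) (G : graph V).
Variables (q n md c eps : R) (D : nat).
Hypotheses (nE : n = #|V|%:R) (mdE : md = q * n) (q0 : 0 < q) (D0 : (0 < D)%N)
  (md8 : 8 <= md) (eps01 : 0 < eps <= 1 / 8) (c0 : 0 <= c).
Hypothesis quasi : quasirandom q c eps G.
Hypothesis layers : regular_layers r n md D eps G.
Local Notation A := (layer r G D).
Local Notation core := (core r G D).
Local Notation band := (band r G D).

Let eps0 : 0 < eps. Proof. by case/andP: eps01. Qed.
Let eps8 : eps <= 1 / 8. Proof. by case/andP: eps01. Qed.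
Let n0 : 0 < n. Proof. by rewrite nE ltr0n; apply/card_gt0P; exists r. Qed.
Let md0 : 0 < md. Proof. exact: lt_le_trans md8. Qed.

(** Between [X] and the exceptional set there are too few edges. This contradicts quasirandomness
    unless the pair has at most [c * n] expected edges. *)
Lemma quasirandom_low (X : {set V}) (t : R) : t <= (1 - eps) * (q * #|X|%:R) ->
  #|[set v in ~: X | #|nbrs G X v|%:R < t]|%:R * (q * #|X|%:R) <= c * n.
Proof.
move=> ht; set Y := [set v in _ | _].
have XY : [disjoint X & Y].
  rewrite -setI_eq0; apply/eqP/setP => v; rewrite !inE; case: (v \in X) => //.
rewrite leNgt; apply/negP => lt.
have /andP[lo _] : (1 - eps) * (q * #|X|%:R * #|Y|%:R) <= (edge_count G X Y)%:R <=
    (1 + eps) * (q * #|X|%:R * #|Y|%:R).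
  by apply: (quasi XY); rewrite -nE [leRHS]mulrC ltW.
have Y0 : (0 < #|Y|)%N.
  by rewrite lt0n; apply: contraTneq lt => ->; rewrite mul0r -leNgt mulr_ge0 // ltW.
move: lo; rewrite leNgt => /negP; apply.
apply: lt_le_trans (_ : #|Y|%:R * t <= _); last first.
  have := ler_wpM2l (ler0n R #|Y|) ht; lra.
rewrite /edge_count natr_sum mulr_natl -sumr_const.
have /card_gt0P[v0 v0Y] := Y0.
apply: ltr_sum => [|v]; first by apply/hasP; exists v0; rewrite ?mem_index_enum.
by rewrite inE => /andP[].
Qed.

Lemma quasirandom_high (X : {set V}) (t : R) : (1 + eps) * (q * #|X|%:R) <= t ->
  #|[set v in ~: X | t < #|nbrs G X v|%:R]|%:R * (q * #|X|%:R) <= c * n.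
Proof.
move=> ht; set Y := [set v in _ | _].
have XY : [disjoint X & Y].
  rewrite -setI_eq0; apply/eqP/setP => v; rewrite !inE; case: (v \in X) => //.
rewrite leNgt; apply/negP => lt.
have /andP[_ hi] : (1 - eps) * (q * #|X|%:R * #|Y|%:R) <= (edge_count G X Y)%:R <=
    (1 + eps) * (q * #|X|%:R * #|Y|%:R).
  by apply: (quasi XY); rewrite -nE [leRHS]mulrC ltW.
have Y0 : (0 < #|Y|)%N.
  by rewrite lt0n; apply: contraTneq lt => ->; rewrite mul0r -leNgt mulr_ge0 // ltW.
move: hi; rewrite leNgt => /negP; apply.
apply: le_lt_trans (_ : #|Y|%:R * t < _).
  have := ler_wpM2l (ler0n R #|Y|) ht; lra.
rewrite /edge_count natr_sum mulr_natl -sumr_const.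
have /card_gt0P[v0 v0Y] := Y0.
apply: ltr_sum => [|v]; first by apply/hasP; exists v0; rewrite ?mem_index_enum.
by rewrite inE => /andP[].
Qed.

Lemma core_card_le : #|core|%:R <= 2 * md ^+ D.-1.
Proof.
case: layers => lay _.
have e : core = \bigcup_(k < D) layer r G k.
  apply/setP => v; rewrite inE; apply/idP/bigcupP => [dv|[k _]].
    by exists (Ordinal dv); rewrite ?inE.
  by rewrite inE => /eqP ->.
have hsum : #|core|%:R <= \sum_(k < D) (1 + eps) * md ^+ k.
  apply: le_trans (_ : (\sum_(k < D) #|layer r G k|)%N%:R <= _).
    rewrite ler_nat e; elim/big_rec2 : _ => [|k s S _ IH]; first by rewrite cards0.
    by apply: leq_trans (leq_card_setU _ _).1 _; rewrite leq_add2l.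
  by rewrite natr_sum; apply: ler_sum => k _; case/andP: (lay k (ltn_ord k)).
apply: le_trans hsum _; rewrite -mulr_sumr.
have geo k : \sum_(j < k.+1) md ^+ j <= 8 / 7 * md ^+ k.
  elim: k => [|k IH]; first by rewrite big_ord1 expr0; lra.
  rewrite big_ord_recr /= exprS.
  have : 8 * md ^+ k <= md * md ^+ k by apply: ler_wpM2r => //; rewrite exprn_ge0 // ltW.
  by lra.
have := geo D.-1; rewrite prednK // => h.
have mp : 0 <= md ^+ D.-1 by rewrite exprn_ge0 // ltW.
have s0 : 0 <= \sum_(j < D) md ^+ j by apply: sumr_ge0 => j _; rewrite exprn_ge0 // ltW.
have := ler_wpM2r s0 eps8; lra.
Qed.

Lemma nbrs_core_gt0 v : (D < #|V|)%N -> v \in A -> (0 < #|nbrs G core v|)%N.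
Proof.
rewrite inE => DV /eqP dv; apply/card_gt0P.
have [||u uv hu] := @gdist_pred V G r v D.-1; rewrite ?prednK //.
by exists u; rewrite !inE uv andbT hu prednK.
Qed.

Lemma regular_pairs (L c1 ell : R) (X : {set V}) : 0 < L -> c1 * ell <= (1 - eps) * md ->
  c * L ^+ 3 <= md -> n / L <= #|X|%:R ->
  #|[set v in ~: X | #|nbrs G X v|%:R < c1 * ell / n * #|X|%:R]|%:R <= n / L ^+ 2.
Proof.
move=> L0 hc1 hcL hX.
have h := @quasirandom_low X (c1 * ell / n * #|X|%:R) _.
set Y := [set v in _ | _] in h *.
have {}h : #|Y|%:R * (q * #|X|%:R) <= c * n.
  apply: h; have -> : (1 - eps) * (q * #|X|%:R) = (1 - eps) * md / n * #|X|%:R.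
    by rewrite mdE; field; rewrite gt_eqF.
  by apply: ler_wpM2r => //; apply: ler_wpM2r => //; rewrite invr_ge0 ltW.
have qX : md / L <= q * #|X|%:R.
  by apply: le_trans (ler_wpM2l (ltW q0) hX); rewrite mdE mulrA.
have mdL : 0 < md / L by rewrite divr_gt0.
rewrite -(ler_pM2r mdL); apply: le_trans (ler_wpM2l (ler0n R #|Y|) qX) _.
apply: le_trans h _.
have -> : n / L ^+ 2 * (md / L) = md / L ^+ 3 * n by field; rewrite gt_eqF.
by rewrite ler_pM2r // ler_pdivlMr // exprn_gt0.
Qed.

(** The set [B] of the perturbation argument. Its vertices have nearly equal numbers of geodesic
    parents, which lets edge counts be read as fractions of parents. *)
Definition typical : {set V} := [set v in layer r G D.+1 |
  (1 - eps) * (q * #|A|%:R) <= #|nbrs G A v|%:R <= (1 + eps) * (q * #|A|%:R)].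

(** Outside [core] and [A], a vertex with a neighbour in [A] lies in layer [D.+1], and a vertex
    without one has too few neighbours in [A]. *)
Lemma card_atypical_le : 0 < #|A|%:R :> R ->
  #|~: (typical :|: A)|%:R * (q * #|A|%:R) <= #|core|%:R * (q * #|A|%:R) + 2 * (c * n).
Proof.
move=> A0; have qA : 0 < q * #|A|%:R by rewrite mulr_gt0.
have := quasirandom_low (lexx ((1 - eps) * (q * #|A|%:R))).
have := quasirandom_high (lexx ((1 + eps) * (q * #|A|%:R))).
set hi := [set v in _ | _]; set lo := [set v in _ | _] => hhi hlo.
have sub : ~: (typical :|: A) \subset core :|: (lo :|: hi).
  apply/subsetP => v; rewrite in_setC in_setU negb_or => /andP[vt vA].
  rewrite !in_setU; case: (boolP (v \in core)) => //= vc.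
  rewrite [v \in lo]in_set [v \in hi]in_set in_setC vA /=; case: ltP => //= h1; case: ltP => //= h2.
  case/negP: vt; rewrite in_set h1 h2 !andbT.
  have NA : (0 < #|nbrs G A v|)%N.
    rewrite -(ltr0n R); apply: lt_le_trans h1; apply: mulr_gt0 => //; have := eps8; lra.
  case/card_gt0P: NA => u; rewrite !in_set => /andP[/eqP du uv].
  have := gdist_adj r uv; rewrite du => h.
  move: vA vc; rewrite !inE; move: h; clear; lia.
apply: le_trans (_ : (#|core| + (#|lo| + #|hi|))%:R * (q * #|A|%:R) <= _).
  apply: ler_wpM2r; first exact: ltW.
  rewrite ler_nat; apply: leq_trans (subset_leq_card sub) _.
  apply: leq_trans (leq_card_setU _ _).1 _; rewrite leq_add2l; exact: (leq_card_setU _ _).1.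
by rewrite !natrD !mulrDl; lra.
Qed.

(** A vertex [v] of [B] loses at least the fraction [#|nbrs G (A :\: X) v| / ((1 + eps) * (q *
    #|A|))] of its parents. Summed over [v], quasirandomness of the pair [A :\: X], [B] bounds the
    deficit below by nearly [#|B| * #|A :\: X| / #|A|]. If the pair is too small for
    quasirandomness, the left side is absorbed by [E]. *)
Lemma push_le (X : {set V}) (Lam G1 E : R) : X \subset A -> 0 < #|A|%:R :> R -> 0 < #|typical|%:R :> R ->
  0 <= G1 -> 0 <= E -> (1 + eps) * (#|A|%:R * Lam) <= (1 - eps) * (#|typical|%:R * G1) ->
  c * n * Lam <= q * #|typical|%:R * E ->
  #|A :\: X|%:R * Lam <= G1 * deficit R r G D typical X + E.
Proof.
move=> XA A0 B0 G10 E0 hA hE; set B := typical; set m := #|A :\: X|%:R.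
have qA : 0 < q * #|A|%:R by rewrite mulr_gt0.
have e1 : 0 < 1 - eps by have := eps8; lra.
have e2 : 0 < 1 + eps by have := eps0; lra.
have fracE v : v \in B -> #|nbrs G (A :\: X) v|%:R / ((1 + eps) * (q * #|A|%:R)) <=
    1 - #|nbrs G X v|%:R / #|nbrs G A v|%:R.
  rewrite inE => /andP[_ /andP[h1 h2]].
  have NA : 0 < #|nbrs G A v|%:R :> R by apply: lt_le_trans h1; apply: mulr_gt0.
  have NAE : #|nbrs G A v|%:R = #|nbrs G X v|%:R + #|nbrs G (A :\: X) v|%:R :> R.
    rewrite -natrD -(cardsID X (nbrs G A v)); congr (_ + _)%:R; apply: eq_card => u.
      rewrite !inE; case uX: (u \in X); rewrite ?andbF ?andbT //.
      by have := subsetP XA u uX; rewrite inE => ->.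
    by rewrite !inE andbA.
  move: NA h2; rewrite NAE -natrD.
  move: #|nbrs G X v| #|nbrs G (A :\: X) v| => a b; rewrite natrD => ab0 ab1.
  have -> : 1 - a%:R / (a%:R + b%:R) = b%:R / (a%:R + b%:R) :> R.
    by field; rewrite gt_eqF.
  by apply: ler_wpM2l => //; rewrite lef_pV2 ?posrE // (lt_le_trans ab0).
have d0 : 0 <= deficit R r G D B X.
  apply: sumr_ge0 => v vB; apply: le_trans (fracE v vB).
  by rewrite divr_ge0 // mulr_ge0 // ltW.
have [Lam0|Lam0] := leP Lam 0.
  apply: le_trans (_ : 0 <= _); first by rewrite mulr_ge0_le0.
  by rewrite addr_ge0 // mulr_ge0.
have [big|small] := leP (c * n) (q * m * #|B|%:R); last first.
  apply: le_trans (_ : E <= _); last by rewrite lerDr mulr_ge0.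
  have qB : 0 < q * #|B|%:R by rewrite mulr_gt0.
  rewrite -(ler_pM2l qB); apply: le_trans hE.
  rewrite (_ : q * #|B|%:R * (m * Lam) = q * m * #|B|%:R * Lam); last by ring.
  by apply: ler_wpM2r; apply: ltW.
have dis : [disjoint A :\: X & B].
  rewrite -setI_eq0; apply/eqP/setP => v; rewrite !inE.
  by case: (gdist G r v =P D) => [->|_]; rewrite ?andbF // eqn_leq ltnn !andbF.
rewrite nE in big; have /andP[lo _] := quasi dis big.
apply: le_trans (_ : G1 * deficit R r G D B X <= _); last by rewrite lerDl.
have hd : (edge_count G (A :\: X) B)%:R / ((1 + eps) * (q * #|A|%:R)) <= deficit R r G D B X.
  by rewrite /edge_count natr_sum mulr_suml; apply: ler_sum.
have hd2 : (1 - eps) * (m * #|B|%:R) <= deficit R r G D B X * ((1 + eps) * #|A|%:R).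
  move: hd; rewrite ler_pdivrMr ?mulr_gt0 // => hd.
  have := le_trans lo hd.
  have -> : (1 - eps) * (q * m * #|B|%:R) = q * ((1 - eps) * (m * #|B|%:R)) by ring.
  have -> : deficit R r G D B X * ((1 + eps) * (q * #|A|%:R)) =
    q * (deficit R r G D B X * ((1 + eps) * #|A|%:R)) by ring.
  by rewrite ler_pM2l.
have pB : 0 < (1 - eps) * #|B|%:R by rewrite mulr_gt0.
rewrite -(ler_pM2l pB).
have := ler_wpM2r (ltW Lam0) hd2; have := ler_wpM2l d0 hA.
by rewrite -/B; lra.
Qed.

End GoodGraph.

(** * From typical graphs to the deterministic hypotheses *)

Section GraphToHypotheses.
Variables (R : realType) (V : finType) (r : V) (G : graph V).
Hypothesis Gsub : G \subset all_edges V.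
Variables (q n md c eps L K a1 : R) (D : nat).
Hypotheses (nE : n = #|V|%:R) (mdE : md = q * n) (q0 : 0 < q) (D0 : (0 < D)%N)
  (DV : (D.+1 < #|V|)%N) (md8 : 8 <= md) (eps01 : 0 < eps <= 1 / 8) (c0 : 0 <= c).
Hypotheses (a10 : 0 < a1) (md_ge : a1 * expR L <= md) (K1 : 1 <= K) (L24 : 24 <= L)
  (ln2K : ln (2 * K) <= L) (Ln : L <= n) (core_pow : md ^+ D.-1 <= n / L ^+ 2).
Hypothesis deg : forall v, #|nbrs G [set: V]%SET v|%:R <= K * expR L.
Hypothesis quasi : quasirandom q c eps G.
Hypothesis layers : regular_layers r n md D eps G.
Local Notation A := (layer r G D).
Local Notation core := (core r G D).
Local Notation y := (md ^+ D / n).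

Let n0 : 0 < n. Proof. by rewrite nE ltr0n; apply/card_gt0P; exists r. Qed.
Let md0 : 0 < md. Proof. exact: lt_le_trans md8. Qed.
Let L0 : 0 < L. Proof. exact: lt_le_trans L24. Qed.
Let K0 : 0 < K. Proof. exact: lt_le_trans K1. Qed.
Let y0 : 0 < y. Proof. by rewrite divr_gt0 // exprn_gt0. Qed.
Let eps0 : 0 < eps. Proof. by case/andP: eps01. Qed.
Let eps8 : eps <= 1 / 8. Proof. by case/andP: eps01. Qed.

Lemma core_card_scale : #|core|%:R <= 2 * (n / L ^+ 2).
Proof.
apply: le_trans (core_card_le D0 md8 eps01 layers) _; exact: ler_wpM2l.
Qed.

Lemma layer_card_ge (t : R) : t <= (1 - expR (- y)) * L -> t / 2 * (n / L) <= #|A|%:R.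
Proof.
move=> ht; case: layers => _ /andP[lo _]; apply: le_trans lo.
have hy : 0 <= 1 - expR (- y) by rewrite subr_ge0 expR_le1 oppr_le0 ltW.
apply: le_trans (_ : 1 / 2 * (n * (1 - expR (- y))) <= _); last first.
  by apply: ler_wpM2r; [rewrite mulr_ge0 // ltW|have := eps8; lra].
have -> : t / 2 * (n / L) = 1 / 2 * (n * (t / L)) by field; rewrite gt_eqF.
by rewrite ler_pM2l // ler_pM2l // ler_pdivrMr.
Qed.

Lemma layer_card_le : #|A|%:R <= (1 + eps) * (n * y).
Proof.
case: layers => _ /andP[_ hi]; apply: le_trans hi _.
by rewrite [n * _]mulrC divfK // gt_eqF.
Qed.

Section Discontinuous.
Variables (Delta gamma e M M1 K' : R).
Hypotheses (gamma0 : 0 < gamma) (beta10 : 0 < 1 - Delta - gamma)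
  (beta1L : 4 * L <= expR ((1 - Delta - gamma) * L / 2))
  (M_ge1 : 1 <= M) (M1_ge1 : 1 <= M1) (M1_big : 2 * expR 7 * K * (M + 1) <= a1 / 2 * M1)
  (c1M1 : a1 / 2 * M1 <= L) (Lc1 : L <= a1 / 2 * expR L)
  (e0 : 0 < e) (e_gamma : e <= gamma / 2) (e_M : e * (M + 2 * M1) <= 1)
  (e_beta : e <= (1 - Delta) / 40) (betacL : 2 * expR 1 * L <= expR ((1 - Delta) * L / 40))
  (K'0 : 0 <= K') (KK' : 100 * (K * K') <= a1 / 2 * M) (K'L : 2000 * K' <= L)
  (nbig : expR (- (n / 10)) <= 1 / 20).
Local Notation B1 := (2 * expR (5 + 3 * gamma) * (K / (a1 / 2)) * (4 / gamma * expR (gamma / 4))).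
Hypotheses (B1K' : B1 * expR 1 <= expR (gamma * K' / 4))
  (B1L : B1 * expR 1 <= expR (ln (L / 6) / 10)).
Hypotheses (cL3 : c * L ^+ 3 <= md)
  (growth : 2 * K / a1 * y <= expR ((Delta + e) * L))
  (size : 8 * M1 <= (1 - expR (- y)) * L)
  (supply : Delta = 0 \/ 2 * expR ((Delta - e) * L) <= y /\ c * L <= y).

Let A_big : 4 * M1 * (n / L) <= #|A|%:R.
Proof. rewrite (_ : 4 * M1 = 8 * M1 / 2); [exact: layer_card_ge|by field]. Qed.

Let nL0 : 0 < n / L. Proof. by rewrite divr_gt0. Qed.

Let core_deg : K * expR L * #|core|%:R <= n * expR ((Delta + e) * L).
Proof.
apply: le_trans (_ : n * (2 * K / a1 * y) <= _); last by rewrite ler_pM2l.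
apply: le_trans (_ : K * expR L * (2 * md ^+ D.-1) <= _).
  apply: ler_wpM2l; last exact: (core_card_le D0 md8 eps01 layers).
  by rewrite mulr_ge0 ?expR_ge0 // ltW.
have -> : n * (2 * K / a1 * y) = K * (md / a1) * (2 * md ^+ D.-1).
  by rewrite -[in md ^+ D](prednK D0) exprS; field; rewrite !gt_eqF.
apply: ler_wpM2r; first by rewrite mulr_ge0 // exprn_ge0 // ltW.
by rewrite ler_pM2l // ler_pdivlMr // mulrC.
Qed.

(** If [Delta = 0] the required number of core neighbours is at most [1], and every vertex of layer
    [D] has one. Otherwise a vertex is expected to have about [y] neighbours in layer [D.-1], at
    least twice the requirement, and quasirandomness leaves few vertices that fall short. *)
Let suppliers : exists A' : {set V}, [/\ A' \subset A, 2 * (M1 * (n / L)) <= #|A'|%:R &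
  forall v, v \in A' -> expR ((Delta - e) * L) <= #|nbrs G core v|%:R].
Proof.
case: supply => [De0|[ylow cLy]].
  exists A; split => // [|v vA].
    by apply: le_trans A_big; rewrite mulrA ler_pM2r //; have := M1_ge1; lra.
  rewrite De0 sub0r mulNr; apply: le_trans (_ : 1 <= _).
    by rewrite expR_le1 oppr_le0 mulr_ge0 // ltW.
  by rewrite ler1n; apply: nbrs_core_gt0 vA => //; apply: ltnW.
pose X := layer r G D.-1; pose t := expR ((Delta - e) * L).
pose bad := [set v in ~: X | #|nbrs G X v|%:R < t]%SET.
have XE : (1 - 2 * eps) * md ^+ D.-1 <= #|X|%:R.
  by case: layers => /(_ D.-1); rewrite prednK // => /(_ (leqnn D)) /andP[].
have qX : 3 / 4 * y <= q * #|X|%:R.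
  apply: le_trans (_ : q * ((1 - 2 * eps) * md ^+ D.-1) <= _); last by rewrite ler_pM2l.
  have -> : q * ((1 - 2 * eps) * md ^+ D.-1) = (1 - 2 * eps) * y.
    by rewrite -[in md ^+ D](prednK D0) exprS {2}mdE; field; rewrite gt_eqF.
  by rewrite ler_pM2r //; have := eps8; lra.
have badX : #|bad|%:R * (q * #|X|%:R) <= c * n.
  apply: (quasirandom_low r nE c0 quasi).
  apply: le_trans (_ : (1 - eps) * (3 / 4 * y) <= _); last first.
    by rewrite ler_pM2l //; have := eps8; lra.
  have : 7 / 8 * (3 / 4 * y) <= (1 - eps) * (3 / 4 * y).
    by apply: ler_wpM2r; [rewrite mulr_ge0 // ltW|have := eps8; lra].
  by have := y0; move: ylow; rewrite -/t; lra.
have bad_le : #|bad|%:R <= 2 * (n / L).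
  have y34 : 0 < 3 / 4 * y by rewrite mulr_gt0.
  rewrite -(ler_pM2r y34); apply: le_trans (ler_wpM2l _ qX) (le_trans badX _) => //.
  have -> : 2 * (n / L) * (3 / 4 * y) = n / L * (3 / 2 * y) by field; rewrite !gt_eqF.
  have -> : c * n = n / L * (c * L) by field; rewrite gt_eqF.
  by rewrite ler_pM2l //; have := y0; lra.
exists (A :\: bad); split.
- exact: subsetDl.
- have : #|A|%:R <= #|A :\: bad|%:R + #|bad|%:R :> R.
    by rewrite -natrD ler_nat -(cardsID bad A) addnC leq_add2l subset_leq_card // subsetIr.
  have := ler_wpM2r (ltW nL0) M1_ge1; have := A_big; move: bad_le.
  by move: #|A|%:R #|A :\: bad|%:R #|bad|%:R => *; lra.
move=> v; rewrite in_setD => /andP[vb vA].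
have vX : v \in ~: X.
  rewrite in_setC inE; move: vA; rewrite inE => /eqP ->.
  by rewrite -[X in X == _](prednK D0) eqn_leq ltnn.
move: vb; rewrite in_set vX /= -leNgt => h; apply: le_trans h _.
rewrite ler_nat; apply: subset_leq_card; apply/subsetP => u; rewrite !inE => /andP[/eqP -> ->].
by rewrite prednK // leqnn.
Qed.

Lemma discontinuous_wasserstein :
  n / 4 <= wasserstein1 (fun T T' => (tree_dist r T T')%:R)
    (gibbs r ((1 - Delta - gamma) * L) G) (gibbs r ((1 - Delta) * L) G).
Proof.
have [A' [A'A A'_card A'_deg]] := suppliers.
have c10 : 0 < a1 / 2 by rewrite divr_gt0.
have reg (X : {set V}) : n / L <= #|X|%:R ->
    #|[set v in ~: X | #|nbrs G X v|%:R < a1 / 2 * expR L / n * #|X|%:R]%SET|%:R <= n / L ^+ 2.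
  apply: (regular_pairs r nE mdE q0 md8 c0 quasi L0) => //.
  have : 7 / 8 * md <= (1 - eps) * md by rewrite ler_pM2r //; have := eps8; lra.
  by have := md_ge; have := md0; rewrite mulrAC; lra.
have core3 : #|core|%:R <= 3 * (n / L ^+ 2).
  apply: le_trans core_card_scale _; rewrite ler_pM2r ?divr_gt0 ?exprn_gt0 //; lra.
have layer_ge : n / L <= #|A|%:R.
  apply: le_trans A_big; rewrite ler_peMl ?(ltW nL0) //; have := M1_ge1; lra.
exact: (@phase_wasserstein R V r G Gsub D K L (a1 / 2) Delta n nE D0 DV K1 c10 L24 ln2K Ln deg
  reg core3 layer_ge gamma e M M1 K' gamma0 beta10 beta1L M_ge1 M1_ge1 M1_big c1M1 Lc1 e0 e_gamma e_M
  e_beta betacL K'0 KK' K'L nbig B1K' B1L core_deg A' A'A A'_card A'_deg).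
Qed.

End Discontinuous.

Section ContinuousGood.
Variables (beta e tau g : R).
Local Notation B := (typical r G q eps D).
Local Notation Lam := (ln (2 * K) + (1 - beta) * L).
Hypotheses (beta0 : 0 < beta) (b2 : expR (- (beta * L)) <= 1 / 2)
  (e0 : 0 < e) (eps_e : eps <= e) (tau01 : 0 < tau <= 1) (e_tau : e <= tau ^+ 2 / 48) (g0 : 0 <= g)
  (late_big : g + 2 <= tau * (beta * L / 2))
  (kap1 : 1 <= (1 - expR (- y)) * L)
  (off_small : 2 * y + (2 / L ^+ 2 + 4 * c * L / md) <= eps)
  (outer_small : 2 * L * (2 / L ^+ 2 + 4 * c * L / md) <= e)
  (tail_small : 10 * (K * L) <= e * a1 * expR (beta * L / 2))
  (push_small : (1 + eps) ^+ 2 * (y * Lam) <= (1 - eps) ^+ 2 * (1 + g + e))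
  (push_c : 4 * (c * L) <= md * e)
  (nbig : expR (- (tau ^+ 2 / 8 * n)) + expR (- n) <= tau).

Let A_big : 1 / 2 * (n / L) <= #|A|%:R. Proof. exact: layer_card_ge. Qed.
Let A0 : 0 < #|A|%:R :> R.
Proof. by apply: lt_le_trans A_big; rewrite !mulr_gt0 // invr_gt0. Qed.
Let qA : md / (2 * L) <= q * #|A|%:R.
Proof.
apply: le_trans (ler_wpM2l (ltW q0) A_big); rewrite le_eqVlt; apply/orP; left; apply/eqP.
by rewrite mdE; field; rewrite gt_eqF.
Qed.
Let qA0 : 0 < q * #|A|%:R. Proof. by rewrite mulr_gt0. Qed.

Let off : R := 2 / L ^+ 2 + 4 * c * L / md.

Let off_le : #|~: (B :|: A)|%:R <= off * n.
Proof.
have := card_atypical_le nE q0 eps01 c0 quasi A0.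
rewrite -ler_pdivlMr // mulrDl mulfK ?gt_eqF // => h; apply: le_trans h _.
rewrite /off [leRHS]mulrDl; apply: lerD; first by apply: le_trans core_card_scale _; rewrite mulrA mulrAC.
apply: le_trans (_ : 2 * (c * n) / (md / (2 * L)) <= _).
  apply: ler_wpM2l; first by rewrite !mulr_ge0 // ltW.
  by rewrite lef_pV2 ?posrE // divr_gt0 // mulr_gt0.
by rewrite le_eqVlt; apply/orP; left; apply/eqP; field; rewrite !gt_eqF.
Qed.

Let A_le : #|A|%:R <= 2 * y * n.
Proof.
apply: le_trans layer_card_le _.
have : (1 + eps) * (n * y) <= 2 * (n * y).
  by rewrite ler_pM2r ?(mulr_gt0 n0 y0) //; have := eps8; lra.
by rewrite -mulrA [y * n]mulrC.
Qed.

Let y_le : 2 * y <= eps.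
Proof.
have : 0 <= off by rewrite addr_ge0 // divr_ge0 ?mulr_ge0 ?exprn_ge0 // ltW.
by have := off_small; rewrite -/off; lra.
Qed.

Let B_big : #|~: B|%:R <= eps * n.
Proof.
apply: le_trans (_ : (2 * y + off) * n <= _); last by rewrite ler_pM2r.
rewrite mulrDl; apply: le_trans (lerD A_le off_le).
rewrite -natrD ler_nat; apply: leq_trans (leq_card_setU _ _).1; apply: subset_leq_card.
by apply/subsetP => v; rewrite !(in_setU, in_setC) negb_or => ->; rewrite andTb orbN.
Qed.

Let B_ge : (1 - eps) * n <= #|B|%:R.
Proof.
have : #|B|%:R + #|~: B|%:R = n :> R by rewrite -natrD cardsC nE.
by have := B_big; lra.
Qed.

Lemma continuous_expected_discrepancy :
  \sum_T gibbs r (beta * L) G T *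
    \sum_(v in nonroot r G) discrepancy R r G D B (depth r T) v <= (4 * g + 4 * tau) * n.
Proof.
have e1 : 0 < 1 - eps by have := eps8; lra.
have nlow0 : 0 < (1 - eps) * (q * #|A|%:R) by rewrite mulr_gt0.
have B0 : 0 < #|B|%:R :> R by apply: lt_le_trans B_ge; rewrite mulr_gt0.
have K2 : 0 <= ln (2 * K) by rewrite ln_ge0 //; have := K1; lra.
have BD : B \subset layer r G D.+1 by apply/subsetP => v; rewrite in_set => /andP[].
apply: (@expected_discrepancy_le R V r G Gsub D B K L beta ((1 - eps) * (q * #|A|%:R)) n e tau g) => //.
- by move=> v; rewrite in_set => /andP[_ /andP[]].
- by apply: le_trans B_big _; rewrite ler_pM2r.
- apply: le_trans (_ : off * n * (2 * L) <= _).
    apply: ler_pM => //; first by rewrite addr_ge0 // ltW.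
      apply: le_trans off_le; rewrite ler_nat; apply: subset_leq_card; exact: subsetDr.
    by have := ln2K; lra.
  by rewrite mulrAC ler_pM2r // mulrC.
- by apply: le_trans A_le _; rewrite ler_pM2r //; apply: le_trans y_le eps_e.
- have nlow : a1 * expR L * (2 / 5) / L <= (1 - eps) * (q * #|A|%:R).
    apply: le_trans (_ : 4 / 5 * (md / (2 * L)) <= _); last first.
      apply: ler_pM => //; first by rewrite divr_ge0 ?mulr_ge0 // ltW.
      by have := eps8; lra.
    have -> : 4 / 5 * (md / (2 * L)) = md * (2 / 5) / L by field; rewrite gt_eqF.
    by rewrite ler_pM2r ?invr_gt0 // ler_pM2r.
  have ae : 0 < a1 * expR L * (2 / 5) / L by rewrite !mulr_gt0 ?expR_gt0 ?invr_gt0.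
  apply: le_trans (_ : 2 * (expR (beta * L / 2) * (K * expR L / (a1 * expR L * (2 / 5) / L)) *
      expR (- (beta * L))) <= _).
    apply: ler_wpM2l => //; apply: ler_wpM2r; first exact: expR_ge0.
    apply: ler_wpM2l; first exact: expR_ge0.
    apply: ler_wpM2l; first by rewrite mulr_ge0 ?expR_ge0 // ltW.
    by rewrite lef_pV2 ?posrE.
  have -> : - (beta * L) = - (beta * L / 2) - (beta * L / 2) by field.
  rewrite expRD expRN.
  have E0 := expR_gt0 (beta * L / 2); have EL := expR_gt0 L.
  have -> : 2 * (expR (beta * L / 2) * (K * expR L / (a1 * expR L * (2 / 5) / L)) *
     ((expR (beta * L / 2))^-1 / expR (beta * L / 2))) = 5 * (K * L) / (a1 * expR (beta * L / 2)).
    by field; rewrite !gt_eqF.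
  rewrite ler_pdivrMr ?mulr_gt0 // [leRHS]mulrA; apply: le_trans tail_small.
  by rewrite ler_pM2r ?mulr_gt0 //; lra.
- move=> X XA; apply: (@push_le R V r G q n c eps D nE q0 eps01 quasi X Lam (1 + g + e) (e * n)) => //.
  + by have := g0; have := e0; lra.
  + by rewrite mulr_ge0 // ltW.
  + have ge : 0 <= 1 + g + e by have := g0; have := e0; lra.
    apply: le_trans (_ : (1 - eps) * ((1 - eps) * n * (1 + g + e)) <= _); last first.
      by rewrite ler_pM2l //; apply: ler_wpM2r.
    have [Lam0|Lam0] := leP 0 Lam; last first.
      apply: le_trans (_ : 0 <= _).
        by rewrite mulr_ge0_le0 ?mulr_ge0_le0 ?(ltW Lam0) //; have := eps0; lra.
      by rewrite !mulr_ge0 // ltW.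
    apply: le_trans (_ : (1 + eps) * ((1 + eps) * (n * y) * Lam) <= _).
      apply: ler_wpM2l; first by have := eps0; lra.
      by apply: ler_wpM2r => //; apply: layer_card_le.
    have := ler_wpM2r (ltW n0) push_small; rewrite !expr2.
    have -> : (1 + eps) * (1 + eps) * (y * Lam) * n = (1 + eps) * ((1 + eps) * (n * y) * Lam) by ring.
    by have -> : (1 - eps) * (1 - eps) * (1 + g + e) * n = (1 - eps) * ((1 - eps) * n * (1 + g + e)) by ring.
  have LamL : Lam <= 2 * L.
    by have := mulr_gt0 beta0 L0; have := ln2K; rewrite mulrBl mul1r; lra.
  apply: le_trans (_ : c * n * (2 * L) <= _); first by apply: ler_wpM2l => //; rewrite mulr_ge0 // ltW.
  have qB : md / 2 <= q * #|B|%:R.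
    apply: le_trans (ler_wpM2l (ltW q0) B_ge).
    have -> : q * ((1 - eps) * n) = (1 - eps) * md by rewrite mdE; ring.
    by rewrite mulrC ler_pM2r //; have := eps8; lra.
  apply: le_trans (ler_wpM2r _ qB); last by rewrite mulr_ge0 // ltW.
  have := ler_wpM2l (ltW n0) push_c; lra.
Qed.

End ContinuousGood.
End GraphToHypotheses.

(** * Scales and limits *)

Local Open Scope classical_set_scope.
Local Open Scope ring_scope.

Lemma poly_le_expR (R : realType) (a c : R) (k : nat) : 0 < c ->
  exists x0 : R, forall x, x0 <= x -> a * x ^+ k <= expR (c * x).
Proof.
move=> c0; pose C := (k.+1%:R / c) ^+ k.+1.
have C0 : 0 < C by rewrite exprn_gt0 // divr_gt0.
exists (Num.max 1 (`|a| * C)) => x; rewrite ge_max => /andP[x1 xa].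
have x0 : 0 < x by apply: lt_le_trans x1.
have h : x ^+ k.+1 <= C * expR (c * x).
  have -> : expR (c * x) = expR (c * x / k.+1%:R) ^+ k.+1.
    by rewrite -expRM_natl [in RHS]mulrC divfK // pnatr_eq0.
  rewrite -exprMn; apply: lerXn2r; rewrite ?nnegrE; [exact: ltW| |].
    by rewrite mulr_ge0 ?expR_ge0 // divr_ge0 // ltW.
  have kp : 0 < k.+1%:R :> R by [].
  move: (k.+1%:R : R) kp => kk kp.
  apply: le_trans (ler_wpM2l (ltW (divr_gt0 kp c0)) (_ : c * x / kk <= _)); last first.
    by have := expR_ge1Dx (c * x / kk); lra.
  by rewrite le_eqVlt; apply/orP; left; apply/eqP; field; rewrite !gt_eqF.
rewrite -(ler_pM2l x0); apply: le_trans (_ : `|a| * (C * expR (c * x)) <= _).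
  apply: le_trans (_ : `|a| * x ^+ k.+1 <= _); last exact: ler_wpM2l.
  rewrite exprS mulrCA; apply: ler_wpM2r; last exact: ler_norm.
  by rewrite mulr_ge0 ?exprn_ge0 // ltW.
by rewrite mulrA; apply: ler_wpM2r => //; apply: expR_ge0.
Qed.

(** As [8 <= md], the powers grow so fast that [D.+1] stays below [m]; this keeps the layers in use
    away from the default distance. *)
Lemma exists_power (R : realType) (md x : R) (m : nat) : 8 <= md -> 1 < x -> x <= m%:R ->
  (2 < m)%N -> exists D : nat, [/\ (0 < D)%N, (D.+1 < m)%N & md ^+ D.-1 < x <= md ^+ D].
Proof.
move=> md8 x1 xm m2; have md0 : 0 < md by apply: lt_le_trans md8.
have pow k : 8 ^+ k <= md ^+ k by apply: lerXn2r; rewrite ?nnegrE // ltW.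
have pow' k : (k.+3 <= 8 ^ k.+1)%N.
  by elim: k => // k IH; rewrite expnS; lia.
have ex : exists k, x <= md ^+ k.
  exists m.+1; apply: le_trans xm (le_trans _ (pow _)).
  by rewrite -natrX ler_nat; apply: leq_trans (pow' m); rewrite -addn3 leq_addr.
have [D hD minD] := ex_minnP ex.
have D0 : (0 < D)%N by rewrite lt0n; apply: contraTneq hD => ->; rewrite expr0 -ltNge.
have lt : md ^+ D.-1 < x.
  by rewrite ltNge; apply/negP => /minD; rewrite -ltnS prednK // ltnn.
exists D; split; rewrite ?lt //.
case: D D0 hD lt {minD} => // -[_ _ _ //|d] _ _ /= lt.
apply: leq_trans (_ : (8 ^ d.+1).+1 <= _)%N; first by rewrite ltnS pow'.
rewrite -(ltr_nat R) natrX; exact: le_lt_trans (pow _) (lt_le_trans lt xm).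
Qed.

Lemma expRN_small (R : realType) (eta : R) : 0 < eta ->
  exists t0 : R, forall t, t0 <= t -> expR (- t) <= eta.
Proof.
move=> eta0; exists (- ln eta) => t ht; rewrite -(@lnK _ eta) ?posrE // ler_expR; lra.
Qed.

Lemma le_expR (R : realType) (x : R) : x <= expR x.
Proof. by have := expR_ge1Dx x; lra. Qed.

Section Sequences.
Variables (R : realType) (alpha : nat -> R).
Local Notation N n := (n.+1%:R : R).
Local Notation ell n := (ln (n.+1%:R : R)).
Local Notation L n := (ln (ln (n.+1%:R : R))).

Lemma loglog_ge (c : R) : \forall n \near \oo, c <= L n.
Proof.
exists (Num.truncn (expR (expR c))).+1 => // n /= hn.
have h : expR (expR c) <= n.+1%:R.
  apply/ltW/(lt_le_trans (truncnS_gt _)); rewrite ler_nat; exact: leqW.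
have h1 : expR c <= ell n by rewrite -(expRK (expR c)) ler_ln ?posrE ?expR_gt0.
by rewrite -(expRK c) ler_ln ?posrE ?expR_gt0 // (lt_le_trans (expR_gt0 c)).
Qed.

Lemma near_succ (P : nat -> Prop) : (\forall n \near \oo, P n) -> \forall n \near \oo, P n.+1.
Proof. by move=> [m _ h]; exists m => // n /= mn; apply: h; apply: leqW. Qed.

Hypothesis standing : standing_assumptions alpha.

Lemma alpha_bounds : exists a1 a2 : R, 0 < a1 /\ \forall n \near \oo, a1 <= alpha n.+1 <= a2.
Proof.
case: standing => _ lo hi.
have [a1 a10 h1] : exists2 a1 : R, 0 < a1 & \forall n \near \oo, a1 <= alpha n.
  move: lo; rewrite /limn_einf oppe_gt0 => /ereal_inf_lt[_ [W Woo <-]].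
  case: (ereal_sup _) (@ereal_sup_ubound _ ((fun n => - (alpha n)%:E)%E @` W)) => [s| |] // ub s0.
  - exists (- s); first by rewrite oppr_gt0 -lte_fin.
    apply: filterS Woo => n Wn; have := ub (- (alpha n)%:E)%E; rewrite -EFinN lee_fin lerNl.
    by apply; exists n.
  (* A supremum equal to [-oo] bounds no real number, so this case is contradictory at each index of
     [W] and any value serves as bound. *)
  - exists 1 => //; apply: filterS Woo => n Wn; have := ub (- (alpha n)%:E)%E.
    by rewrite -EFinN leNgt ltNyr => /(_ (ex_intro2 _ _ n Wn erefl)).
have [a2 h2] : exists a2 : R, \forall n \near \oo, alpha n <= a2.
  move: hi => /ereal_inf_lt[_ [W Woo <-]].
  case: (ereal_sup _) (@ereal_sup_ubound _ ((fun n => (alpha n)%:E)%E @` W)) => [s| |] // ub s0.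
  - exists s; apply: filterS Woo => n Wn; have := ub (alpha n)%:E; rewrite lee_fin.
    by apply; exists n.
  - exists 1 => //; apply: filterS Woo => n Wn; have := ub (alpha n)%:E.
    by rewrite leNgt ltNyr => /(_ (ex_intro2 _ _ n Wn erefl)).
exists a1, a2; split => //; apply: (@near_succ (fun n => a1 <= alpha n <= a2)).
by apply: filterS2 h1 h2 => n -> ->.
Qed.

(** Integer powers of a number above [1] are strictly increasing, so two consecutive natural
    exponents around the threshold identify the minimum over all integers, negative ones
    included. *)
Lemma d_star_eq (n D : nat) : 1 < mean_degree alpha n -> (0 < D)%N ->
  mean_degree alpha n ^+ D.-1 < n%:R / ln (ln n%:R) ^+ 2 <= mean_degree alpha n ^+ D ->
  d_star alpha n = D%:Z.
Proof.
move=> md1 D0 /andP[lo hi]; set md := mean_degree alpha n in md1 lo hi.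
have md0 : 0 < md by apply: lt_trans md1.
have inS (d : int) : d_star_set alpha n d -> (D%:Z <= d)%R.
  rewrite /d_star_set /= -/md => h; rewrite leNgt; apply/negP => lt.
  have : md ^ D.-1%:Z < md ^ d by apply: lt_le_trans h.
  by rewrite ltr_eXz2l //; move: lt D0; clear; lia.
apply: xget_unique; first by split.
move=> d [dS dmin]; apply/eqP; rewrite eq_le inS // andbT.
exact: dmin.
Qed.


Lemma mean_degreeE n : mean_degree alpha n.+1 = alpha n.+1 * ell n.
Proof. by rewrite /mean_degree /edge_prob mulrC divfK // pnatr_eq0. Qed.

Lemma mean_degree_edge n : mean_degree alpha n.+1 = edge_prob alpha n.+1 * N n.
Proof. by rewrite /mean_degree mulrC. Qed.

Definition Dn n : nat := `|d_star alpha n.+1|%N.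
(** This is [ln (1 / lambda_n)]: the size that layer [D] would have without saturation, divided by
    the number of vertices. *)
Definition yn n : R := mean_degree alpha n.+1 ^+ Dn n / N n.

(* Every deterministic relation between the scales that holds for all large [n]. *)
Definition scaled (a1 a2 x0 : R) (n : nat) : Prop :=
  [/\ [/\ x0 <= L n, expR (L n) = ell n & expR (ell n) = N n],
      a1 * ell n <= mean_degree alpha n.+1 <= a2 * ell n,
      8 <= mean_degree alpha n.+1 /\ 0 < edge_prob alpha n.+1 <= 1,
      [/\ (0 < Dn n)%N, ((Dn n).+1 < n.+1)%N,
          mean_degree alpha n.+1 ^+ (Dn n).-1 <= N n / L n ^+ 2 & (L n ^+ 2)^-1 <= yn n] &
      [/\ lambda_seq alpha n.+1 = expR (- yn n),
          kappa_seq alpha n.+1 = (1 - expR (- yn n)) * L n &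
          Delta_seq alpha n.+1 * ln (mean_degree alpha n.+1) = ln (yn n)]].

Lemma near_scaled : exists a1 a2 : R, [/\ 0 < a1, a1 <= a2 &
  forall x0, \forall n \near \oo, scaled a1 a2 x0 n].
Proof.
have [a1 [a2 [a10 ha]]] := alpha_bounds.
have a12 : a1 <= a2.
  by case: ha => m _ /(_ m (leqnn m)) /andP[]; apply: le_trans.
exists a1, a2; split=> // x0.
have [x1 h1] := @poly_le_expR R 1 1 2 ltr01.
have [x2 h2] := @poly_le_expR R a2 1 1 ltr01.
near=> n.
have /andP[al ah] : a1 <= alpha n.+1 <= a2 by near: n.
have Lx0 : x0 <= L n by near: n; apply: loglog_ge.
have Lx1 : x1 <= L n by near: n; apply: loglog_ge.
have Lx2 : x2 <= L n by near: n; apply: loglog_ge.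
have L3 : 3 <= L n by near: n; apply: loglog_ge.
have La : 8 / a1 <= L n by near: n; apply: loglog_ge.
have L0 : 0 < L n by apply: lt_le_trans L3.
have ell0 : 0 < ell n.
  by rewrite ltNge; apply/negP => /ln0; move: L0; move=> + h; rewrite h ltxx.
have Ne : expR (ell n) = N n by rewrite lnK // posrE.
have Le : expR (L n) = ell n by rewrite lnK // posrE.
have Lell : L n + 1 <= ell n by rewrite -[leRHS]Le; have := expR_ge1Dx (L n); lra.
have ellN : ell n + 1 <= N n by rewrite -[leRHS]Ne; have := expR_ge1Dx (ell n); lra.
have L2 : L n ^+ 2 <= ell n by have := h1 _ Lx1; rewrite !mul1r Le.
have aell : a2 * ell n <= N n.
  by have := h2 (ell n); rewrite expr1 mul1r Ne; apply; lra.
have md8 : 8 <= mean_degree alpha n.+1.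
  rewrite mean_degreeE; apply: le_trans (_ : a1 * (8 / a1) <= _).
    by rewrite mulrC divfK // gt_eqF.
  apply: ler_pM => //; [exact: ltW|by rewrite divr_ge0 // ltW|lra].
have md0 : 0 < mean_degree alpha n.+1 by apply: lt_le_trans md8.
have L20 : 0 < L n ^+ 2 by rewrite exprn_gt0.
have x_gt1 : 1 < N n / L n ^+ 2 by rewrite ltr_pdivlMr // mul1r; lra.
have x_le : N n / L n ^+ 2 <= n.+1%:R.
  by rewrite ler_pdivrMr // ler_peMr // expr_ge1 //; lra.
have n3 : (2 < n.+1)%N by rewrite -(ltr_nat R); lra.
have [D [D0 DN /andP[lo hi]]] := exists_power md8 x_gt1 x_le n3.
have dE : d_star alpha n.+1 = D%:Z.
  by apply: d_star_eq => //; [lra|rewrite lo hi].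
have DE : Dn n = D by rewrite /Dn dE.
have yE : yn n = mean_degree alpha n.+1 ^+ D / N n by rewrite /yn DE.
have lE : lambda_seq alpha n.+1 = expR (- yn n) by rewrite /lambda_seq dE yE.
split=> //.
- rewrite mean_degreeE; apply/andP; split; apply: ler_wpM2r => //; exact: ltW.
- split=> //; rewrite /edge_prob divr_gt0 ?mulr_gt0 //=; last by case: standing.
  rewrite ler_pdivrMr // mul1r; apply: le_trans aell; apply: ler_wpM2r => //; exact: ltW.
- rewrite DE; split=> //; first exact: ltW.
  rewrite yE ler_pdivlMr // mulrC; exact: hi.
split=> //; first by rewrite /kappa_seq lE.
have lnmd : 0 < ln (mean_degree alpha n.+1) by rewrite ln_gt0 //; lra.
rewrite /Delta_seq /ell_star dE yE mulrBl divfK ?gt_eqF // ln_div ?posrE ?exprn_gt0 //.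
by rewrite lnXn // -pmulrn mulr_natl.
Unshelve. all: by end_near.
Qed.

Section Scaled.
Variables a1 a2 : R.
Hypotheses (a10 : 0 < a1) (a12 : a1 <= a2).
Hypothesis near_sc : forall x0, \forall n \near \oo, scaled a1 a2 x0 n.

Let B : R := `|ln a1| + `|ln a2|.
Let B0 : 0 <= B. Proof. by rewrite addr_ge0. Qed.

Lemma log_mean_degree : \forall n \near \oo,
  L n - B <= ln (mean_degree alpha n.+1) <= L n + B.
Proof.
near=> n.
have [[L1 Le _] /andP[lo hi] [md8 _] _ _] : scaled a1 a2 1 n by near: n; apply: near_sc.
have ell0 : 0 < ell n by rewrite -Le expR_gt0.
have md0 : 0 < mean_degree alpha n.+1 by apply: lt_le_trans md8.
have a20 : 0 < a2 by apply: lt_le_trans a12.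
have b1 : - `|ln a1| <= ln a1 by rewrite lerNl -normrN ler_norm.
have b2 : ln a2 <= `|ln a2| by apply: ler_norm.
have p1 : 0 <= `|ln a1| by []. have p2 : 0 <= `|ln a2| by [].
have l1 : ln (a1 * ell n) <= ln (mean_degree alpha n.+1) by rewrite ler_ln ?posrE //; apply: mulr_gt0.
have l2 : ln (mean_degree alpha n.+1) <= ln (a2 * ell n) by rewrite ler_ln ?posrE //; apply: mulr_gt0.
by move: l1 l2; rewrite [ln (a1 * _)]lnM ?posrE // [ln (a2 * _)]lnM ?posrE // /B => *; lra.
Unshelve. all: by end_near.
Qed.

Section DeltaLimit.
Variable Delta : R.
Hypotheses (Delta0 : 0 <= Delta) (Delta_lim : Delta_seq alpha n @[n --> \oo] --> Delta).

Let Delta_near (e : R) : 0 < e -> \forall n \near \oo, `|Delta - Delta_seq alpha n.+1| < e.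
Proof.
move=> e0; apply: (@near_succ (fun n => `|Delta - Delta_seq alpha n| < e)).
by move/cvgrPdist_lt : Delta_lim; apply.
Qed.

(** By the choice of [ell_star], [yn] is the mean degree to the power [Delta_seq]. The logarithm of
    the mean degree is [L n] up to a constant, so [yn] is [log n] to the power [Delta + o(1)], and
    [e] absorbs constant factors. *)
Lemma yn_upper (e C : R) : 0 < e -> 0 < C ->
  \forall n \near \oo, C * yn n <= expR ((Delta + e) * L n).
Proof.
move=> e0 C0; have D0 := Delta0; near=> n.
have [[L1 Le _] _ [md8 _] [_ _ _ y0] [_ _ DE]] : scaled a1 a2 1 n by near: n; apply: near_sc.
have y00 : 0 < yn n by apply: lt_le_trans y0; rewrite invr_gt0 exprn_gt0 // (lt_le_trans ltr01).
have /andP[lo hi] : L n - B <= ln (mean_degree alpha n.+1) <= L n + B.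
  by near: n; apply: log_mean_degree.
have : `|Delta - Delta_seq alpha n.+1| < e / 2 by near: n; apply: Delta_near; rewrite divr_gt0.
rewrite ltr_norml => /andP[d1 d2].
have Lbig : 2 / e * ((Delta + e / 2) * B + ln C) <= L n by near: n; apply: loglog_ge.
have lnmd : 0 <= ln (mean_degree alpha n.+1) by rewrite ln_ge0 //; lra.
have -> : C * yn n = expR (ln C + ln (yn n)) by rewrite expRD !lnK ?posrE.
rewrite ler_expR -DE.
have h1 : Delta_seq alpha n.+1 * ln (mean_degree alpha n.+1) <=
    (Delta + e / 2) * (L n + B).
  apply: le_trans (_ : (Delta + e / 2) * ln (mean_degree alpha n.+1) <= _).
    by apply: ler_wpM2r => //; lra.
  by apply: ler_wpM2l => //; lra.
have e2 : 0 < e / 2 by rewrite divr_gt0.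
move: Lbig; rewrite -(ler_pM2l e2).
have -> : e / 2 * (2 / e * ((Delta + e / 2) * B + ln C)) = (Delta + e / 2) * B + ln C.
  by field; rewrite gt_eqF.
move: h1; rewrite !mulrDl !mulrDr; lra.
Unshelve. all: by end_near.
Qed.

Lemma yn_lower (e C : R) : 0 < e -> 0 < C ->
  \forall n \near \oo, C * expR ((Delta - e) * L n) <= yn n.
Proof.
move=> e0 C0; have D0 := Delta0; near=> n.
have [[L1 Le _] _ [md8 _] [_ _ _ y0] [_ _ DE]] : scaled a1 a2 1 n by near: n; apply: near_sc.
have y00 : 0 < yn n by apply: lt_le_trans y0; rewrite invr_gt0 exprn_gt0 // (lt_le_trans ltr01).
have /andP[lo hi] : L n - B <= ln (mean_degree alpha n.+1) <= L n + B.
  by near: n; apply: log_mean_degree.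
have : `|Delta - Delta_seq alpha n.+1| < e / 2 by near: n; apply: Delta_near; rewrite divr_gt0.
rewrite ltr_norml => /andP[d1 d2].
have Lbig : 2 / e * (`|Delta - e / 2| * B + ln C) <= L n by near: n; apply: loglog_ge.
have lnmd : 0 <= ln (mean_degree alpha n.+1) by rewrite ln_ge0 //; lra.
have -> : C * expR ((Delta - e) * L n) = expR (ln C + (Delta - e) * L n) by rewrite expRD lnK ?posrE.
rewrite -(@lnK _ (yn n)) ?posrE // ler_expR -DE.
apply: le_trans (_ : (Delta - e / 2) * ln (mean_degree alpha n.+1) <= _); last first.
  by apply: ler_wpM2r => //; lra.
have h1 : (Delta - e / 2) * L n - `|Delta - e / 2| * B <= (Delta - e / 2) * ln (mean_degree alpha n.+1).
  rewrite lerBlDr -lerBlDl -mulrBr; apply: le_trans (ler_norm _) _; rewrite normrM.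
  apply: ler_wpM2l => //; rewrite ler_norml; lra.
have e2 : 0 < e / 2 by rewrite divr_gt0.
move: Lbig; rewrite -(ler_pM2l e2).
have -> : e / 2 * (2 / e * (`|Delta - e / 2| * B + ln C)) = `|Delta - e / 2| * B + ln C.
  by field; rewrite gt_eqF.
move: h1; rewrite !mulrBl; lra.
Unshelve. all: by end_near.
Qed.

(** If [Delta] were positive, [yn_lower] would make [yn] at least [2] and keep [lambda_seq] below
    [1 / 3]. *)
Lemma lambda1_Delta0 : lambda_seq alpha n @[n --> \oo] --> (1 : R) -> Delta = 0.
Proof.
move=> lam; apply/eqP; rewrite eq_le Delta0 andbT leNgt; apply/negP => Dp.
have [n [h1 h2 h3]] : exists n, [/\ 2 * expR ((Delta - Delta) * L n) <= yn n,
    `|1 - lambda_seq alpha n.+1| < 1 / 2 & scaled a1 a2 1 n].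
  apply: (@filter_ex _ \oo); near=> n; split; near: n.
  - exact: yn_lower.
  - apply: (@near_succ (fun n => `|1 - lambda_seq alpha n| < 1 / 2)).
    by move/cvgrPdist_lt : lam; apply.
  - exact: near_sc.
case: h3 => _ _ _ _ [lE _ _]; move: h1 h2.
rewrite subrr mul0r expR0 mulr1 lE ltr_norml => y2 /andP[_ h].
have : expR (- yn n) <= 1 / 3.
  apply: le_trans (_ : expR (- 2) <= _); first by rewrite ler_expR lerN2.
  by rewrite expRN div1r lef_pV2 ?posrE ?expR_gt0 //; have := expR_ge1Dx (2 : R); lra.
lra.
Unshelve. all: by end_near.
Qed.

End DeltaLimit.

Definition good (K eps : R) (n : nat) (G : graph 'I_n.+1) : Prop :=
  [/\ forall v, #|nbrs G [set: 'I_n.+1]%SET v|%:R <= K * ell n,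
      quasirandom (edge_prob alpha n.+1) (18 / eps ^+ 2) eps G &
      regular_layers ord0 (N n) (mean_degree alpha n.+1) (Dn n) eps G].

(** The bound [1 <= kappa_seq] makes the mean of layer [D] at least of order [n / L], which
    diverges, so that this layer concentrates. The constant [2 * (a2 + 2)] reduces the degree
    estimate to [N n * expR (- (2 * ell n))], the inverse of [N n]. *)
Lemma good_prob (eps eta : R) : 0 < eps <= 1 / 8 -> 0 < eta ->
  (\forall n \near \oo, 1 <= kappa_seq alpha n) ->
  \forall n \near \oo, er_prob (edge_prob alpha n.+1) (fun G : graph 'I_n.+1 => ~ good (2 * (a2 + 2)) eps G) <= eta.
Proof.
move=> eps01 eta0 kap.
have /andP[eps0 eps8] := eps01.
have eps1 : 0 < eps <= 1 by rewrite eps0; lra.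
have lin1 (x : R) : x <= eta / 8 -> 2 * x <= eta / 4 by lra.
have lin2 (x y : R) : x <= eta / 16 -> y <= eta / 16 -> 4 * x + y <= 5 * (eta / 16) by lra.
have lin3 : eta / 8 + (eta / 4 + 5 * (eta / 16)) <= eta by lra.
have eta4 : 0 < eta / 16 by rewrite divr_gt0.
have [t0 ht] := expRN_small eta4.
have half0 : 0 < 1 / 2 :> R by [].
have [t1 ht1] := expRN_small half0.
have e2 : 0 < eps ^+ 2 by rewrite exprn_gt0.
have [x1 h1] := @poly_le_expR R 1 1 2 ltr01.
have mt' (m l x : R) : 400 / (eps ^+ 2 * a1) * Num.max t0 t1 <= x -> x <= l -> a1 * l <= m ->
    Num.max t0 t1 <= eps ^+ 2 * m / 400.
  move=> hx xl lm.
  have p400 : 0 < 400 :> R by rewrite ltr0n.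
  have e3 : 0 < eps ^+ 2 * a1 / 400 by apply: divr_gt0 p400; apply: mulr_gt0.
  have -> : Num.max t0 t1 = eps ^+ 2 * a1 / 400 * (400 / (eps ^+ 2 * a1) * Num.max t0 t1).
    by field; rewrite !gt_eqF.
  apply: le_trans (_ : eps ^+ 2 * a1 / 400 * l <= _).
    by rewrite ler_pM2l //; apply: le_trans xl.
  have -> : eps ^+ 2 * a1 / 400 * l = eps ^+ 2 * (a1 * l) / 400 by ring.
  by rewrite ler_pM2r ?invr_gt0 ?p400 // ler_pM2l.
near=> n.
have k1 : 1 <= kappa_seq alpha n.+1.
  by near: n; apply: (@near_succ (fun n => 1 <= kappa_seq alpha n)).
have [[L1 Le Ne] /andP[lo hi] [md8 /andP[q0 q1]] [D0 DN mdD y0] [_ kE _]] : scaled a1 a2 1 n.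
  by near: n; apply: near_sc.
have L0 : 0 < L n by apply: lt_le_trans L1.
have q01 : 0 <= edge_prob alpha n.+1 <= 1 by rewrite ltW.
have b1 : 400 / (eps ^+ 2 * a1) * Num.max t0 t1 <= L n by near: n; apply: loglog_ge.
have b2 : 12 / eps ^+ 2 * t0 <= L n by near: n; apply: loglog_ge.
have b3 : 48 / eps <= L n by near: n; apply: loglog_ge.
have b4 : 8 / eta <= L n by near: n; apply: loglog_ge.
have b5 : x1 <= L n by near: n; apply: loglog_ge.
have Lell : L n <= ell n by rewrite -[leRHS]Le le_expR.
have ellN : ell n <= N n by rewrite -[leRHS]Ne le_expR.
have L2 : L n ^+ 2 <= N n by apply: le_trans ellN; have := h1 _ b5; rewrite !mul1r Le.
have N8 : (N n)^-1 <= eta / 8.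
  rewrite -[leRHS]invrK lef_pV2 ?posrE ?invr_gt0 ?divr_gt0 // invf_div.
  exact: le_trans b4 (le_trans Lell ellN).
have p1 : er_prob (edge_prob alpha n.+1) (fun G : graph 'I_n.+1 => ~ (forall v,
    #|nbrs G [set: 'I_n.+1]%SET v|%:R <= 2 * (a2 + 2) * ell n)) <= eta / 8.
  apply: le_trans (max_degree_prob 'I_n.+1 q01 _) _; rewrite card_ord -mean_degree_edge.
  apply: le_trans N8; apply: le_trans (_ : N n * expR (- (2 * ell n)) <= _).
    rewrite ler_pM2l // ler_expR lerBlDr; apply: le_trans hi _.
    by rewrite le_eqVlt; apply/orP; left; apply/eqP; field.
  by rewrite -mulrN expRM_natl expRN Ne expr2 mulrA mulfV ?mul1r.
have p2 : er_prob (edge_prob alpha n.+1) (fun G : graph 'I_n.+1 =>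
    ~ quasirandom (edge_prob alpha n.+1) (18 / eps ^+ 2) eps G) <= eta / 4.
  apply: le_trans (quasirandom_prob 'I_n.+1 q01 eps1) _; rewrite card_ord.
  apply: le_trans (_ : 2 * (N n)^-1 <= _); last exact: lin1.
  apply: ler_wpM2l => //; rewrite lef_pV2 ?posrE ?exprn_gt0 // -natrX ler_nat.
  exact/ltnW/ltn_expl.
have mt := mt' _ _ _ b1 Lell lo.
move: mt; rewrite ge_max => /andP[m0 m1].
have p3 : er_prob (edge_prob alpha n.+1) (fun G : graph 'I_n.+1 =>
    ~ regular_layers ord0 (N n) (mean_degree alpha n.+1) (Dn n) eps G) <= 5 * (eta / 16).
  have nE : N n = #|'I_n.+1|%:R by rewrite card_ord.
  have DN' : (Dn n < #|'I_n.+1|)%N by rewrite card_ord ltnW.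
  have xD : mean_degree alpha n.+1 ^+ (Dn n).-1 / N n <= eps / 48.
    rewrite ler_pdivrMr //; apply: le_trans mdD _; rewrite mulrC ler_pM2r //.
    rewrite -[leRHS]invrK lef_pV2 ?posrE ?invr_gt0 ?divr_gt0 ?exprn_gt0 // invf_div.
    by apply: le_trans b3 _; rewrite expr2 ler_peMl // ltW.
  apply: le_trans (regular_layers_prob ord0 q01 nE (mean_degree_edge n) D0 DN' md8 eps01 xD
     (ht1 _ m1)) _.
  have t2 : t0 <= eps ^+ 2 * (N n * (1 - expR (- (mean_degree alpha n.+1 ^+ Dn n / N n)))) / 12.
    have kap' : (L n)^-1 <= 1 - expR (- yn n).
      by rewrite -(ler_pM2r L0) mulVf ?gt_eqF // -kE.
    have NL : L n <= N n * (1 - expR (- yn n)).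
      apply: le_trans (_ : N n * (L n)^-1 <= _); last by rewrite ler_pM2l.
      by rewrite ler_pdivlMr // -expr2.
    rewrite (_ : t0 = eps ^+ 2 / 12 * (12 / eps ^+ 2 * t0)); last by field; rewrite gt_eqF.
    rewrite [leRHS]mulrAC; apply: ler_wpM2l; first by rewrite divr_ge0 // ltW.
    exact: le_trans b2 NL.
  exact: lin2 (ht _ m0) (ht _ t2).
apply: le_trans lin3.
apply: le_trans (lerD p1 (lerD p2 p3)).
apply: le_trans (lerD (lexx _) (er_prob_or q01 _ _)).
apply: le_trans (er_prob_or q01 _ _).
apply: er_prob_mono => // G _ ng.
have [g1|g1] := pselect (forall v, #|nbrs G [set: 'I_n.+1]%SET v|%:R <= 2 * (a2 + 2) * ell n); last by left.
have [g2|g2] := pselect (quasirandom (edge_prob alpha n.+1) (18 / eps ^+ 2) eps G); last by right; left.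
by right; right => g3; apply: ng.
Unshelve. all: by end_near.
Qed.

Lemma whp_good (eps : R) (A : forall n, graph 'I_n.+1 -> Prop) : 0 < eps <= 1 / 8 ->
  (\forall n \near \oo, 1 <= kappa_seq alpha n) ->
  (\forall n \near \oo, forall G : graph 'I_n.+1, G \subset all_edges 'I_n.+1 ->
     good (2 * (a2 + 2)) eps G -> A n G) -> whp alpha A.
Proof.
move=> eps01 kap hA; apply/cvgrPdist_le => eta eta0; near=> n.
have [_ _ [_ /andP[q0 q1]] _ _] : scaled a1 a2 1 n by near: n; apply: near_sc.
have q01 : 0 <= edge_prob alpha n.+1 <= 1 by rewrite ltW.
have h : er_prob (edge_prob alpha n.+1) (fun G : graph 'I_n.+1 => ~ good (2 * (a2 + 2)) eps G) <= eta.
  by near: n; apply: good_prob.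
have hA' : forall G : graph 'I_n.+1, G \subset all_edges 'I_n.+1 ->
   good (2 * (a2 + 2)) eps G -> A n G by near: n.
rewrite ger0_norm ?subr_ge0 ?er_prob_le1 // -er_prob_not; apply: le_trans h.
by apply: er_prob_mono => // G Gs nA /(hA' G Gs).
Unshelve. all: by end_near.
Qed.

End Scaled.
End Sequences.

(** * Auxiliary inequalities *)

Lemma le_mul_succ (R : realFieldType) (c x : R) : 0 < c -> x <= c * (1 + x / c).
Proof.
by move=> c0; rewrite mulrDr mulr1 [c * (x / c)]mulrC divfK ?gt_eqF // lerDr ltW.
Qed.

Lemma push_numeric (R : realFieldType) (eps e g z : R) : 0 < eps <= 1 / 8 -> 0 <= g -> e <= 1 ->
  eps * (9 + 5 * g) <= e -> z <= 1 + g + eps ->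
  (1 + eps) ^+ 2 * z <= (1 - eps) ^+ 2 * (1 + g + e).
Proof.
move=> /andP[e0 e8] g0 e1 he hz; apply: le_trans (ler_wpM2l (sqr_ge0 _) hz) _.
have eg : 0 <= eps * g by rewrite mulr_ge0 // ltW.
have ee : eps <= e by move: he; rewrite mulrDr; lra.
have h1 : eps * e <= eps by rewrite ler_piMr // ltW.
have h2 : eps * eps <= eps * (1 / 8) by apply: ler_wpM2l => //; apply: ltW.
have h3 : 0 <= eps * eps * (e - eps) by rewrite !mulr_ge0 ?subr_ge0 // ltW.
rewrite -subr_ge0 (_ : _ - _ = (e - eps) - 4 * eps - 4 * (eps * g) - 2 * (eps * e) -
  2 * (eps * eps) + eps * eps * (e - eps)); last by ring.
by move: he; rewrite mulrDr; lra.
Qed.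

Lemma off_numeric (R : realFieldType) (L c md eps y : R) : 1 <= L -> 0 < md -> 0 <= c -> 0 < eps ->
  8 / eps <= L -> 16 * (c * L ^+ 2) <= eps * md -> 2 * y <= eps / 4 ->
  2 * y + (2 / L ^+ 2 + 4 * c * L / md) <= eps /\ 2 * L * (2 / L ^+ 2 + 4 * c * L / md) <= eps.
Proof.
move=> L1 md0 c0 e0 Le Lc hy; have L0 : 0 < L by apply: lt_le_trans L1.
pose v := 2 / L ^+ 2; pose u := 4 * c * L / md.
have u0 : 0 <= u by rewrite !mulr_ge0 ?invr_ge0 // ltW.
have v0 : 0 <= v by rewrite divr_ge0 // exprn_ge0 // ltW.
have hu : L * u <= eps / 4.
  rewrite /u mulrA ler_pdivrMr // (_ : eps / 4 * md = eps * md / 4); last by ring.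
  rewrite (_ : L * (4 * c * L) = 16 * (c * L ^+ 2) / 4); last by field.
  by rewrite ler_pM2r.
have hv : L * v <= eps / 4.
  rewrite (_ : L * v = 2 / L); last by rewrite /v; field; rewrite gt_eqF.
  by rewrite ler_pdivrMr //; move: Le; rewrite ler_pdivrMr //; lra.
have := ler_peMl u0 L1; have := ler_peMl v0 L1; rewrite -/u -/v => h1 h2.
split; first by lra.
by rewrite -mulrA mulrDr; lra.
Qed.

Lemma wasserstein_gibbs_le_card (R : realType) (V : finType) (r : V) (G : graph V) (b1 b2 : R) :
  G \subset all_edges V ->
  wasserstein1 (fun T T' => (tree_dist r T T')%:R) (gibbs r b1 G) (gibbs r b2 G) <= #|V|%:R.
Proof.
move=> Gsub; apply: le_trans (@wasserstein_gibbs_le R V r G Gsub b1 b2 (fun _ _ => 1 / 2) _) _.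
  move=> h h' v _ _ _; rewrite (_ : 1 / 2 + 1 / 2 = 1); last by field.
  by rewrite gerBl overlap_uniform_ge0.
rewrite !sumr_const -!mulr_suml !gibbs_sum1 // !mul1r -mulrnDl (_ : 2^-1 + 2^-1 = 1); last by field.
by rewrite ler_nat max_card.
Qed.

(** * The regimes for large graphs *)

Section Regimes.
Variables (R : realType) (alpha : nat -> R) (a1 a2 : R).
Hypotheses (a10 : 0 < a1) (a12 : a1 <= a2).
Hypothesis near_sc : forall x0, \forall n \near \oo, scaled alpha a1 a2 x0 n.
Local Notation N n := (n.+1%:R : R).
Local Notation ell n := (ln (n.+1%:R : R)).
Local Notation L n := (ln (ln (n.+1%:R : R))).
Local Notation K := (2 * (a2 + 2)).

Let a20 : 0 < a2. Proof. exact: lt_le_trans a12. Qed.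
Let K1 : 1 <= K. Proof. by have := a20; lra. Qed.
Let K0 : 0 < K. Proof. exact: lt_le_trans K1. Qed.

Section Discontinuous.
Variables (Delta : R).
Hypotheses (Delta0 : 0 <= Delta)
  (Delta_lim : Delta_seq alpha n @[n --> \oo] --> Delta)
  (kappa_big : forall A : R, \forall n \near \oo, A <= kappa_seq alpha n).

Lemma discontinuous_whp (gamma : R) : 0 < gamma -> gamma < 1 - Delta ->
  whp alpha (fun n G => 1 / 4 <= normalized_W1 G (1 - Delta - gamma) (1 - Delta)).
Proof.
move=> g0 g1.
have beta10 : 0 < 1 - Delta - gamma by lra.
have betac0 : 0 < 1 - Delta by lra.
pose c1 : R := a1 / 2; have c10 : 0 < c1 by rewrite divr_gt0.
pose c : R := 18 / (1 / 8) ^+ 2.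
have c0 : 0 <= c by rewrite divr_ge0 // exprn_ge0.
pose B1 := 2 * expR (5 + 3 * gamma) * (K / c1) * (4 / gamma * expR (gamma / 4)).
have B10 : 0 < B1.
  apply: mulr_gt0; last by rewrite mulr_gt0 ?expR_gt0 ?divr_gt0.
  by apply: mulr_gt0; [rewrite mulr_gt0 ?expR_gt0|rewrite divr_gt0].
(* The constants are fixed in the order [K'], [M], [M1], [e]. This value makes [gamma * K' / 4]
   equal to [B1 * expR 1], which is below its own exponential. *)
pose K' := 4 / gamma * (B1 * expR 1).
have K'0 : 0 <= K' by rewrite ltW // mulr_gt0 ?divr_gt0 // mulr_gt0 ?expR_gt0.
have B1K' : B1 * expR 1 <= expR (gamma * K' / 4).
  have -> : gamma * K' / 4 = B1 * expR 1 by rewrite /K'; field; rewrite gt_eqF.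
  exact: le_expR.
(* A top set of order [M * n / L] must be so large that a set of order [K' * n / L] captures only a
   small share of the parents. *)
pose M := 1 + 100 * (K * K') / c1.
have KK'c : 0 <= 100 * (K * K') / c1.
  by apply: divr_ge0; [apply: mulr_ge0; [rewrite ler0n|apply: mulr_ge0 => //; apply: ltW]|apply: ltW].
have M_ge1 : 1 <= M by rewrite lerDl.
have KK' : 100 * (K * K') <= c1 * M by apply: le_mul_succ.
have Kc : 0 <= 2 * expR 7 * K * (M + 1) / c1.
  apply: divr_ge0; last exact: ltW.
  apply: mulr_ge0; last by rewrite addr_ge0 // (le_trans ler01).
  by apply: mulr_ge0; [rewrite mulr_ge0 ?expR_ge0|exact: ltW].
pose M1 := 1 + 2 * expR 7 * K * (M + 1) / c1.
have M1_ge1 : 1 <= M1 by rewrite lerDl.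
have M1_big : 2 * expR 7 * K * (M + 1) <= c1 * M1 by apply: le_mul_succ.
have MM : 0 < M + 2 * M1 by have := M_ge1; have := M1_ge1; lra.
(* [e] comes last: it must be small against [M] and [M1], since [expR (e * x)] has to stay bounded
   for [x] up to the order of these constants. *)
pose e := Num.min (gamma / 2) (Num.min (M + 2 * M1)^-1 ((1 - Delta) / 40)).
have e0 : 0 < e by rewrite !lt_min divr_gt0 //= invr_gt0 MM divr_gt0.
have e_gamma : e <= gamma / 2 by rewrite ge_min lexx.
have e_M : e * (M + 2 * M1) <= 1.
  by rewrite -ler_pdivlMr // div1r !ge_min lexx orbT.
have e_beta : e <= (1 - Delta) / 40 by rewrite !ge_min lexx !orbT.
clearbody K' M M1 e.
have pa : 0 < (1 - Delta - gamma) / 2 by rewrite divr_gt0.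
have pb : 0 < (1 - Delta) / 40 by rewrite divr_gt0.
have [x1 h1] := @poly_le_expR R 4 _ 1 pa.
have [x2 h2] := @poly_le_expR R c1^-1 _ 1 ltr01.
have [x3 h3] := @poly_le_expR R (2 * expR 1) _ 1 pb.
have [x4 h4] := @poly_le_expR R (c / a1) _ 3 ltr01.
have p20 : 0 < 1 / 20 :> R by [].
have [t0 ht] := expRN_small p20.
have Ka : 0 < 2 * K / a1 by rewrite divr_gt0 // mulr_gt0.
(* For [Delta = 0] the sequence [yn] may be bounded or tend to zero, so no lower bound on it is
   claimed in that case. *)
have supply : \forall n \near \oo, Delta = 0 \/
    2 * expR ((Delta - e) * L n) <= yn alpha n /\ c * L n <= yn alpha n.
  have [->|Dn0] := eqVneq Delta 0; first by near=> n; left.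
  have Dp : 0 < Delta by rewrite lt_neqAle eq_sym Dn0.
  have D2 : 0 < Delta / 2 by rewrite divr_gt0.
  have [x5 h5] := @poly_le_expR R c _ 1 D2.
  near=> n; right; split.
    by near: n; apply: (yn_lower a10 a12 near_sc Delta0 Delta_lim).
  have x5L : x5 <= L n by near: n; apply: loglog_ge.
  apply: le_trans (_ : 1 * expR ((Delta - Delta / 2) * L n) <= _).
    rewrite mul1r (_ : Delta - Delta / 2 = Delta / 2); last by field.
    by have := h5 _ x5L; rewrite expr1.
  by near: n; apply: (yn_lower a10 a12 near_sc Delta0 Delta_lim).
have eps01 : 0 < (1 / 8 : R) <= 1 / 8 by rewrite lexx divr_gt0.
apply: (whp_good a10 near_sc eps01 (kappa_big 1)); near=> n.
have sc : scaled alpha a1 a2 24 n by near: n; apply: near_sc.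
have [[L24 Le Ne] /andP[md_ge md_le] [md8 /andP[q0 q1]] [D0 DN mdD y0] [_ kE _]] := sc.
have Lx1 : x1 <= L n by near: n; apply: loglog_ge.
have Lx2 : x2 <= L n by near: n; apply: loglog_ge.
have Lx3 : x3 <= L n by near: n; apply: loglog_ge.
have Lx4 : x4 <= L n by near: n; apply: loglog_ge.
have Lt0 : 10 * t0 <= L n by near: n; apply: loglog_ge.
have ln2K : ln (2 * K) <= L n by near: n; apply: loglog_ge.
have c1M1 : c1 * M1 <= L n by near: n; apply: loglog_ge.
have K'L : 2000 * K' <= L n by near: n; apply: loglog_ge.
have LB1 : 6 * expR (10 * (B1 * expR 1)) <= L n by near: n; apply: loglog_ge.
have growth : 2 * K / a1 * yn alpha n <= expR ((Delta + e) * L n).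
  by near: n; apply: (yn_upper a10 a12 near_sc Delta0 Delta_lim).
have size : 8 * M1 <= kappa_seq alpha n.+1.
  by near: n; apply: (@near_succ (fun n => 8 * M1 <= kappa_seq alpha n)); apply: kappa_big.
have sup : Delta = 0 \/ 2 * expR ((Delta - e) * L n) <= yn alpha n /\ c * L n <= yn alpha n.
  by near: n.
move=> G Gsub [deg quasi layers].
have L0 : 0 < L n by apply: lt_le_trans L24.
have LellN : L n <= N n.
  apply: le_trans (_ : ell n <= _); first by rewrite -[leRHS]Le le_expR.
  by rewrite -[leRHS]Ne le_expR.
have beta1L : 4 * L n <= expR ((1 - Delta - gamma) * L n / 2).
  by rewrite [_ * L n / 2]mulrAC; have := h1 _ Lx1; rewrite expr1.
have betacL : 2 * expR 1 * L n <= expR ((1 - Delta) * L n / 40).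
  by rewrite [(1 - Delta) * _ / 40]mulrAC; have := h3 _ Lx3; rewrite expr1.
have Lc1 : L n <= c1 * expR (L n).
  by have := h2 _ Lx2; rewrite expr1 mul1r mulrC ler_pdivrMr // mulrC.
have cL3 : c * L n ^+ 3 <= mean_degree alpha n.+1.
  apply: le_trans md_ge; have := h4 _ Lx4; rewrite mul1r Le mulrAC ler_pdivrMr //.
  by rewrite [a1 * _]mulrC.
have B1L : B1 * expR 1 <= expR (ln (L n / 6) / 10).
  apply: le_trans (le_expR _) _; rewrite ler_expR ler_pdivlMr //.
  rewrite -ler_expR lnK ?posrE ?divr_gt0 // ler_pdivlMr // mulrC.
  by rewrite [B1 * _ * _]mulrC.
have nbig : expR (- (N n / 10)) <= 1 / 20.
  by apply: ht; rewrite ler_pdivlMr // mulrC; apply: le_trans Lt0 LellN.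
have nE : N n = #|'I_n.+1|%:R by rewrite card_ord.
have DN' : ((Dn alpha n).+1 < #|'I_n.+1|)%N by rewrite card_ord.
have md_ge' : a1 * expR (L n) <= mean_degree alpha n.+1 by rewrite Le.
have deg' v : #|nbrs G [set: 'I_n.+1]%SET v|%:R <= K * expR (L n) by rewrite Le.
rewrite kE in size.
rewrite /normalized_W1 /gibbs_measure ler_pdivlMr // mulrC mulrA mulr1.
exact: (@discontinuous_wasserstein R 'I_n.+1 ord0 G Gsub (edge_prob alpha n.+1) (N n)
  (mean_degree alpha n.+1) c (1 / 8) (L n) K a1 (Dn alpha n) nE (mean_degree_edge alpha n) q0 D0
  DN' md8 eps01 c0 a10 md_ge' K1 L24 ln2K LellN mdD deg' quasi layers Delta gamma e M M1 K' g0 beta10 beta1L M_ge1 M1_ge1 M1_big c1M1 Lc1 e0 e_gamma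
  e_M e_beta betacL K'0 KK' K'L nbig B1K' B1L cL3 growth size sup).
Unshelve. all: by end_near.
Qed.

End Discontinuous.

Section Continuous.
Variable k : R.
Hypotheses (k1 : 1 < k) (lam : lambda_seq alpha n @[n --> \oo] --> (1 : R))
  (kap : kappa_seq alpha n @[n --> \oo] --> k).

Let k0 : 0 < k. Proof. exact: lt_trans k1. Qed.

(** From [y / (1 + y) <= 1 - expR (- y)] one gets [y * L <= kappa * (1 + y)]. As [lambda] tends to
    [1], [y] is at most [1]; the inequality then forces [y] to be of order [1 / L], and the factor
    [1 + y] tends to [1]. *)
Lemma yn_loglog (eta : R) : 0 < eta -> \forall n \near \oo, yn alpha n * L n <= k + eta.
Proof.
move=> eta0; pose k' := k + eta / 2.
have eta2 : 0 < eta / 2 by rewrite divr_gt0.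
have k'0 : 0 < k' by rewrite addr_gt0.
have e12 : expR (- 1) <= 1 / 2 :> R.
  by rewrite expRN div1r lef_pV2 ?posrE ?expR_gt0 //; have := expR_ge1Dx (1 : R); lra.
have lin (x : R) : `|1 - x| < 1 / 2 -> 1 / 2 < x by rewrite ltr_norml; lra.
have lin2 (x : R) : `|k - x| < eta / 2 -> x <= k' by rewrite ltr_norml /k'; lra.
near=> n.
have [[L1 _ _] _ _ [_ _ _ y0] [lE kE _]] : scaled alpha a1 a2 1 n by near: n; apply: near_sc.
have L0 : 0 < L n by apply: lt_le_trans L1.
have y00 : 0 < yn alpha n by apply: lt_le_trans y0; rewrite invr_gt0 exprn_gt0.
have hl : 1 / 2 < lambda_seq alpha n.+1.
  apply: lin; near: n; apply: (@near_succ (fun n => `|1 - lambda_seq alpha n| < 1 / 2)).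
  by move/cvgrPdist_lt : lam; apply.
have hk : kappa_seq alpha n.+1 <= k'.
  apply: lin2; near: n; apply: (@near_succ (fun n => `|k - kappa_seq alpha n| < eta / 2)).
  by move/cvgrPdist_lt : kap; apply.
have Lbig : 4 * k' ^+ 2 / eta <= L n by near: n; apply: loglog_ge.
have y1 : yn alpha n <= 1.
  rewrite leNgt; apply/negP => lt; move: hl; rewrite lE ltNge => /negP; apply.
  by apply: le_trans e12; rewrite ler_expR lerN2 ltW.
have yL : yn alpha n * L n <= k' * (1 + yn alpha n).
  have p1 : 0 < 1 + yn alpha n by rewrite addr_gt0.
  have := expRN_leV (ltW y00); rewrite ler_pdivrMr // => h.
  apply: le_trans (ler_wpM2r (ltW L0) h) _; rewrite mulrAC -kE.
  by apply: ler_wpM2r => //; apply: ltW.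
have yle : yn alpha n <= 2 * k' / L n.
  rewrite ler_pdivlMr //; apply: le_trans yL _; rewrite mulrC; apply: ler_wpM2r; first exact: ltW.
  by rewrite -[leRHS]/(1 + 1) lerD2l.
apply: le_trans yL _; rewrite mulrDr mulr1.
have -> : k + eta = k' + eta / 2 by rewrite /k'; field.
rewrite lerD2l; apply: le_trans (ler_wpM2l (ltW k'0) yle) _.
rewrite mulrA ler_pdivrMr //.
have -> : k' * (2 * k') = eta / 2 * (4 * k' ^+ 2 / eta) by field; rewrite gt_eqF.
by rewrite ler_pM2l.
Unshelve. all: by end_near.
Qed.

(** Layer [D] has at most about [k * n / L] vertices, so moving it down entirely changes the
    exponent by at most about [k * (1 - beta) * n] when [beta <= 1]. Bounding [k * (1 - beta)] by
    [1 + g] is therefore what [push] requires. *)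
Lemma continuous_near (beta g eps e tau : R) : 0 < beta -> 0 < eps <= 1 / 8 -> 0 <= g ->
  eps * (9 + 5 * g) <= e -> 0 < tau <= 1 -> e <= tau ^+ 2 / 48 -> k * (1 - beta) <= 1 + g ->
  \forall n \near \oo, forall G : graph 'I_n.+1, G \subset all_edges 'I_n.+1 -> good alpha K eps G ->
  \sum_T gibbs ord0 (beta * L n) G T * \sum_(v in nonroot ord0 G)
    discrepancy R ord0 G (Dn alpha n) (typical ord0 G (edge_prob alpha n.+1) eps (Dn alpha n))
      (depth ord0 T) v <= (4 * g + 4 * tau) * N n.
Proof.
move=> beta0 eps01 g0 eps_g tau01 e_tau kbeta.
have /andP[eps0 eps8] := eps01; have /andP[tau0 tau1] := tau01.
have eps_e : eps <= e.
  apply: le_trans eps_g; rewrite ler_peMr ?(ltW eps0) //; lra.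
have e0 : 0 < e by apply: lt_le_trans eps_e.
have e1 : e <= 1.
  apply: le_trans e_tau _; rewrite ler_pdivrMr // mul1r; apply: le_trans (_ : 1 <= _); last by lra.
  by rewrite expr_le1 // ltW.
pose c : R := 18 / eps ^+ 2.
have c0 : 0 <= c by rewrite divr_ge0 // exprn_ge0 // ltW.
have half0 : 0 < 1 / 2 :> R by [].
have tau2 : 0 < tau / 2 by rewrite divr_gt0.
have tau8 : 0 < tau ^+ 2 / 8 by rewrite divr_gt0 // exprn_gt0.
have [t1 ht1] := expRN_small half0.
have [t2 ht2] := expRN_small tau2.
have b2 : 0 < beta / 2 by rewrite divr_gt0.
have [x1 h1] := @poly_le_expR R (10 * K / (e * a1)) _ 1 b2.
have [x2 h2] := @poly_le_expR R (16 * c / (eps * a1)) _ 2 ltr01.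
have ea : 0 < e * a1 by rewrite mulr_gt0.
have epa : 0 < eps * a1 by rewrite mulr_gt0.
have ln2K0 : 0 <= ln (2 * K) by rewrite ln_ge0 //; have := K1; lra.
have k10 : 0 < k + 1 by rewrite addr_gt0.
have eps2 : 0 < eps / 2 by rewrite divr_gt0.
have eps28 : 0 < eps / 8 by rewrite divr_gt0.
have lin1 (x : R) : `|k - x| < k - 1 -> 1 <= x by rewrite ltr_norml; lra.
have lin2 (x : R) : x <= k + eps / 2 -> (1 - beta) * x <= 1 + g + eps / 2 \/ x < 0.
  move=> hx; have [x0|] := leP 0 x; last by right.
  left; have [b1|b1] := leP beta 1; last first.
    apply: le_trans (_ : 0 <= _); last by lra.
    by rewrite mulr_le0_ge0 //; lra.
  apply: le_trans (_ : (1 - beta) * (k + eps / 2) <= _); first by apply: ler_wpM2l => //; lra.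
  have : (1 - beta) * (eps / 2) <= eps / 2 by rewrite ler_piMl //; [exact: ltW|lra].
  rewrite (_ : (1 - beta) * (k + eps / 2) = k * (1 - beta) + (1 - beta) * (eps / 2)); last by ring.
  by lra.
have lin3 (a b : R) : a <= eps / 2 -> b <= 1 + g + eps / 2 -> a + b <= 1 + g + eps by lra.
have lin4 (x : R) : x <= eps / 8 -> 2 * x <= eps / 4 by lra.
have lin5 (a b : R) : a <= tau / 2 -> b <= tau / 2 -> a + b <= tau by lra.
near=> n.
have [[L24 Le Ne] /andP[md_ge md_le] [md8 /andP[q0 q1]] [D0 DN mdD y0] [_ kE _]] : scaled alpha a1 a2 24 n.
  by near: n; apply: near_sc.
have kap1 : 1 <= kappa_seq alpha n.+1.
  apply: lin1; near: n; apply: (@near_succ (fun n => `|k - kappa_seq alpha n| < k - 1)).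
  by move/cvgrPdist_lt : kap; apply; rewrite subr_gt0.
have yL1 : yn alpha n * L n <= k + 1 by near: n; apply: yn_loglog.
have yL2 : yn alpha n * L n <= k + eps / 2 by near: n; apply: yn_loglog.
have Lx1 : x1 <= L n by near: n; apply: loglog_ge.
have Lx2 : x2 <= L n by near: n; apply: loglog_ge.
have Lt1 : t1 / beta <= L n by near: n; apply: loglog_ge.
have Lt2 : t2 <= L n by near: n; apply: loglog_ge.
have Lt3 : t2 / (tau ^+ 2 / 8) <= L n by near: n; apply: loglog_ge.
have ln2K : ln (2 * K) <= L n by near: n; apply: loglog_ge.
have Lg : (g + 2) / (tau * (beta / 2)) <= L n by near: n; apply: loglog_ge.
have Le8 : 8 / eps <= L n by near: n; apply: loglog_ge.
have Lk8 : (k + 1) / (eps / 8) <= L n by near: n; apply: loglog_ge.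
have LkK : (k + 1) * ln (2 * K) / (eps / 2) <= L n by near: n; apply: loglog_ge.
move=> G Gsub [deg quasi layers].
have L0 : 0 < L n by apply: lt_le_trans L24.
have L1 : 1 <= L n by apply: le_trans L24; rewrite ler1n.
have y00 : 0 < yn alpha n by apply: lt_le_trans y0; rewrite invr_gt0 exprn_gt0.
have LellN : L n <= N n.
  apply: le_trans (_ : ell n <= _); first by rewrite -[leRHS]Le le_expR.
  by rewrite -[leRHS]Ne le_expR.
have ylek : yn alpha n <= (k + 1) / L n by rewrite ler_pdivlMr.
have md0 : 0 < mean_degree alpha n.+1 by apply: lt_le_trans md8.
have cL2 : 16 * (c * L n ^+ 2) <= eps * mean_degree alpha n.+1.
  apply: le_trans (_ : eps * a1 * ell n <= _); last by rewrite -mulrA ler_pM2l.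
  have := h2 _ Lx2; rewrite mul1r Le mulrAC ler_pdivrMr // [ell n * _]mulrC.
  by rewrite -[16 * c * _]mulrA.
have y8 : yn alpha n <= eps / 8.
  apply: le_trans ylek _; rewrite ler_pdivrMr // mulrC -ler_pdivrMr //.
have [off_small outer_small] := off_numeric L1 md0 c0 eps0 Le8 cL2 (lin4 _ y8).
have tail_small : 10 * (K * L n) <= e * a1 * expR (beta * L n / 2).
  have := h1 _ Lx1; rewrite expr1 mulrAC ler_pdivrMr // [expR _ * _]mulrC.
  by rewrite [beta / 2 * _]mulrAC -[10 * K * _]mulrA.
have push_small : (1 + eps) ^+ 2 * (yn alpha n * (ln (2 * K) + (1 - beta) * L n)) <=
    (1 - eps) ^+ 2 * (1 + g + e).
  apply: push_numeric => //; rewrite mulrDr; apply: lin3.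
    apply: le_trans (ler_wpM2r ln2K0 ylek) _.
    by rewrite mulrAC ler_pdivrMr // [leRHS]mulrC -ler_pdivrMr.
  rewrite mulrCA; case: (lin2 _ yL2) => //.
  by rewrite ltNge mulr_ge0 // ltW.
have push_c : 4 * (c * L n) <= mean_degree alpha n.+1 * e.
  apply: le_trans (_ : eps * mean_degree alpha n.+1 <= _); last by rewrite mulrC ler_pM2l.
  apply: le_trans cL2; apply: ler_pM => //; first by rewrite mulr_ge0 // ltW.
    by rewrite ler_nat.
  by apply: ler_wpM2l => //; rewrite expr2 ler_peMl // ltW.
have b2' : expR (- (beta * L n)) <= 1 / 2 by apply: ht1; rewrite mulrC -ler_pdivrMr.
have late_big : g + 2 <= tau * (beta * L n / 2).
  have tb : 0 < tau * (beta / 2) by rewrite mulr_gt0.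
  by rewrite (_ : tau * (beta * L n / 2) = L n * (tau * (beta / 2))) -?ler_pdivrMr //; ring.
have nbig : expR (- (tau ^+ 2 / 8 * N n)) + expR (- N n) <= tau.
  apply: lin5; apply: ht2; last exact: le_trans Lt2 LellN.
  by rewrite mulrC -ler_pdivrMr //; apply: le_trans Lt3 LellN.
have nE : N n = #|'I_n.+1|%:R by rewrite card_ord.
have DN' : ((Dn alpha n).+1 < #|'I_n.+1|)%N by rewrite card_ord.
have md_ge' : a1 * expR (L n) <= mean_degree alpha n.+1 by rewrite Le.
have deg' v : #|nbrs G [set: 'I_n.+1]%SET v|%:R <= K * expR (L n) by rewrite Le.
rewrite kE in kap1.
exact: (@continuous_expected_discrepancy R 'I_n.+1 ord0 G Gsub (edge_prob alpha n.+1) (N n)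
  (mean_degree alpha n.+1) c eps (L n) K a1 (Dn alpha n) nE (mean_degree_edge alpha n) q0 D0
  DN' md8 eps01 c0 a10 md_ge' K1 L24 ln2K mdD deg' quasi layers beta e tau g beta0 b2' e0 eps_e
  tau01 e_tau g0 late_big kap1 off_small (le_trans outer_small eps_e) tail_small push_small push_c nbig).
Unshelve. all: by end_near.
Qed.

(** The bound obtained is linear in [delta]: with [g] and [tau] at most [k * delta], the two
    discrepancies add up to at most [12 * k * delta]. If [k * s] is at least [1] the trivial bound
    by the number of vertices is enough. Otherwise the square of [k * s], which is
    [12 * k ^+ 2 * delta], lies between [12 * k * delta] and [k * s]. *)
Lemma continuous_whp (beta delta : R) : 0 < delta -> 0 < beta -> `|beta - (1 - k^-1)| < delta ->
  whp alpha (fun n G => normalized_W1 G beta (1 - k^-1) <= k * Num.sqrt (12 * delta)).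
Proof.
move=> delta0 beta0 hbeta; set s := Num.sqrt _.
have lin1 (x : R) : `|k - x| < k - 1 -> 1 <= x by rewrite ltr_norml; lra.
have kap1 : \forall n \near \oo, 1 <= kappa_seq alpha n.
  near=> n; apply: lin1; near: n.
  by move/cvgrPdist_lt : kap; apply; rewrite subr_gt0.
have s0 : 0 <= s by apply: sqrtr_ge0.
have s2 : s ^+ 2 = 12 * delta by rewrite sqr_sqrtr // mulr_ge0 // ltW.
have [ks|ks] := leP 1 (k * s).
  have eps01 : 0 < (1 / 8 : R) <= 1 / 8 by rewrite lexx divr_gt0.
  apply: (whp_good a10 near_sc eps01 kap1); near=> n => G Gsub _.
  rewrite /normalized_W1 /gibbs_measure ler_pdivrMr //.
  apply: le_trans (wasserstein_gibbs_le_card _ _ _ Gsub) _.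
  by rewrite card_ord ler_peMl.
have kd : 12 * (k * delta) <= k * s.
  apply: le_trans (_ : k * s * (k * s) <= _); last by rewrite ler_piMr ?(ltW ks) // mulr_ge0 // ltW.
  rewrite (_ : k * s * (k * s) = k * (k * s ^+ 2)); last by ring.
  rewrite s2 (_ : k * (k * (12 * delta)) = k * (12 * (k * delta))); last by ring.
  by rewrite ler_peMl ?(ltW k1) // !mulr_ge0 // ltW.
pose tau := k * delta.
have tau0 : 0 < tau by rewrite mulr_gt0.
have tau01 : 0 < tau <= 1 by rewrite tau0 /=; rewrite -/tau in kd; lra.
have kV : 0 < k^-1 by rewrite invr_gt0.
have kV1 : k^-1 < 1 by rewrite invf_lt1.
(* Above the critical value [push] needs no excess; only the distance below [1 - k^-1] enters. *)
pose gp := Num.max 0 (1 - k^-1 - beta).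
have gp0 : 0 <= gp by rewrite le_max lexx.
have gpd : gp <= delta.
  by rewrite ge_max ltW //=; move: hbeta; rewrite ltr_norml; lra.
pose g := k * gp; have g0 : 0 <= g by rewrite mulr_ge0 // ltW.
pose e := tau ^+ 2 / 48; have e0 : 0 < e by rewrite divr_gt0 // exprn_gt0.
have g9 : 0 < 9 + 5 * g by lra.
pose eps := Num.min (1 / 8) (e / (9 + 5 * g)).
have eps01 : 0 < eps <= 1 / 8 by rewrite lt_min ge_min lexx /= andbT; apply/andP; split; apply: divr_gt0.
have eps_g : eps * (9 + 5 * g) <= e by rewrite -ler_pdivlMr // ge_min lexx orbT.
have eps_0 : eps * (9 + 5 * 0) <= e.
  apply: le_trans eps_g; apply: ler_wpM2l; first by case/andP: eps01 => /ltW.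
  by rewrite mulr0 lerD2l mulr_ge0.
have kbeta : k * (1 - beta) <= 1 + g.
  have -> : 1 + g = k * (k^-1 + gp) by rewrite mulrDr mulfV // gt_eqF.
  rewrite ler_pM2l //; have : 1 - k^-1 - beta <= gp by rewrite le_max lexx orbT.
  by lra.
have kbetac : k * (1 - (1 - k^-1)) <= 1 + 0.
  by rewrite opprB addrCA subrr addr0 mulfV ?gt_eqF // addr0.
have betac0 : 0 < 1 - k^-1 by rewrite subr_gt0.
have tot : 4 * g + 4 * tau + (4 * 0 + 4 * tau) <= k * s.
  have : g <= tau by rewrite ler_pM2l.
  by move: kd; rewrite -/tau; lra.
apply: (whp_good a10 near_sc eps01 kap1); near=> n => G Gsub gd.
have E1 : \sum_T gibbs ord0 (beta * L n) G T * \sum_(v in nonroot ord0 G)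
    discrepancy R ord0 G (Dn alpha n) (typical ord0 G (edge_prob alpha n.+1) eps (Dn alpha n))
      (depth ord0 T) v <= (4 * g + 4 * tau) * N n.
  move: G Gsub gd; near: n; exact: (continuous_near beta0 eps01 g0 eps_g tau01 (lexx e) kbeta).
have E2 : \sum_T gibbs ord0 ((1 - k^-1) * L n) G T * \sum_(v in nonroot ord0 G)
    discrepancy R ord0 G (Dn alpha n) (typical ord0 G (edge_prob alpha n.+1) eps (Dn alpha n))
      (depth ord0 T) v <= (4 * 0 + 4 * tau) * N n.
  move: G Gsub gd {E1}; near: n.
  exact: (continuous_near betac0 eps01 (lexx 0) eps_0 tau01 (lexx e) kbetac).
rewrite /normalized_W1 /gibbs_measure ler_pdivrMr //.
apply: le_trans (@wasserstein_gibbs_le R _ ord0 G Gsub (beta * L n) ((1 - k^-1) * L n)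
  (discrepancy R ord0 G (Dn alpha n) (typical ord0 G (edge_prob alpha n.+1) eps (Dn alpha n))) _) _.
  move=> h h' v ih ih' vn; apply: overlap_discrepancy => //.
  by apply/subsetP => u; rewrite in_set => /andP[].
apply: le_trans (lerD E1 E2) _; rewrite -mulrDl; exact: ler_wpM2r.
Unshelve. all: by end_near.
Qed.

End Continuous.
End Regimes.

(** [1 - lambda_seq] stays away from zero while the iterated logarithm diverges. *)
Lemma kappa_regime_B (R : realType) (alpha : nat -> R) (lambda : R) :
  lambda < 1 -> lambda_seq alpha n @[n --> \oo] --> lambda ->
  forall A : R, \forall n \near \oo, A <= kappa_seq alpha n.
Proof.
move=> l1 lam A; apply: near_inftyS; pose d := (1 - lambda) / 2.
have d0 : 0 < d by rewrite divr_gt0 // subr_gt0.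
have lin (x : R) : `|lambda - x| < d -> d <= 1 - x by rewrite ltr_norml /d; lra.
near=> n.
have h : d <= 1 - lambda_seq alpha n.+1.
  apply: lin; near: n; apply: (@near_succ (fun n => `|lambda - lambda_seq alpha n| < d)).
  by move/cvgrPdist_lt : lam; apply.
have L1 : `|A| / d <= ln (ln (n.+1%:R : R)) by near: n; apply: loglog_ge.
apply: le_trans (ler_norm A) _; rewrite /kappa_seq.
apply: le_trans (_ : d * (`|A| / d) <= _); first by rewrite mulrC divfK // gt_eqF.
by apply: ler_pM => //; [exact: ltW|rewrite divr_ge0 // ltW].
Unshelve. all: by end_near.
Qed.

Theorem theorem1p12 (R : realType) :
  (exists C : R, 0 < C /\
    forall (alpha : nat -> R) (lambda Delta : R) (kappa : \bar R),
      standing_assumptions alpha ->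
      parameter_limits alpha lambda Delta kappa ->
      regime_B lambda Delta \/ regime_Ci lambda kappa ->
      forall delta : R, 0 < delta ->
      exists beta : R,
        [/\ 0 < beta,
            `|beta - beta_c Delta kappa| < delta &
            whp alpha (fun n G =>
              C <= normalized_W1 G beta (beta_c Delta kappa))]) /\
  (forall (alpha : nat -> R) (lambda Delta : R) (kappa : \bar R),
      standing_assumptions alpha ->
      parameter_limits alpha lambda Delta kappa ->
      regime_Cii lambda kappa ->
      forall delta : R, 0 < delta ->
      forall beta : R, 0 < beta ->
        `|beta - beta_c Delta kappa| < delta ->
        whp alpha (fun n G =>
          normalized_W1 G beta (beta_c Delta kappa)
            <= fine kappa * Num.sqrt (12 * delta))).
Proof.
split.
  exists (1 / 4); split; first by rewrite divr_gt0.
  move=> alpha lambda Delta kappa st [[_ lam] [/andP[D0 _] Dlim] [_ klim]] reg delta d0.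
  have [a1 [a2 [a10 a12 sc]]] := near_scaled st.
  (* Both regimes reduce to [kappa = +oo] and [Delta < 1]: in the first, [kappa] is identified by
     uniqueness of limits; in the second, [Delta = 0] because [lambda = 1]. *)
  have [kE D1 kbig] : [/\ kappa = +oo%E, Delta < 1 &
      forall A : R, \forall n \near \oo, A <= kappa_seq alpha n].
    case: reg => [[/andP[_ D1] /andP[_ l1]]|[l1 kE]].
      have kbig := kappa_regime_B l1 lam.
      have kinf : (kappa_seq alpha n)%:E @[n --> \oo] --> +oo%E.
        by apply/cvgeyPge => A; apply: filterS (kbig A) => n; rewrite lee_fin.
      split=> //.
      by rewrite -(cvg_lim (@ereal_hausdorff R) klim) (cvg_lim (@ereal_hausdorff R) kinf).
    split=> //.
      rewrite l1 in lam.
      by rewrite (lambda1_Delta0 a10 a12 sc D0 Dlim lam) ltr01.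
    move=> A; rewrite kE in klim; move/cvgeyPge : klim => /(_ A).
    by apply: filterS => n; rewrite lee_fin.
  have bE : beta_c Delta kappa = 1 - Delta by rewrite /beta_c kE invey /= subr0.
  (* The halves keep [beta] positive and strictly within [delta] of the critical value. *)
  pose gamma := Num.min (delta / 2) ((1 - Delta) / 2).
  have c0 : 0 < 1 - Delta by rewrite subr_gt0.
  have g0 : 0 < gamma by rewrite lt_min !divr_gt0.
  have g1 : gamma <= delta / 2 by rewrite ge_min lexx.
  have g2 : gamma <= (1 - Delta) / 2 by rewrite ge_min lexx orbT.
  exists (1 - Delta - gamma); rewrite bE; split.
  - by lra.
  - by rewrite addrAC subrr add0r normrN gtr0_norm //; lra.
  apply: (discontinuous_whp a10 a12 sc D0 Dlim kbig g0); lra.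
move=> alpha lambda Delta kappa st [[_ lam] [/andP[D0 _] Dlim] [_ klim]] [l1 /andP[k1 k2]].
move=> delta d0 beta b0.
have [a1 [a2 [a10 a12 sc]]] := near_scaled st.
rewrite l1 in lam.
case: kappa klim k1 k2 => [k| |] // klim k1 _.
have k1' : 1 < k by rewrite -lte_fin.
have klim' : kappa_seq alpha n @[n --> \oo] --> k by apply: fine_cvg klim.
have k0 : k != 0 by rewrite gt_eqF // (lt_trans ltr01).
have bE : beta_c Delta k%:E = 1 - k^-1.
  by rewrite /beta_c (lambda1_Delta0 a10 a12 sc D0 Dlim lam) inver (negPf k0) subr0.
rewrite bE /= => hb.
exact: (continuous_whp a10 a12 sc k1' lam klim' d0 b0 hb).
Qed.
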